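(* (1) The mapping $\Phi_+$ is a bijection between $\mathcal O$ and the set of properly bicolored mobiles of positive excess; for $O\in\mathcal O$, the outer degree of $O$ equals the excess of $\Phi_+(O)$. (2) The mapping $\Phi_-$ is a bijection between $\widetilde{\mathcal O}$ and the set of properly bicolored mobiles of negative excess; for $O\in\widetilde{\mathcal O}$, the outer degree of $O$ equals minus the excess of $\Phi_-(O)$.
   Context: A map is a connected finite graph (loops and multiple edges allowed) embedded in the oriented sphere up to orientation-preserving homeomorphism; a corner is the angular sector between two consecutive half-edges around a vertex; the degree of a face is its number of corners. A face-rooted map has a marked root-face; vertices and edges incident to it are outer; the outer degree is the degree of the root-face. An orientation assigns a direction to each edge. A directed path/circuit follows edge directions; a circuit is a simple closed directed path. In a face-rooted orientation a circuit is clockwise if the root-face is on its left, counterclockwise otherwise; the orientation is minimal if it has no counterclockwise circuit; it is clockwise-minimal if it is minimal and each outer edge has a non-root face on its right; it is accessible if every vertex can be reached by a directed path from some outer vertex. It is admissible if the root-face contour is a simple cycle and each outer vertex has indegree $1$. $\mathcal O$ is the set of clockwise-minimal accessible face-rooted orientations; $\widetilde{\mathcal O}$ is the set of admissible ones in $\mathcal O$ (their root-face contour is then a clockwise circuit). A properly bicolored mobile is a plane tree (a map with one face) with vertices colored black and white, every edge joining a black and a white vertex, where black vertices may carry dangling half-edges called buds; its excess is its number of edges minus its number of buds. Local transformation: let $e$ be an edge directed from $v'$ to $v$, with half-edges $h$ (at $v$) and $h'$ (at $v'$); let $c$, $c'$ be the corners preceding $h$, $h'$ in clockwise order around $v$,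 $v'$, contained in faces $f$, $f'$; a black vertex $b_g$ is placed in each face $g$. The local transformation of $e$ creates an edge joining $b_f$ to $v$ in the corner $c$, attaches a bud to $b_{f'}$ pointing toward the corner $c'$, and deletes $e$. For $O\in\mathcal O$ with root-face $f_0$: color the vertices of $O$ white, place a black vertex $b_f$ in each face $f$; $\Phi_+(O)$ is obtained by performing the local transformation of every edge and then deleting $b_{f_0}$ together with its incident buds. For $O\in\widetilde{\mathcal O}$: $\Phi_-(O)$ is obtained by first reversing the direction of every edge of the root-face contour, then performing the local transformation of every edge, and finally deleting $b_{f_0}$, the outer (white) vertices of $O$ and the edges between them. *)

(* Defs.v *)
From mathcomp Require Import all_boot all_order all_fingroup all_algebra.
Set Implicit Arguments. Unset Strict Implicit. Unset Printing Implicit Defensive.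
Import GRing.Theory Num.Theory.

(* A map is given by a finite set D of darts (half-edges), a           *)
(* permutation [s] giving the CLOCKWISE successor of a half-edge around *)
(* its vertex, and a fixed-point-free involution [a] pairing the two    *)
(* half-edges of an edge.  Vertices = s-orbits, edges = a-orbits.       *)
(* A dart d also names the corner preceding d in clockwise order around *)
(* its vertex (between s^-1 d and d).  Faces are the orbits of          *)
(* phi = s o a (perm product (a * s)%g, i.e. x |-> s (a x)) acting on   *)
(* corners.  For an edge traversed in the direction of dart d, the face *)
(* on its left is the face of d and the face on its right is the face of *)
(* a d (= face of s d).                                                 *)
(* An orientation is [out : D -> bool]: out d means the edge of d is    *)
(* directed away from the vertex of d (d is the tail half-edge).        *)

Record fro := FRO {
  oD : finType;
  osig : {perm oD};
  oalp : {perm oD};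
  oout : oD -> bool;
  oroot : oD (* a corner of the root-face; the root face is its phi-orbit *)
}.

Section FRODefs.
Variable O : fro.
Local Notation D := (oD O).
Local Notation s := (@osig O).
Local Notation a := (@oalp O).
Local Notation out := (@oout O).

Definition ophi : {perm D} := (a * s)%g.

Definition samev (x y : D) := fconnect s x y.
Definition samef (x y : D) := fconnect ophi x y.
Definition inroot (x : D) := samef (@oroot O) x.

Definition nverts := fcard s predT.
Definition nedgs := fcard a predT.
Definition nfaces := fcard ophi predT.

Definition is_plane_map :=
  [/\ forall d, a (a d) = d,
      forall d, a d != d,
      forall d d', connect (fun x y => (y == s x) || (y == a x)) d d'
    & nverts + nfaces = nedgs + 2].

Definition is_orientation := forall d, out (a d) = ~~ out d.

Definition is_circuit (c : seq D) :=
  [/\ c != [::], all out c,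
      path.cycle (fun x y => samev (a x) y) c
    & pairwise (fun x y => ~~ samev x y) c].

(* the faces lying on the left of the circuit: the faces reachable from the
   face on the left of its first edge without crossing an edge of the
   circuit; the circuit is clockwise iff the root face is among them *)
Definition left_step (c : seq D) (x y : D) :=
  samef x y || ((y == a x) && (x \notin c) && (a x \notin c)).
Definition clockwise (c : seq D) :=
  connect (left_step c) (head (@oroot O) c) (@oroot O).

Definition minimal := forall c, is_circuit c -> clockwise c.

(* each outer edge has a non-root face on its right *)
Definition cw_minimal :=
  minimal /\
  forall d, out d -> (inroot d || inroot (a d)) -> ~~ inroot (a d).

Definition reach_step (x y : D) := samev x y || (out x && (y == a x)).

Definition accessible :=
  forall d, exists2 r, inroot r & connect reach_step r d.

Definition outdeg := #|[pred x | inroot x]|.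

(* root-face contour is a simple cycle, outer vertices have indegree 1 *)
Definition admissible :=
  [/\ forall x y, inroot x -> inroot y -> samev x y -> x = y,
      forall x, inroot x -> ~~ inroot (a x)
    & forall x, inroot x -> #|[pred y | samev x y & ~~ out y]| = 1].

End FRODefs.

Definition in_O (O : fro) :=
  [/\ is_plane_map O, is_orientation O, cw_minimal O & accessible O].
Definition in_Ot (O : fro) := in_O O /\ admissible O.

Definition fro_iso (O1 O2 : fro) :=
  exists f : oD O1 -> oD O2,
    [/\ bijective f,
        forall x, f (@osig O1 x) = @osig O2 (f x),
        forall x, f (@oalp O1 x) = @oalp O2 (f x),
        forall x, @oout O2 (f x) = @oout O1 x
      & samef (f (@oroot O1)) (@oroot O2)].

(* Mobiles: buds are darts fixed by the involution; colour true = black *)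
Record mobile := Mobile {
  mD : finType;
  msig : mD -> mD;
  malp : mD -> mD;
  mcol : mD -> bool
}.

Definition mnverts (M : mobile) := fcard (@msig M) predT.
Definition mnedges (M : mobile) := #|[pred d | @malp M d != d]| %/ 2.
Definition mnbuds (M : mobile) := #|[pred d | @malp M d == d]|.
Definition excess (M : mobile) : int := (mnedges M)%:Z - (mnbuds M)%:Z.

Definition is_pbmobile (M : mobile) :=
  [/\ injective (@msig M),
      forall d, @malp M (@malp M d) = d,
      forall d d', connect (fun x y => (y == @msig M x) || (y == @malp M x)) d d'
    & mnverts M = mnedges M + 1] /\
  [/\ forall d, @mcol M (@msig M d) = @mcol M d,
      forall d, @malp M d != d -> @mcol M (@malp M d) != @mcol M d
    & forall d, @malp M d == d -> @mcol M d].

Definition mob_iso (M1 M2 : mobile) :=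
  exists f : mD M1 -> mD M2,
    [/\ bijective f,
        forall x, f (@msig M1 x) = @msig M2 (f x),
        forall x, f (@malp M1 x) = @malp M2 (f x)
      & forall x, @mcol M2 (f x) = @mcol M1 x].

(* first iterate f^j x (j >= 1) satisfying P (x if none) *)
Definition nextp (T : finType) (f : T -> T) (P : pred T) (x : T) :=
  let t := traject f (f x) #|T| in nth x t (find P t).

Section Construction.
Variables (D : finType) (s a : {perm D}) (out : D -> bool) (r : D)
          (del : D -> bool).
(* [del d] : the (white) vertex of d is deleted *)
Let phi : {perm D} := (a * s)%g.
Let inr0 (x : D) := fconnect phi r x.

(* mobile darts:
   inl (inl h) : white half-edge created at the head vertex of h, in corner h
   inl (inr h) : black half-edge of the same edge, at b_(face of h), toward corner h
   inr t       : bud at b_(face of t) pointing toward corner t (t a tail) *)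
Definition mdart := ((D + D) + D)%type.

Definition mvalid (x : mdart) : bool :=
  match x with
  | inl (inl h) | inl (inr h) => ~~ out h && ~~ inr0 h && ~~ del h
  | inr t => out t && ~~ inr0 t
  end.

Let validw (h : D) := ~~ out h && ~~ inr0 h && ~~ del h.
Let validc (c : D) := ~~ inr0 c && (out c || ~~ del c).

(* the next corner clockwise around the black vertex of a face: faces are
   walked by phi with the face on the left, hence clockwise around b_f is phi^-1 *)
Definition bnext (c : D) : mdart :=
  let c' := nextp (phi^-1)%g validc c in
  if out c' then inr c' else inl (inr c').

Definition rawsig (x : mdart) : mdart :=
  match x with
  | inl (inl h) => inl (inl (nextp s validw h))
  | inl (inr c) | inr c => bnext c
  end.

Definition rawalp (x : mdart) : mdart :=
  match x with
  | inl (inl h) => inl (inr h)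
  | inl (inr h) => inl (inl h)
  | inr t => inr t
  end.

Definition rawcol (x : mdart) : bool :=
  match x with inl (inl _) => false | _ => true end.

Definition MT := {x : mdart | mvalid x}.

Definition mob_of : mobile :=
  @Mobile MT (fun x => insubd x (rawsig (val x)))
             (fun x => insubd x (rawalp (val x)))
             (fun x => rawcol (val x)).
End Construction.

(* Phi_+ : local transformation of every edge, delete b_(f0) and its buds *)
Definition PhiP (O : fro) : mobile :=
  mob_of (@osig O) (@oalp O) (@oout O) (@oroot O) (fun _ => false).

(* Phi_- : reverse the root-face contour, transform every edge, delete b_(f0),
   the outer white vertices and the edges incident to them *)
Definition rev_out (O : fro) (d : oD O) : bool :=
  if inroot d || inroot (@oalp O d) then ~~ @oout O d else @oout O d.
Definition outer_vertex (O : fro) (d : oD O) : bool :=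
  [exists x, inroot x && samev x d].
Definition PhiM (O : fro) : mobile :=
  mob_of (@osig O) (@oalp O) (rev_out (O:=O)) (@oroot O) (outer_vertex (O:=O)).

(* Main.v *)
Require Import Defs.
From mathcomp Require Import all_boot all_order all_fingroup all_algebra zify.
Set Implicit Arguments. Unset Strict Implicit. Unset Printing Implicit Defensive.
Import GRing.Theory Num.Theory.

(* Let phi be the face permutation of an orientation O, N the set of darts
   outside the root-face, and let shat send an ingoing dart to the next ingoing
   dart around its vertex and fix the outgoing darts.  On N the permutations
   phi^-1 (black vertices) and shat (white vertices) describe the mobile, and
   chi = phi^-1 shat is its contour.  Let par h be the first ingoing dart met
   counterclockwise from the tail of h.

   An Euler inequality V + E + F <= #darts + 2 #components for arbitrary pairs
   of permutations gives a Jordan lemma: cutting along a closed walk whose left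
   sectors contain no edge of the walk separates its two sides.  With it,
   minimality and accessibility force every par-chain to end on the root-face
   contour, and conversely this property implies both.  The chains form a
   forest, so that each edge off the root-face contour reads in the word of chi
   as a balanced word opened by its ingoing dart and closed by its outgoing
   dart.  Hence chi is a single cycle, the mobile is a tree, and O is recovered
   by matching parentheses along the contour; the unmatched ones give the
   root-face.

   For Phi_-, admissibility makes shat fix the ingoing darts of the outer
   vertices, so that the mobile has the same pair (phi^-1, shat); only the
   status of the unmatched half-edges changes, from leaf edges to buds. *)

(** Minimality speaks of circuits, but a cycle of [par] may visit a vertex several times. This is
    why the Jordan lemma is stated for closed walks. The Euler inequality makes no connectedness
    assumption, because it is applied to the map cut along such a walk, where the number of
    components is the unknown. For a tree it has one component, and the same inequality leaves room
    for a single contour cycle. A mobile does not say where its contour should start. The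
    reconstruction takes the start from the periodic walk of steps +1 and -1 read along the contour:
    a walk with positive drift has a last passage, after which it stays above its start, and the
    openings that are never closed become the root-face. With negative drift, the buds that have
    nothing to close are first reread as openings. They are fixed by the white rotation, so the
    construction for positive excess applies unchanged, and these fixed points give the outer
    vertices indegree 1. *)

(** * Orbit counts and the Euler inequality *)

Lemma porbit_fconnect (T : finType) (s : {perm T}) x y :
  (y \in porbit s x) = fconnect s x y.
Proof.
apply/porbitP/idP => [[i ->]|/iter_findex <-]; first by rewrite permX fconnect_iter.
by exists (findex s x y); rewrite permX.
Qed.

Lemma fcard_porbits (T : finType) (s : {perm T}) : fcard s predT = #|porbits s|.
Proof.
have sy := fconnect_sym (@perm_inj T s).
rewrite /n_comp_mem -(@card_in_imset _ _ (porbit s) _).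
  apply: eq_card => A; apply/imsetP/imsetP => [[x _ ->]|[x _ ->]]; first by exists x.
  exists (froot s x); first by rewrite !inE roots_root.
  by apply/eqP; rewrite eq_porbit_mem porbit_fconnect sy connect_root.
move=> x y; rewrite !inE !andbT => /eqP rx /eqP ry /eqP.
rewrite eq_porbit_mem porbit_fconnect => /(fingraph.rootP sy); rewrite rx ry => -> //.
Qed.

Lemma tperm_porbits_le (T : finType) (s : {perm T}) x y :
  #|porbits (tperm x y * s)| <= #|porbits s|.+1.
Proof. have := porbits_mul_tperm s x y => /=; case: (x != y); lia. Qed.

(* An Euler inequality: the labelling [k] plays the role of the connected
   components of the hypermap generated by [s] and [t]. *)
Lemma genus_ineq (T : finType) (s t : {perm T}) : exists k : T -> T,
  [/\ forall x, k (s x) = k x, forall x, k (t x) = k x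
    & #|porbits s| + #|porbits t| + #|porbits (t * s)| <= #|T| + 2 * #|k @: T|].
Proof.
have [n] := ubnP #|[set x | t x != x]|; elim: n t => // n IHn t le_n.
have [t1|] := eqVneq t 1%g.
  exists (froot s); split=> [x|x|].
  - by apply/esym/eqP; rewrite root_connect ?fconnect1 //; apply: fconnect_sym; apply: perm_inj.
  - by rewrite t1 perm1.
  rewrite t1 mul1g.
  have -> : #|froot s @: T| = #|porbits s|.
    rewrite -fcard_porbits /n_comp_mem; apply: eq_card => x.
    have sy := fconnect_sym (@perm_inj T s).
    rewrite !inE andbT; apply/imsetP/idP => [[y _ ->]|/eqP <-]; last by exists x.
    by rewrite roots_root.
  suff : #|porbits (1%g : {perm T})| <= #|T| by lia.
  by rewrite leq_imset_card.
move=> nt1.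
have [x nx] : exists x, t x != x.
  apply/existsP; apply: contraR nt1 => /existsPn H; apply/eqP/permP => x.
  by rewrite perm1; apply/eqP; have := H x; rewrite negbK.
(* [t'] is [t] with [y] cut out of its cycle and fixed: one more orbit, a smaller support. *)
set y := t x in nx; pose t' : {perm T} := (tperm x y * t)%g.
have t'y : t' y = y by rewrite permM tpermR.
have t'E z : t z = t' (tperm x y z) by rewrite permM tpermK.
have lt_n : #|[set z | t' z != z]| < n.
  rewrite -ltnS (leq_trans _ le_n) // ltnS; apply: proper_card; apply/properP; split.
    apply/subsetP => z; rewrite !inE permM; case: tpermP => [->|->|//]; first by rewrite nx.
    by rewrite -/y eqxx.
  exists y; rewrite !inE ?t'y ?eqxx //.
  by rewrite {2}/y (inj_eq perm_inj).
have [k [ks kt Hk]] := IHn _ lt_n.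
have tt' : t = (tperm x y * t')%g by rewrite /t' mulgA tperm2 mul1g.
have cyt : #|porbits t|.+1 = #|porbits t'|.
  have := porbits_mul_tperm t' x y => /=; rewrite -tt' eq_sym nx.
  have -> : x \notin porbit t' y; last by rewrite /=; lia.
  apply/negP => /porbitP[i]; have -> : (t' ^+ i)%g y = y; last by move/eqP; rewrite eq_sym (negPf nx).
  by elim: i => [|i IHi]; rewrite ?perm1 // expgSr permM IHi.
(* Going back from [t'] to [t] costs one orbit of [t]. Inside a component the product gains at most
   one orbit; across two components it loses one, while at most one label disappears. *)
case: (eqVneq (k x) (k y)) => [kxy|kxy].
  exists k; split=> // [z|]; first by rewrite t'E kt; case: tpermP => [->|->|].
  have := tperm_porbits_le (t' * s) x y; rewrite mulgA -tt' => H.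
  by apply: leq_trans _ Hk; rewrite -cyt addnS addSn -addnS leq_add2l.
have kts z i : k (((t' * s)%g ^+ i)%g z) = k z.
  by elim: i => [|i IHi]; rewrite ?perm1 // expgSr permM permM ks kt.
pose k' z := if k z == k y then k x else k z.
exists k'; split=> [z|z|]; first by rewrite /k' ks.
  by rewrite /k' t'E kt; case: tpermP => [->|->|//]; rewrite eqxx if_same.
have := porbits_mul_tperm (t' * s) x y => /=; rewrite mulgA -tt' eq_sym nx.
have -> : x \notin porbit (t' * s) y.
  by apply/negP => /porbitP[i xE]; move: kxy; rewrite xE kts eqxx.
have le1 : #|k @: T| <= (#|k' @: T|).+1.
  rewrite (cardsD1 (k y) (k @: T)) imset_f // add1n ltnS subset_leq_card //.
  apply/subsetP => z; rewrite !inE => /andP[zy /imsetP[w _ zE]].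
  by apply/imsetP; exists w; rewrite // /k' -zE (negPf zy).
rewrite /= => H.
have {}H : #|porbits (t * s)|.+1 = #|porbits (t' * s)|.
  by move: H; rewrite [_ + _.*2]addn2 [RHS]addn1 => -[].
have le2 : (#|porbits s| + #|porbits t| + #|porbits (t * s)|).+2 <= #|T| + 2 * #|k @: T|.
  by apply: leq_trans _ Hk; rewrite -cyt -H !addnS !addSn.
rewrite -2!ltnS; apply: leq_trans le2 _.
by rewrite -!addnS leq_add2l; move: le1; move: #|_| #|_| => b c; lia.
Qed.

(** Connectedness through invariant predicates: this form passes to other pairs of permutations
    without building paths. *)
Definition transitive2 (T : finType) (f g : T -> T) :=
  forall P : pred T, (forall x, P (f x) = P x) -> (forall x, P (g x) = P x) ->
  forall x y, P x = P y.

Lemma connect_transitive2 (T : finType) (f g : T -> T) :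
  injective f -> injective g ->
  (forall x y, connect (fun x y => (y == f x) || (y == g x)) x y) <->
  transitive2 f g.
Proof.
move=> fI gI; set e := (fun _ => _); split=> [H P Pf Pg x y|H x y].
  have /connectP[p] := H x y; elim: p x => [|z p IHp] x /=; first by move=> _ ->.
  by move=> /andP[/orP[/eqP->|/eqP->] pp] E; rewrite -(IHp _ pp E).
rewrite -(H (connect e x) _ _ x y) //.
- move=> z; apply/idP/idP => [|c]; last by apply: connect_trans c (connect1 _); rewrite /e eqxx.
  move=> c; apply: connect_trans c _; have : fconnect f (f z) z by rewrite fconnect_sym ?fconnect1.
  by apply: connect_sub => u v /= /eqP <-; apply: connect1; rewrite /e eqxx.
- move=> z; apply/idP/idP => [|c]; last by apply: connect_trans c (connect1 _); rewrite /e eqxx orbT.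
  move=> c; apply: connect_trans c _; have : fconnect g (g z) z by rewrite fconnect_sym ?fconnect1.
  by apply: connect_sub => u v /= /eqP <-; apply: connect1; rewrite /e eqxx orbT.
Qed.

(** * First-return maps of a permutation *)

Section NextP.
Variables (T : finType) (f : T -> T) (P : pred T).
Hypothesis fI : injective f.

Let nextp_def x : nextp f P x =
  nth x (traject f (f x) #|T|) (find P (traject f (f x) #|T|)).
Proof. by []. Qed.

Lemma nextp_ex x : (exists n, P (iter n.+1 f x)) ->
  exists n, [/\ nextp f P x = iter n.+1 f x, P (nextp f P x)
             & forall m, m < n -> ~~ P (iter m.+1 f x)].
Proof.
case=> n0 Pn0; have hP : has P (traject f (f x) #|T|).
  apply/hasP; exists (iter n0.+1 f x) => //; apply/trajectP.
  have : fconnect f (f x) (iter n0.+1 f x) by rewrite iterSr fconnect_iter.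
  move=> /[dup] /iter_findex E /findex_max lt.
  exists (findex f (f x) (iter n0.+1 f x)) => //.
  by rewrite (leq_trans lt) // -size_orbit -(card_uniqP (orbit_uniq _ _)) max_card.
have tE y i : i < #|T| -> nth y (traject f (f x) #|T|) i = iter i.+1 f x.
  by move=> lt; rewrite (set_nth_default (f x)) ?size_traject // nth_traject // -iterSr.
exists (find P (traject f (f x) #|T|)); split.
- by rewrite nextp_def tE // -[X in _ < X](size_traject f (f x)) -has_find.
- by rewrite nextp_def nth_find.
- move=> m lt; have ltT : m < #|T|.
    by rewrite (leq_trans lt) // -[X in _ <= X](size_traject f (f x)) find_size.
  by have := before_find x lt; rewrite tE // => ->.
Qed.

Lemma nextpE x n : P (iter n.+1 f x) -> (forall m, m < n -> ~~ P (iter m.+1 f x)) ->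
  nextp f P x = iter n.+1 f x.
Proof.
move=> Pn H; have [|m [E Pm Hm]] := nextp_ex (x := x); first by exists n.
case: (ltngtP m n) => [lt|lt|<- //].
  by move: (H _ lt); rewrite -E Pm.
by move: (Hm _ lt); rewrite Pn.
Qed.

(** The last branch is the default of [nextp]: an orbit that misses [P] leaves [x] in place. *)
Lemma nextp_step x : nextp f P x = if P (f x) then f x else
  if [exists y, fconnect f x y && P y] then nextp f P (f x) else x.
Proof.
case: ifP => [Pfx|nPfx]; first by apply: (@nextpE x 0).
case: ifP => [/existsP[y /andP[xy Py]]|/existsPn H].
  have [n En] : exists n, y = iter n.+1 f x.
    exists (findex f (f x) y); rewrite iterSr iter_findex //.
    by rewrite -same_fconnect1.
  case: n En => [|n] En; first by move: Py; rewrite En /= nPfx.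
  have [|m [E Pm Hm]] := nextp_ex (x := f x); first by exists n; rewrite -iterSr -En.
  rewrite E -iterSr; apply: nextpE; first by rewrite iterSr -E.
  by case=> [|i] lti; rewrite ?nPfx // iterSr; apply: Hm.
rewrite nextp_def; set t := traject _ _ _.
rewrite nth_default // leqNgt -has_find; apply/hasPn => y /trajectP[i _ ->].
have := H (iter i f (f x)); rewrite -iterSr fconnect_iter /= => -> //.
Qed.

Lemma nextp_P x y : fconnect f x y -> P y -> P (nextp f P x).
Proof.
move=> xy Py; have [|n [_ //]] := nextp_ex (x := x).
by exists (findex f (f x) y); rewrite iterSr iter_findex // -same_fconnect1.
Qed.

Lemma nextp_fconnect x : fconnect f x (nextp f P x).
Proof.
rewrite nextp_def; set t := traject _ _ _.
have [lt|ge] := ltnP (find P t) (size t); last by rewrite nth_default // connect0.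
have /trajectP[i _ ->] := mem_nth x lt.
by rewrite -iterSr fconnect_iter.
Qed.

Lemma nextp_id x : P x -> P (nextp f P x).
Proof. exact/nextp_P/connect0. Qed.

(** Two points with a common first return lie on one orbit, and the nearer one would have stopped
    the walk of the other. *)
Lemma nextp_inj : {in P &, injective (nextp f P)}.
Proof.
move=> x y Px Py E.
have exn z : P z -> exists n, P (iter n.+1 f z).
  by move=> Pz; exists (fingraph.order f z).-1; rewrite orderSpred iter_order.
have [n [En _ Hn]] := nextp_ex (exn x Px); have [m [Em _ Hm]] := nextp_ex (exn y Py).
have iI k : injective (iter k f) by elim: k => // k IHk u v /= /fI /IHk.
wlog le : n m x y Px Py E En Hn Em Hm / n <= m.
  by move=> W; case: (leqP n m) => [|/ltnW] le; [|apply/esym]; eapply W; eauto.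
have {}E : x = iter (m - n) f y.
  by apply: (iI n.+1); rewrite -iterD addSn subnKC // -En E Em.
move: (m - n) (leq_subr n m) E => [|d] // ltm E.
by have := Hm d ltm; rewrite -E -[P x]/(x \in P) Px.
Qed.

Lemma fconnect_nextp x y : P x -> P y ->
  fconnect (nextp f P) x y = fconnect f x y.
Proof.
move=> Px Py; apply/idP/idP.
  by apply: connect_sub => u v /= /eqP <-; apply: nextp_fconnect.
move=> xy; have [n] := ubnP (findex f x y); elim: n x Px xy => // n IHn x Px xy lt.
case E : (findex f x y) => [|k].
  by move/eqP: E; rewrite findex_eq0 => /eqP ->; apply: connect0.
have yE : y = iter k.+1 f x by rewrite -E iter_findex.
have [|m [Em Pm Hm]] := nextp_ex (x := x); first by exists k; rewrite -yE.
apply: connect_trans (fconnect1 _ x) _ => /=.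
have le : m <= k by rewrite leqNgt; apply/negP => /Hm; rewrite -yE Py.
have yE2 : y = iter (k - m) f (nextp f P x) by rewrite Em -iterD addnS subnK.
have lto : k.+1 < fingraph.order f x by rewrite -E findex_max.
have oE : fingraph.order f (nextp f P x) = fingraph.order f x.
  by apply/eq_card => z; rewrite !inE -(same_connect (fconnect_sym fI) (nextp_fconnect x)).
apply: IHn => //; first by rewrite yE2 fconnect_iter.
rewrite yE2 findex_iter; first by move: lt; rewrite E; lia.
by rewrite oE; lia.
Qed.

End NextP.

Lemma nextp_step_in (T : finType) (f : T -> T) (P : pred T) x :
  injective f -> P (nextp f P x) ->
  nextp f P x = if P (f x) then f x else nextp f P (f x).
Proof.
move=> fI Pn; rewrite nextp_step //; case: ifP => // _; case: ifP => // /existsPn H.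
by have := H (nextp f P x); rewrite nextp_fconnect Pn.
Qed.

(** * A Jordan lemma for plane maps *)

(** The inverse of an injection of a finite type is one of its iterates, so forward stability is
    enough. *)
Lemma homo_inj_closed (T : finType) (f : T -> T) (P : pred T) : injective f ->
  (forall x, P x -> P (f x)) -> forall x, P (f x) = P x.
Proof.
move=> fI H x; apply/idP/idP; last exact: H.
have /iter_findex E : fconnect f (f x) x by rewrite fconnect_sym // fconnect1.
move=> Px; rewrite -E; elim: (findex _ _ _) => //= n; exact: H.
Qed.

(** Each orbit of [f] meets [P] in exactly one orbit of the first-return map; the retraction [h]
    matches the two families. *)
Lemma fcard_nextp (T : finType) (f g : T -> T) (P : pred T) :
  injective f -> injective g -> (forall x, exists2 y, fconnect f x y & P y) ->
  (forall x, P x -> g x = nextp f P x) -> fcard g P = fcard f predT.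
Proof.
move=> fI gI meet gE.
have nP x : P (nextp f P x) by have [y xy /(nextp_P fI xy)] := meet x.
pose h x := if P x then x else nextp f P x.
have hP x : P (h x) by rewrite /h; case: ifP.
have hc x : fconnect f x (h x).
  by rewrite /h; case: ifP => _; [apply: connect0|apply: nextp_fconnect].
have gP x : P x -> P (g x) by move=> Px; rewrite gE.
have gn x y : P x -> fconnect g x y = fconnect (nextp f P) x y.
  move=> Px; have it i : P (iter i g x) /\ iter i g x = iter i (nextp f P) x.
    by elim: i => // i [Pi Ei] /=; split; [apply: gP|rewrite gE // Ei].
  by apply/idP/idP => /iter_findex <-; [rewrite (it _).2|rewrite -(it _).2];
    apply: fconnect_iter.
have clP : fclosed g P.
  by move=> x y /= /eqP <-; rewrite !unfold_in (homo_inj_closed gI gP).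
rewrite (@adjunction_n_comp _ _ h (frel g) (frel f) (fconnect_sym gI) (fconnect_sym fI) P clP).
  by apply: eq_n_comp_r => x; rewrite !inE; exact: hP.
split=> [x Px|x y _]; first by exists x; rewrite /h (Px : P x) connect0.
rewrite gn // fconnect_nextp // -(same_connect (fconnect_sym fI) (hc x)).
by rewrite -(same_connect_r (fconnect_sym fI) (hc y)).
Qed.

Lemma card_involution (T : finType) (a : {perm T}) :
  (forall x, a (a x) = x) -> (forall x, a x != x) -> #|T| = fcard a predT * 2.
Proof.
move=> aK aN; rewrite (@fcard_order_set _ a (@perm_inj _ a) 2 predT) //.
apply/subsetP => x _; rewrite !inE.
rewrite (@order_cycle _ _ [:: x; a x] _ _ x) ?inE ?eqxx //=.
  by rewrite aK !eqxx.
by rewrite inE eq_sym aN.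
Qed.

Section Jordan.
Variables (D : finType) (s a : {perm D}).
Let phi : {perm D} := (a * s)%g.
Hypotheses (aK : forall d, a (a d) = d) (aN : forall d, a d != d)
  (sa_trans : transitive2 s a)
  (euler : fcard s predT + fcard phi predT = fcard a predT + 2).
Variable C : pred D.
Let B y := C y || C (a y).
(** [C] holds the darts of a closed walk in the direction of travel, [B] both darts of its edges.
    Having arrived through [a x], the walk goes on by the first of its own edges met clockwise, that
    is, on the left. *)
Let nx x := nextp s B (a x).
Hypotheses (CN : forall x, C x -> ~~ C (a x)) (Cnx : forall x, C x -> C (nx x))
  (Ccycle : forall x y, C x -> C y -> fconnect nx x y).

Let phiE x : phi x = s (a x). Proof. by rewrite permM. Qed.
Let sI := @perm_inj _ s.
Let phiI := @perm_inj _ phi.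
Let Ba x : C x -> B (a x). Proof. by rewrite /B aK orbC => ->. Qed.

Let nx_inj : {in C &, injective nx}.
Proof. by move=> x y Cx Cy /(nextp_inj sI) E; apply: (@perm_inj _ a); apply: E; apply: Ba. Qed.

Let nx_surj x : C x -> exists2 y, C y & nx y = x.
Proof.
move=> Cx; have : [set nx y | y in C] = [set y in C].
  apply/eqP; rewrite eqEcard card_in_imset // cardsE leqnn andbT.
  by apply/subsetP => _ /imsetP[y Cy ->]; rewrite inE; apply: Cnx.
by move/setP/(_ x); rewrite inE (_ : x \in C = true) // => /imsetP[y Cy ->]; exists y.
Qed.

(* the darts in the left sectors, strictly between [a x] and [nx x] *)
Let L d := ~~ B d && C (nextp s B d).

Let nextB x : fconnect s x (nextp s B x). Proof. exact: nextp_fconnect. Qed.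

Let nB_step y : ~~ B (s y) -> B (nextp s B y) -> nextp s B y = nextp s B (s y).
Proof. by move=> nB By; rewrite nextp_step_in // (negPf nB). Qed.

Let B_step y : B (s y) -> nextp s B y = s y.
Proof. by move=> By; rewrite nextp_step // By. Qed.

Let CB x : C x -> B x. Proof. by rewrite /B => ->. Qed.

Let L_nB y : L y -> ~~ B (s y) -> L (s y).
Proof. by case/andP=> nBy Cn nB; rewrite /L nB -nB_step // CB. Qed.

Let L_B y : L y -> B (s y) -> C (s y).
Proof. by case/andP=> nBy Cn By; rewrite -B_step. Qed.

Let nL_C y : ~~ B y -> ~~ L y -> ~~ C (s y).
Proof. by move=> nB; apply: contra => Cy; rewrite /L nB B_step // CB. Qed.

Let nL_L y : ~~ B y -> ~~ L y -> ~~ L (s y).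
Proof.
move=> nB; apply: contra => /andP[nBs Cn]; rewrite /L nB nB_step //.
by apply: nextp_P (CB Cn) => //; rewrite (connect_trans (fconnect1 _ _) (nextB _)).
Qed.

Let C_step x : C x -> ~~ C (nextp s B x).
Proof.
move=> Cx; apply/negP => /nx_surj[y Cy /(nextp_inj sI) E].
by have := CN Cy; rewrite E ?Cx //; [apply: Ba|apply: CB].
Qed.

Let C_nC x : C x -> ~~ C (s x).
Proof. by move=> Cx; apply: contra (C_step Cx) => Cs; rewrite B_step // CB. Qed.

Let C_nL x : C x -> ~~ L (s x).
Proof.
move=> Cx; apply: contra (C_step Cx) => /andP[nB Cs].
by rewrite nB_step //; apply: nextp_id => //; apply: CB.
Qed.

Let CL x : C x -> C (s (a x)) || L (s (a x)).
Proof.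
move=> Cx; have := Cnx Cx; rewrite /nx /L; have [By|nB] /= := boolP (B (s (a x))).
  by rewrite B_step // => ->.
by rewrite nB_step // ?CB ?Cnx // => ->; rewrite orbT.
Qed.

Let Cphi x : C x -> C (phi x) -> phi x = nx x.
Proof. by rewrite phiE => Cx Cp; rewrite /nx B_step // CB. Qed.

Section Open.
Variable x0 : D.
Hypotheses (Cx0 : C x0) (nCx0 : ~~ C (phi x0)).

Let nC := predC C.

(** On an orbit of [phi] contained in [C], [phi] and [nx] agree; such an orbit would contain [x0],
    whose image under [phi] is not in [C]. *)
Let phi_meet x : exists2 y, fconnect phi x y & nC y.
Proof.
apply/exists_inP; apply: contraR nCx0 => /exists_inPn H.
have {}H y : fconnect phi x y -> C y by move=> xy; have := H y xy; rewrite negbK.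
have : fconnect phi x x0.
  have /iter_findex <- := Ccycle (H x (connect0 _ _)) Cx0.
  elim: (findex _ _ _) => [|n IHn] /=; first exact: connect0.
  have IH' : fconnect phi x (phi (iter n nx x)) by rewrite -same_fconnect1_r.
  by rewrite -Cphi ?H.
by move=> xx0; apply: H; rewrite -same_fconnect1_r.
Qed.

Let ex x := nextp phi nC x.
Let ex_nC x : nC (ex x).
Proof. by have [y xy Py] := phi_meet x; apply: nextp_P xy Py. Qed.
Let ex_nC_step x : nC (phi x) -> ex x = phi x.
Proof. by move=> H; rewrite /ex nextp_step // H. Qed.
Let ex_C_step x : C (phi x) -> ex x = ex (phi x).
Proof. by move=> H; rewrite [LHS]nextp_step_in // [nC _]/= H. Qed.

(** The surgery: the darts of [C] are taken out of their face cycles and strung into a cycle of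
    their own. The vertex permutation that goes with it is [t], in which the left sectors are
    detached from the rest. *)
Let p0 x := if C x then nx x else ex x.
Let p0_inj : injective p0.
Proof.
move=> x y; rewrite /p0; case: ifP => Cx; case: ifP => Cy E.
- exact: nx_inj.
- by have := ex_nC y; rewrite -E /nC /= Cnx.
- by have := ex_nC x; rewrite E /nC /= Cnx.
- by apply: (nextp_inj phiI) E; rewrite unfold_in /nC /= ?Cx ?Cy.
Qed.
Let p := perm p0_inj.
Let t : {perm D} := (a * p)%g.
Let tE y : t y = if C (a y) then nx (a y) else ex (a y).
Proof. by rewrite permM permE. Qed.

Let t_nC y : ~~ C (a y) -> ~~ C (s y) -> t y = s y.
Proof. by move=> /negPf nCa nCs; rewrite tE nCa ex_nC_step phiE ?aK. Qed.

Let t_C y : ~~ C (a y) -> C (s y) -> t y = ex (s y).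
Proof. by move=> /negPf nCa nCs; rewrite tE nCa ex_C_step phiE ?aK. Qed.

Let nB_Ca y : ~~ B y -> ~~ C (a y). Proof. by rewrite negb_or => /andP[]. Qed.

Let ex_L x : C x -> L (ex x).
Proof.
move=> Cx; have [y xy Py] := phi_meet x.
have [|n [En Pn Hn]] := @nextp_ex _ phi nC x.
  exists (findex phi (phi x) y); rewrite iterSr iter_findex //.
  by rewrite -same_fconnect1.
have Cn : C (iter n phi x) by case: n Hn {En} => // n /(_ n (leqnn _)); rewrite negbK.
move: Pn; rewrite /ex En /= /nC /= phiE => nCn.
by have := CL Cn; rewrite (negPf nCn).
Qed.

Let Lt y : L y -> L (t y).
Proof.
move=> Ly; have nBy : ~~ B y by case/andP: Ly.
have [Cs|nCs] := boolP (C (s y)).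
  by rewrite t_C ?nB_Ca // ex_L.
rewrite t_nC ?nB_Ca // L_nB //; apply: contra nCs; exact: L_B.
Qed.

Let nextL x : C x -> nextp s (predC L) (a x) = nx x.
Proof.
move=> Cx; have Cn := Cnx Cx; have [|n [En Pn Hn]] := @nextp_ex _ s B (a x).
  exists (findex s (s (a x)) (nx x)); rewrite iterSr iter_findex ?CB //.
  by rewrite -same_fconnect1 ?nextB.
rewrite /nx En; have HL m : m < n -> L (iter m.+1 s (a x)).
  elim: m => [|m IHm] lt.
    have := CL Cx; rewrite orbC; case: (L _) => //= C1.
    by have := Hn 0 lt; rewrite /= CB.
  by rewrite iterS L_nB ?IHm ?(ltnW lt) //; apply: (Hn m.+1).
apply: nextpE => // [|m lt]; last by rewrite /= negbK; apply: HL.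
by rewrite -En; apply/negP => /andP[]; rewrite Pn.
Qed.

(** The left sectors carry at least one orbit of [t]; off them [t] is the first return of [s], with
    one orbit for each vertex. *)
Let card_t : (fcard s predT).+1 <= fcard t predT.
Proof.
rewrite [leqRHS](n_compC L) -add1n; apply: leq_add.
  apply/fcard_gt0P; first exact: perm_inj; last by exists (ex x0); exact: ex_L.
  by move=> x y /= /eqP <-; apply: (esym (homo_inj_closed (@perm_inj _ t) Lt x)).
rewrite (@fcard_nextp _ s t (predC L)) //; first exact: perm_inj.
  move=> x; have [Lx|nLx] := boolP (L x); last by exists x; rewrite ?connect0.
  exists (nextp s B x); rewrite ?nextB //= /L.
  by case/andP: Lx => _ Cn; rewrite CB.
move=> y /= nLy; have [Cay|nCay] := boolP (C (a y)).
  by rewrite tE Cay -{2}[y]aK nextL.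
have [Cy|nCy] := boolP (C y).
  by rewrite t_nC ?C_nC // nextp_step //= C_nL.
have nBy : ~~ B y by rewrite /B negb_or nCy.
by rewrite t_nC ?nL_C // nextp_step //= nL_L.
Qed.

Let p_cycle : fcard p predT = (fcard phi predT).+1.
Proof.
have pI := @perm_inj _ p.
have pC x : C x -> p x = nx x by rewrite permE /p0 => ->.
have pnx x y : C x -> fconnect p x y = fconnect nx x y.
  move=> Cx; have it i : C (iter i p x) /\ iter i p x = iter i nx x.
    by elim: i => // i [Pi Ei] /=; rewrite pC //; split; [apply: Cnx|rewrite Ei].
  by apply/idP/idP => /iter_findex <-; [rewrite (it _).2|rewrite -(it _).2];
    apply: fconnect_iter.
have Cp x : C x -> C (p x) by move=> Cx; rewrite pC // Cnx.
rewrite (n_compC C) (@eq_n_comp_r _ (frel p) C (connect (frel p) x0)).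
  rewrite n_comp_connect; last exact: fconnect_sym.
  rewrite add1n (@fcard_nextp _ phi p nC) //.
  by move=> x nCx; rewrite permE /p0 ifN.
move=> y; change (C y = fconnect p x0 y).
apply/idP/idP => [Cy|/iter_findex <-].
  by rewrite pnx // Ccycle.
by elim: (findex _ _ _) => //= n /Cp.
Qed.

(** Cutting adds at least one vertex and exactly one face and keeps the edges, so the Euler
    inequality forces a second component. The walk edges share one label and the left sectors share
    another; [X] consists of [C] and of all darts labelled differently from [C]. *)
Lemma jordan_open : exists X : pred D,
  [/\ forall x, X (phi x) = X x, forall x, C x -> X x, forall x, C x -> ~~ X (a x)
    & forall y, ~~ C y -> ~~ C (a y) -> X (a y) = X y].
Proof.
have [k [kt ka]] := genus_ineq t a.
have -> : (a * t)%g = p by apply/permP => x; rewrite !permM aK.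
rewrite -!fcard_porbits p_cycle (card_involution aK aN) => Hk.
have k2 : 1 < #|k @: D|.
  move: Hk card_t euler; move: (fcard t _) (fcard s _) (fcard a _) (fcard phi _) #|_|.
  move=> *; lia.
have knx x : C x -> k (nx x) = k x.
  by move=> Cx; rewrite -(ka x) -(kt (a x)) tE aK Cx.
have kC x : C x -> k x = k x0.
  move=> Cx; have /iter_findex <- := Ccycle Cx0 Cx; elim: (findex _ _ _) => //= n IHn.
  have Cn : C (iter n nx x0) by elim: n {IHn} => //= n; apply: Cnx.
  by rewrite knx.
(* A left sector is followed clockwise by [t] up to the walk edge that ends it, where [t] jumps by
   [ex]. *)
have kL z : L z -> k z = k (ex (nextp s B z)).
  move=> Lz; have [nBz Cz] := andP Lz.
  have [|n [En _ Hn]] := @nextp_ex _ s B z.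
    exists (findex s (s z) (nextp s B z)); rewrite iterSr iter_findex ?CB //.
    by rewrite -same_fconnect1 ?nextB.
  elim: n z Lz nBz Cz En Hn => [|n IHn] z Lz nBz Cz En Hn.
    have Cs : C (s z) by move: Cz; rewrite En.
    by rewrite En /= -[LHS](kt z) t_C ?nB_Ca.
  have nBs := Hn 0 isT; rewrite /= in nBs.
  have nCs : ~~ C (s z) by apply: contra nBs; apply: CB.
  have ns := nB_step nBs (CB Cz).
  have Ls := L_nB Lz nBs.
  rewrite -(kt z) t_nC ?nB_Ca // ns; apply: IHn => //; rewrite -?ns // ?En ?iterSr //.
  by move=> m lt; rewrite -iterSr; apply: Hn.
have kex x : C x -> k (ex (nx x)) = k (ex x).
  move=> Cx; have [Cp|nCp] := boolP (C (phi x)).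
    by rewrite -Cphi // -ex_C_step.
  have Ls : L (s (a x)) by have := CL Cx; rewrite -phiE (negPf nCp).
  rewrite (ex_nC_step nCp) phiE (kL _ Ls) /nx nB_step //; first by case/andP: Ls.
  by apply: CB; apply: Cnx.
have kex0 x : C x -> k (ex x) = k (ex x0).
  move=> Cx; have /iter_findex <- := Ccycle Cx0 Cx; elim: (findex _ _ _) => //= n IHn.
  have Cn : C (iter n nx x0) by elim: n {IHn} => //= n; apply: Cnx.
  by rewrite kex.
have kL0 z : L z -> k z = k (ex x0).
  by move=> /[dup] /andP[_ Cz] Lz; rewrite kL // kex0.
(* If the two labels agreed, [k] would be invariant under [s] as well as [a], hence constant. *)
have neq : k (ex x0) != k x0.
  apply/negP => /eqP E; have ks y : k (s y) = k y.
    have [Cay|nCay] := boolP (C (a y)).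
      rewrite -(ka y) (kC _ Cay); have := CL Cay; rewrite aK.
      by case/orP => [/kC|/kL0] ->.
    have [Ly|nLy] := boolP (L y).
      rewrite (kL0 _ Ly); have [Bs|nBs] := boolP (B (s y)).
        by rewrite E; apply/kC/L_B.
      by apply/kL0/L_nB.
    rewrite -(kt y) t_nC //; have [Cy|nCy] := boolP (C y); first exact: C_nC.
    by apply: nL_C; rewrite // /B negb_or nCy.
  suff : #|k @: D| <= 1 by rewrite leqNgt k2.
  rewrite -(cards1 (k x0)); apply: subset_leq_card; apply/subsetP => _ /imsetP[y _ ->].
  rewrite inE; rewrite (sa_trans (P := fun z => k z == k x0) _ _ y x0) ?eqxx //.
    by move=> x; rewrite ks.
  by move=> x; rewrite ka.
exists (fun y => C y || (k y != k x0)); split=> [|x -> //|x Cx|y /negPf-> /negPf->].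
- apply: homo_inj_closed => // x /orP[Cx|kx].
    have := CL Cx; rewrite -phiE; case/orP => [->//|/kL0 ->].
    by rewrite neq orbT.
  have [//|nCp] /= := boolP (C (phi x)).
  have [Cx|nCx] := boolP (C x); first by rewrite (kC _ Cx) eqxx in kx.
  have -> : phi x = t (a x) by rewrite t_nC ?aK -?phiE.
  by rewrite kt ka.
- by rewrite negb_or CN //= ka (kC _ Cx) eqxx.
- by rewrite ka.
Qed.

End Open.

(** In the remaining case [C] is stable under [phi], hence a union of faces and its own left
    side. *)
Lemma jordan : exists X : pred D,
  [/\ forall x, X (phi x) = X x, forall x, C x -> X x, forall x, C x -> ~~ X (a x)
    & forall y, ~~ C y -> ~~ C (a y) -> X (a y) = X y].
Proof.
have [/exists_inP[x Cx nCx]|/exists_inPn H] := boolP [exists (x | C x), ~~ C (phi x)].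
  exact: jordan_open Cx nCx.
exists C; split=> // [|y /negPf-> /negPf-> //].
apply: homo_inj_closed => // x Cx; have := H x Cx; rewrite negbK //.
Qed.
End Jordan.

(** * Mobiles seen from their black half-edges *)

Lemma inj_surj_bij (T T' : finType) (f : T -> T') :
  injective f -> (forall y, exists x, f x = y) -> bijective f.
Proof.
move=> fI fS; apply: (inj_card_bij fI); rewrite -(card_codom fI).
by apply: subset_leq_card; apply/subsetP => y _; have [x <-] := fS y; apply: codom_f.
Qed.

Lemma fcard_embed (T T' : finType) (h : T' -> T) (f : T -> T) (f' : T' -> T') (A : pred T) :
  injective f -> injective f' -> injective h -> (forall x, h (f' x) = f (h x)) ->
  (forall x, A x <-> exists y, h y = x) -> fcard f A = fcard f' predT.
Proof.
move=> fI f'I hI hf Ah.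
have it n x : h (iter n f' x) = iter n f (h x) by elim: n => //= n <-.
have clA : fclosed f A.
  move=> x _ /= /eqP <-; apply: (esym (homo_inj_closed fI _ x)) => z /Ah[y <-].
  by apply/Ah; exists (f' y).
rewrite (adjunction_n_comp h (fconnect_sym fI) (fconnect_sym f'I) clA).
  by apply: eq_n_comp_r => x; rewrite !inE; apply/Ah; exists x.
split=> [x Ax|x y _].
  have : exists y, h y == x by have [y <-] := proj1 (Ah x) Ax; exists y.
  by move/sigW=> [y /eqP<-]; exists y; apply: connect0.
apply/idP/idP => /iter_findex; first by move=> <-; rewrite it fconnect_iter.
by rewrite -it => /hI <-; apply: fconnect_iter.
Qed.

Lemma fcard_fix (T : finType) (f : T -> T) (A : pred T) :
  (forall x, A x -> f x = x) -> fcard f A = #|A|.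
Proof.
move=> fA; apply: eq_card => x; rewrite !inE; have [Ax|] := boolP (x \in A); last by rewrite andbF.
rewrite andbT; apply/eqP; have /iter_findex <- := connect_root (frel f) x.
by elim: (findex _ _ _) => //= n ->; apply: fA.
Qed.

Lemma mob_iso_sym M1 M2 : mob_iso M1 M2 -> mob_iso M2 M1.
Proof.
case=> f [[g fK gK] fs fa fc]; exists g; split; first by exists f.
- by move=> x; apply: (can_inj fK); rewrite fs !gK.
- by move=> x; apply: (can_inj fK); rewrite fa !gK.
- by move=> x; rewrite -fc gK.
Qed.

Lemma mob_iso_trans M1 M2 M3 : mob_iso M1 M2 -> mob_iso M2 M3 -> mob_iso M1 M3.
Proof.
case=> f [fB fs fa fc] [g [gB gs ga gc]]; exists (g \o f); split=> [|x|x|x] /=.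
- exact: bij_comp.
- by rewrite fs gs.
- by rewrite fa ga.
- by rewrite gc fc.
Qed.

Lemma card_bij (T T' : finType) (f : T -> T') (A : pred T) (A' : pred T') :
  bijective f -> (forall x, A' (f x) = A x) -> #|A| = #|A'|.
Proof.
move=> fB AA; have fI := bij_inj fB; rewrite -(card_image fI); apply: eq_card => y.
case: fB => g fK gK; rewrite -[y]gK [RHS]unfold_in AA.
by apply/imageP/idP => [[x Ax /fI ->] //|Ay]; exists (g y).
Qed.

Lemma mob_iso_excess M1 M2 : mob_iso M1 M2 -> excess M1 = excess M2.
Proof.
case=> f [fB fs fa fc]; rewrite /excess /mnedges /mnbuds.
rewrite (card_bij (A' := [pred d | @malp M2 d != d]) fB); last first.
  by move=> x; rewrite /= -fa (inj_eq (bij_inj fB)).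
rewrite (card_bij (A' := [pred d | @malp M2 d == d]) fB) //.
by move=> x; rewrite /= -fa (inj_eq (bij_inj fB)).
Qed.

Lemma mob_iso_pbmobile M1 M2 : mob_iso M1 M2 -> is_pbmobile M1 -> is_pbmobile M2.
Proof.
case=> f [fB fs fa fc] [[sI aK conn vE] [cs ca cb]].
have fI := bij_inj fB; have [g fK gK] := fB; have gI := can_inj gK.
have gs x : g (@msig M2 x) = @msig M1 (g x) by apply: fI; rewrite fs !gK.
have ga x : g (@malp M2 x) = @malp M1 (g x) by apply: fI; rewrite fa !gK.
have s2I : injective (@msig M2) by move=> x y E; apply/gI/sI; rewrite -!gs E.
have a2K d : @malp M2 (@malp M2 d) = d by apply: gI; rewrite !ga aK.
have a2I := can_inj a2K; have a1I := can_inj aK.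
split; split=> //.
- apply/connect_transitive2 => // P Ps Pa x y; rewrite -[x]gK -[y]gK.
  apply: ((proj1 (connect_transitive2 sI a1I) conn) (fun x => P (f x))) => z.
    by rewrite fs.
  by rewrite fa.
- rewrite /mnverts /mnedges (fcard_embed (h := f) (f' := @msig M1) (A := predT)) //; last first.
    by move=> x; split=> // _; exists (g x).
  rewrite [LHS]vE /mnedges.
  rewrite (card_bij (A' := [pred d | @malp M2 d != d]) fB) //.
  by move=> x; rewrite /= -fa (inj_eq fI).
- by move=> d; rewrite -[d]gK -fs !fc.
- by move=> d; rewrite -[d]gK -fa !fc (inj_eq fI); apply: ca.
- by move=> d; rewrite -[d]gK -fa !fc (inj_eq fI); apply: cb.
Qed.

(* A mobile seen from its black half-edges: [cb] rotates around the black
   vertices, [ch] marks the non-buds, and [cw] carries the rotation around the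
   white vertices across the edges (and fixes the buds). *)
Record core := Core { cN : finType; cb : {perm cN}; cw : {perm cN}; ch : pred cN }.

Definition core_wf (c : core) := forall x : cN c, ~~ ch x -> cw c x = x.

(** A bud is both a dart and a fixed point of [cw], so this is the relation between vertices and
    edges of a tree with the buds counted on each side. *)
Definition core_tree (c : core) :=
  transitive2 (cb c) (cw c) /\ fcard (cb c) predT + fcard (cw c) predT = #|cN c| + 1.

Definition core_iso (c1 c2 : core) := exists g : cN c1 -> cN c2,
  [/\ bijective g, forall x, g (cb c1 x) = cb c2 (g x),
      forall x, g (cw c1 x) = cw c2 (g x) & forall x, ch (g x) = ch x].

(** A white half-edge is named by the black half-edge of the same edge, so the summand is the
    colour. The default of [insubd] is not met when [core_wf] holds, since [cw] then preserves
    [ch]. *)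
Definition mob_core (c : core) : mobile :=
  @Mobile (cN c + {x : cN c | ch x})%type
    (fun d => match d with inl x => inl (cb c x) | inr h => inr (insubd h (cw c (val h))) end)
    (fun d => match d with inl x => if insub x is Some h then inr h else inl x
                         | inr h => inl (val h) end)
    (fun d => if d is inl _ then true else false).

Section CoreWf.
Variable c : core.
Hypothesis cwf : core_wf c.
Local Notation N := (cN c).

Lemma ch_cw x : ch (cw c x) = ch x.
Proof.
apply: (homo_inj_closed (@perm_inj _ (cw c))) => y hy; apply: contraT => nh.
by have /perm_inj E := cwf nh; rewrite E hy in nh.
Qed.

Local Notation sub_cw := (fun h : {x : N | ch x} => insubd h (cw c (val h))).

Lemma val_sub_cw (h : {x : N | ch x}) : val (insubd h (cw c (val h))) = cw c (val h).
Proof. by rewrite val_insubd ch_cw (valP h). Qed.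

Lemma sub_cw_inj : injective sub_cw.
Proof. by move=> x y /(congr1 val); rewrite /= !val_sub_cw => /perm_inj /val_inj. Qed.

Lemma mob_core_sigI : injective (@msig (mob_core c)).
Proof.
by move=> [x|x] [y|y] //= [] => [/perm_inj ->//|/sub_cw_inj ->].
Qed.

Lemma mob_core_alpK d : @malp (mob_core c) (@malp (mob_core c) d) = d.
Proof.
case: d => [x|h] /=; last by rewrite valK.
by case: insubP => [h hx <- //=|hx] /=; rewrite insubN.
Qed.

Lemma mob_core_alp_eq d :
  (@malp (mob_core c) d == d) = if d is inl x then ~~ ch x else false.
Proof.
case: d => [x|h] //=; case: insubP => [h hx _|hx]; first by rewrite hx.
by rewrite hx eqxx.
Qed.

Lemma mob_core_nbuds : mnbuds (mob_core c) = #|predC (@ch c)|.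
Proof.
rewrite /mnbuds -(card_image (@inl_inj N {x : N | ch x})); apply: eq_card => d.
rewrite !inE mob_core_alp_eq; apply/idP/imageP => [|[x nx ->]]; last exact: nx.
by case: d => // x nx; exists x.
Qed.

Lemma mob_core_nedges : mnedges (mob_core c) = #|@ch c|.
Proof.
rewrite /mnedges (_ : #|_| = #|@ch c| * 2) ?mulnK //.
have cT : #|{: mD (mob_core c)}| = #|N| + #|@ch c| by rewrite card_sum card_sig.
have E := cardC [pred d : mD (mob_core c) | malp d == d].
move: E; rewrite [#|[pred d : mD (mob_core c) | malp d == d]|]mob_core_nbuds cT.
rewrite -(cardC (@ch c)) => E; transitivity #|predC [pred d : mD (mob_core c) | malp d == d]|.
  exact: eq_card.
by move: E; move: #|_| #|_| #|_| => x y z; lia.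
Qed.

Lemma excess_mob_core : excess (mob_core c) = (#|@ch c|%:Z - #|predC (@ch c)|%:Z)%R.
Proof. by rewrite /excess mob_core_nedges mob_core_nbuds. Qed.

Lemma fcard_cw_heads : fcard (cw c) (@ch c) = fcard sub_cw predT.
Proof.
apply: (@fcard_embed _ _ val) => //; first exact: perm_inj.
- exact: sub_cw_inj.
- exact: val_inj.
- exact: val_sub_cw.
by move=> x; split=> [hx|[y <-]]; [exists (Sub x hx); rewrite SubK|exact: (valP y)].
Qed.

Lemma mob_core_nverts :
  mnverts (mob_core c) + #|predC (@ch c)| = fcard (cb c) predT + fcard (cw c) predT.
Proof.
rewrite /mnverts (n_compC (fun d : mD (mob_core c) => mcol d)).
rewrite (@fcard_embed _ _ inl _ (cb c)) //; first last.
- by case=> [x|h] /=; split=> //; [exists x|case].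
- exact: inl_inj.
- exact: perm_inj.
- exact: mob_core_sigI.
rewrite -addnA; congr (_ + _).
rewrite (n_compC (@ch c)) (@fcard_fix _ (cw c) (predC (@ch c))); last by move=> x /cwf.
congr (_ + _); rewrite fcard_cw_heads.
apply: (@fcard_embed _ _ inr) => //; [exact: mob_core_sigI|exact: sub_cw_inj|exact: inr_inj|].
by case=> [x|h] /=; split=> //; [case|exists h].
Qed.

Lemma mob_core_pbmobile : is_pbmobile (mob_core c) <-> core_tree c.
Proof.
have E : (mnverts (mob_core c) = mnedges (mob_core c) + 1) <->
   (fcard (cb c) predT + fcard (cw c) predT = #|N| + 1).
  rewrite -mob_core_nverts mob_core_nedges -(cardC (@ch c)).
  by move: (mnverts _) #|_| #|_| => *; lia.
have aI := can_inj mob_core_alpK; have sI := mob_core_sigI.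
have [C1 C2] := connect_transitive2 sI aI.
split=> [[[_ _ conn /E vE] _]|[tr /E vE]]; split=> //.
- move=> P Pb Pw x y; have := C1 conn (fun d => match d with inl x => P x | inr h => P (val h) end).
  move=> /(_ _ _ (inl x) (inl y)); apply.
    by case=> [z|h] //=; rewrite val_sub_cw.
  by case=> [z|h] //=; case: insubP => [h hx <-|].
- split=> //; first exact: mob_core_alpK.
  apply: C2 => P Ps Pa x y.
  have al (h : {x : N | ch x}) : P (inr h) = P (inl (val h)) by rewrite -[LHS]Pa.
  have Pl z w : P (inl z) = P (inl w).
    apply: (tr (fun x => P (inl x))) => {z w}z; first by rewrite -[RHS]Ps.
    have [hz|/cwf -> //] := boolP (ch z).
    by have := Ps (inr (Sub z hz)); rewrite /= !al val_sub_cw SubK.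
  have Pw d : exists z, P d = P (inl z).
    by case: d => [z|h]; [exists z|exists (val h); rewrite al].
  by have [[z ->] [w ->]] := (Pw x, Pw y).
- split=> [[]|d|d]; rewrite // mob_core_alp_eq; case: d => //= x; rewrite negbK.
  by case: insubP => [h hx //|/negPf ->].
Qed.

End CoreWf.

(** Colours make an isomorphism respect the two summands, and the edge involution determines its
    white part from its black part. *)
Lemma mob_core_iso c1 c2 : core_wf c1 -> core_wf c2 ->
  mob_iso (mob_core c1) (mob_core c2) <-> core_iso c1 c2.
Proof.
move=> wf1 wf2; split=> [[f [fB fs fa fc]]|[g [gB gb gw gc]]].
  have fI := bij_inj fB.
  have exl x : exists y, f (inl x) == inl y.
    by have := fc (inl x); case: (f _) => // y; exists y.
  pose g x := sval (sigW (exl x)).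
  have fl x : f (inl x) = inl (g x) by apply/eqP; apply: (svalP (sigW (exl x))).
  have gI : injective g by move=> x y E; apply: (@inl_inj _ {x | ch x}); apply: fI; rewrite !fl E.
  have gc x : ch (g x) = ch x.
    have E : f (@malp (mob_core c1) (inl x)) == f (inl x) = (@malp (mob_core c2) (inl (g x)) == inl (g x)).
      by rewrite fa fl.
    by move: E; rewrite (inj_eq fI) !mob_core_alp_eq; do 2!case: (ch _).
  exists g; split=> //.
  - apply: inj_surj_bij => // y; have [f' _ f'K] := fB.
    have : f (f' (inl y)) = inl y by apply: f'K.
    case: (f' _) => [x|h]; first by rewrite fl => -[<-]; exists x.
    by move=> E; have := fc (inr h); rewrite E.
  - by move=> x; have := fs (inl x); rewrite /= !fl /= => -[].
  move=> x; have [hx|hx] := boolP (ch x); last by rewrite !(wf1, wf2) ?gc.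
  have a1 z (hz : ch z) : inl z = @malp (mob_core c1) (inr (Sub z hz)) by [].
  have frr z (hz : ch z) : f (inr (Sub z hz)) = inr (insubd (Sub (g z) (etrans (gc z) hz)) (g z)).
    rewrite -[LHS](@mob_core_alpK c2) -fa -a1 fl /= (insubT _ (etrans (gc z) hz)); congr inr.
    by apply: val_inj; rewrite val_insubd SubK gc hz.
  have hwx : ch (cw c1 x) by rewrite ch_cw.
  pose h : {x : cN c1 | ch x} := Sub x hx.
  have E : insubd h (cw c1 (val h)) = Sub (cw c1 x) hwx by apply: val_inj; rewrite val_sub_cw.
  have := fs (inr h); rewrite /= E !frr => -[] /(congr1 val).
  by rewrite !val_insubd /= !gc hx hwx ch_cw // gc hx.
have gI := bij_inj gB; have [g' gK g'K] := gB.
pose f (d : mD (mob_core c1)) : mD (mob_core c2) := match d with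
  | inl x => inl (g x) | inr h => inr (Sub (g (val h)) (etrans (gc _) (valP h))) end.
exists f; split.
- apply: inj_surj_bij.
    by move=> [x|h] [y|k] //= []; [move/gI=> ->|move=> /gI /val_inj ->].
  case=> [y|h]; first by exists (inl (g' y)); rewrite /= g'K.
  have hg : ch (g' (val h)) by rewrite -gc g'K (valP h).
  by exists (inr (Sub (g' (val h)) hg)); congr inr; apply: val_inj; rewrite !SubK g'K.
- case=> [x|h] /=; first by rewrite gb.
  by congr inr; apply: val_inj; rewrite SubK !val_sub_cw // SubK gw.
- case=> [x|h] //=; case: insubP => [h hx <-|nh] /=; last by rewrite insubN ?gc.
  rewrite insubT; first by rewrite gc (valP h).
  by move=> ?; congr inr; apply: val_inj.
- by case.
Qed.

Lemma mobile_core M : is_pbmobile M -> exists2 c, core_wf c & mob_iso (mob_core c) M.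
Proof.
case=> -[sI aK _ _] [cs ca cb'].
pose N := {x : mD M | mcol x}.
(* The white rotation conjugated to the black ends of the edges; buds stay fixed. *)
pose w0 (x : mD M) := if malp x == x then x else malp (msig (malp x)).
have anb (x : mD M) : mcol x -> malp x != x -> ~~ mcol (malp x).
  by move=> xb /ca; rewrite xb; case: (mcol _).
have wnb (x : mD M) : ~~ mcol x -> mcol (malp x).
  move=> xw; have /ca : malp x != x by apply: contra xw => /cb'.
  by move/negPf: xw => ->; case: (mcol _).
have w0b (x : mD M) : mcol x -> mcol (w0 x).
  by move=> xb; rewrite /w0; case: ifPn => // nx; apply: wnb; rewrite cs anb.
pose b (x : N) : N := Sub (msig (val x)) (etrans (cs _) (valP x)).
pose w (x : N) : N := Sub (w0 (val x)) (w0b _ (valP x)).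
have aI := can_inj aK.
have bI : injective b by move=> x y /(congr1 val) /sI /val_inj.
have w0h (x : mD M) : mcol x -> malp x != x -> malp (w0 x) != w0 x.
  move=> xb nx; rewrite /w0 (negPf nx) aK; apply/eqP => E.
  by have := wnb (msig (malp x)); rewrite cs (negPf (anb x xb nx)) -E cs => /(_ isT); rewrite (negPf (anb x xb nx)).
have wI : injective w.
  move=> x y /(congr1 val) /= E; apply: val_inj.
  have := w0h _ (valP x); have := w0h _ (valP y); move: E; rewrite /= /w0.
  have [ex|nx] := eqVneq (malp (val x)) (val x); have [ey|ny] := eqVneq (malp (val y)) (val y) => //.
  - by move=> E /(_ isT); rewrite -E ex eqxx.
  - by move=> E _ /(_ isT); rewrite E ey eqxx.
  - by move=> /aI /sI /aI.
pose c := @Core {x : mD M | mcol x} (perm bI) (perm wI) (fun x => malp (val x) != val x).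
exists c => [x /=|]; first by rewrite negbK permE => ex; apply: val_inj; rewrite /= /w0 ex.
pose f (d : mD (mob_core c)) : mD M := match d with inl x => val x | inr h => malp (val (val h)) end.
have fh (h : {x : cN c | ch x}) : ~~ mcol (malp (val (val h))).
  by apply: anb; [exact: (valP (val h))|exact: (valP h)].
have cwf : core_wf c by move=> x /=; rewrite negbK permE => ex; apply: val_inj; rewrite /= /w0 ex.
exists f; split.
- apply: inj_surj_bij.
    move=> [x|h] [y|k] /=; first by move/val_inj->.
    + by move=> E; have := fh k; rewrite -E (valP x).
    + by move=> E; have := fh h; rewrite E (valP y).
    + by move/aI/val_inj/val_inj->.
  move=> y; have [yb|yw] := boolP (mcol y); first by exists (inl (Sub y yb)).
  have hy : ch (Sub (malp y) (wnb _ yw) : cN c).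
    by rewrite /= aK; apply/eqP => E; have := wnb _ yw; rewrite -E (negPf yw).
  by exists (inr (Sub (Sub (malp y) (wnb _ yw)) hy)); rewrite /= aK.
- case=> [x|h]; first by rewrite /= permE.
  have vE := congr1 val (val_sub_cw cwf h).
  change (malp (val (val (insubd h (cw c (val h))))) = msig (malp (val (val h)))).
  by rewrite vE /= permE /= /w0 ifN ?aK //; exact: (valP h).
- case=> [x|h] /=; last by rewrite aK.
  by case: insubP => [h _ <- //|]; rewrite negbK => /eqP.
- by case=> [x|h] /=; [exact: (valP x)|exact/negbTE/fh].
Qed.

Lemma core_iso_sym c1 c2 : core_iso c1 c2 -> core_iso c2 c1.
Proof.
case=> g [[g' gK g'K] gb gw gc]; exists g'; split; first by exists g.
- by move=> x; apply: (can_inj gK); rewrite gb !g'K.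
- by move=> x; apply: (can_inj gK); rewrite gw !g'K.
- by move=> x; rewrite -gc g'K.
Qed.

Definition core_chi (c : core) (x : cN c) := cb c (cw c x).

Lemma core_chi_inj c : injective (@core_chi c).
Proof. exact: inj_comp (@perm_inj _ (cb c)) (@perm_inj _ (cw c)). Qed.

(** For a tree, the Euler inequality with a single component leaves at most one orbit to the
    product. *)
Lemma core_chi_cycle c : core_tree c -> forall x y, fconnect (@core_chi c) x y.
Proof.
case=> tr; rewrite !fcard_porbits => eu x y.
have [k [kb kw]] := genus_ineq (cb c) (cw c).
have kxy z w : k z = k w.
  by apply/eqP; rewrite (tr (fun z => k z == k w) _ _ z w) ?eqxx // => u; rewrite (kb, kw).
have : #|k @: cN c| <= 1.
  rewrite -(cards1 (k x)); apply: subset_leq_card; apply/subsetP => _ /imsetP[z _ ->].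
  by rewrite inE (kxy z x).
have -> : fconnect (@core_chi c) x y = fconnect (cw c * cb c)%g x y.
  by apply: eq_fconnect => z; rewrite permM.
rewrite -porbit_fconnect => le Hk.
have {le Hk}le : #|porbits (cw c * cb c)| <= 1.
  by move: le Hk; rewrite eu; move: #|_| #|_| #|_| => *; lia.
rewrite -eq_porbit_mem; apply/eqP; apply: (card_le1_eqP le); exact: imset_f.
Qed.

(** * Circuits and cuts of plane orientations *)

Section Orient.
Variable O : fro.
Local Notation D := (oD O).
Local Notation s := (@osig O).
Local Notation a := (@oalp O).
Local Notation out := (@oout O).
Local Notation phi := (ophi O).

Lemma ophiE x : phi x = s (a x). Proof. by rewrite permM. Qed.

Lemma samev_sym (x y : D) : samev x y = samev y x.
Proof. by apply: fconnect_sym; apply: perm_inj. Qed.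

Lemma samef_sym (x y : D) : samef x y = samef y x.
Proof. by apply: fconnect_sym; apply: perm_inj. Qed.

Lemma samev_trans (x y z : D) : samev x y -> samev y z -> samev x z.
Proof. exact: connect_trans. Qed.

Lemma inroot_phi x : inroot (phi x) = inroot x.
Proof. by rewrite /inroot /samef -same_fconnect1_r //; apply: perm_inj. Qed.

Lemma inroot_phiV x : inroot ((phi^-1)%g x) = inroot x.
Proof. by rewrite -[in RHS](permKV phi x) inroot_phi. Qed.

Lemma inroot_root : inroot (@oroot O).
Proof. exact: connect0. Qed.

Lemma samef_inv (X : pred D) x y : (forall z, X (phi z) = X z) -> samef x y -> X y = X x.
Proof.
by move=> Xp /iter_findex <-; elim: (findex _ _ _) => //= n IHn; rewrite Xp.
Qed.

Lemma samev_inv (X : pred D) x y : (forall z, X (s z) = X z) -> samev x y -> X y = X x.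
Proof.
by move=> Xp /iter_findex <-; elim: (findex _ _ _) => //= n IHn; rewrite Xp.
Qed.

Section Plane.
Hypotheses (Opl : is_plane_map O) (Oor : is_orientation O).

Lemma plane_alpK x : a (a x) = x. Proof. by have [aK _ _ _] := Opl; apply: aK. Qed.

Lemma plane_trans : transitive2 s a.
Proof.
by have [_ _ H _] := Opl; apply/connect_transitive2 => //; apply: perm_inj.
Qed.

Lemma phiV_alp x : (phi^-1)%g x = a ((s^-1)%g x).
Proof. by apply: (@perm_inj _ phi); rewrite permKV ophiE plane_alpK permKV. Qed.

Lemma plane_jordan (C : pred D) :
  let nx x := nextp s (fun y => C y || C (a y)) (a x) in
  (forall x, C x -> ~~ C (a x)) -> (forall x, C x -> C (nx x)) ->
  (forall x y, C x -> C y -> fconnect nx x y) ->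
  exists X : pred D,
  [/\ forall x, X (phi x) = X x, forall x, C x -> X x, forall x, C x -> ~~ X (a x)
    & forall y, ~~ C y -> ~~ C (a y) -> X (a y) = X y].
Proof.
by have [aK aN _ eu] := Opl; apply: jordan => //; apply: plane_trans.
Qed.

Section Circuit.
Variable c : seq D.
Hypothesis Oc : is_circuit c.

Let B y := (y \in c) || (a y \in c).
Let nx x := nextp s B (a x).

Lemma circuit_out x : x \in c -> out x.
Proof. by have [_ /allP H _ _] := Oc => /H. Qed.

Lemma circuit_inj x y : x \in c -> y \in c -> samev x y -> x = y.
Proof.
have [_ _ _ /(pairwiseP x) H] := Oc => xc yc xy.
have ix := nth_index x xc; have iy := nth_index x yc.
have lx : index x c < size c by rewrite index_mem.
have ly : index y c < size c by rewrite index_mem.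
case: (ltngtP (index x c) (index y c)) => lt; last by rewrite -ix -iy lt.
  by have := H _ _ lx ly lt; rewrite ix iy xy.
by have := H _ _ ly lx lt; rewrite ix iy samev_sym xy.
Qed.

Lemma circuit_uniq : uniq c.
Proof.
have [_ _ _ H] := Oc; rewrite uniq_pairwise; apply: sub_pairwise H => x y.
by apply: contraNneq => ->; apply: connect0.
Qed.

(** A circuit uses one ingoing and one outgoing edge at each of its vertices, so the next circuit
    edge met around the head of [x] is its successor. *)
Lemma circuit_next x : x \in c -> nx x = next c x.
Proof.
move=> xc; have [_ _ cyc _] := Oc; have yc : next c x \in c by rewrite mem_next.
have xy : samev (a x) (next c x) by apply: (next_cycle cyc).
have sI := @perm_inj _ s; have Bax : B (a x) by rewrite /B plane_alpK xc orbT.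
have nv : samev (a x) (nx x) by apply: nextp_fconnect.
have Bn : B (nx x) by apply: nextp_P xy _ => //; rewrite /B yc.
case/orP: Bn => zc.
  by apply: circuit_inj => //; apply: samev_trans xy; rewrite samev_sym.
(* In the other case the dart found is the head of a circuit edge at the same vertex, which must be
   [x] itself; the turn around the vertex would then meet no other circuit dart. *)
have wy : next c (a (nx x)) = next c x.
  apply: circuit_inj; rewrite ?mem_next //; apply: samev_trans xy.
  rewrite samev_sym; apply: samev_trans nv _.
  by have := next_cycle cyc zc; rewrite plane_alpK.
have {}wy : a (nx x) = x.
  by have := congr1 (prev c) wy; rewrite !prev_next ?circuit_uniq.
have {}wy : nextp s B (a x) = a x by rewrite -[RHS](congr1 a wy) ?plane_alpK // -{1}wy.
have : fconnect (nextp s B) (a x) (next c x).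
  by rewrite fconnect_nextp // /B yc.
move/iter_findex; have -> : iter (findex (nextp s B) (a x) (next c x)) (nextp s B) (a x) = a x.
  by elim: (findex _ _ _) => //= n ->.
by move=> E; have := circuit_out yc; rewrite -E Oor circuit_out.
Qed.

Lemma circuit_fcycle : fcycle nx c.
Proof.
have := cycle_next circuit_uniq; apply: sub_in_cycle (allss c).
by move=> x y xc _ /=; rewrite circuit_next.
Qed.

Lemma circuit_sides : exists X : pred D,
  [/\ forall x, X (phi x) = X x, forall x, x \in c -> X x, forall x, x \in c -> ~~ X (a x)
    & forall y, y \notin c -> a y \notin c -> X (a y) = X y].
Proof.
apply: (@plane_jordan (fun x => x \in c)) => [x xc|x xc|x y xc yc].
- by apply/negP => /circuit_out; rewrite Oor circuit_out.
- by rewrite [nextp _ _ _]circuit_next // mem_next.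
- exact: (connect_cycle circuit_fcycle).
Qed.

End Circuit.

(** Iterating a choice of continuation ends in a period. The choice [ch] depends on the vertex
    alone, so the period visits each vertex at most once. *)
Lemma circuit_exists (E : pred D) : (forall x, E x -> out x) ->
  (forall x, E x -> exists2 y, E y & samev (a x) y) -> (exists x, E x) ->
  exists2 c, is_circuit c & {subset c <= E}.
Proof.
move=> Eout Enext [x0 Ex0].
pose ch v := odflt v [pick y | E y && samev v y].
pose psi x := ch (froot s (a x)).
have sC := fconnect_sym (@perm_inj _ s).
have psiP x : E x -> E (psi x) /\ samev (a x) (psi x).
  move=> Ex; rewrite /psi /ch; case: pickP => [y /andP[Ey ry]|/=].
    by split=> //; apply: samev_trans ry; apply: connect_root.
  have [y Ey xy] := Enext x Ex => /(_ y); rewrite Ey /=.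
  by rewrite (samev_trans _ xy) // samev_sym; apply: connect_root.
have [i lti Ei] := trajectP (looping_order psi x0).
set w := iter i psi x0 in Ei.
have Ew n : E (iter n psi w).
  by rewrite /w -iterD; elim: (_ + _) => //= k /psiP[].
have cw : fcycle psi (fingraph.orbit psi w).
  apply/(@orbitPcycle _ psi w 3 0); exists (fingraph.order psi x0 - i).-1.
  by rewrite prednK ?subn_gt0 // /w -iterD subnK ?(ltnW lti).
have EO : {subset fingraph.orbit psi w <= E}.
  by move=> x; rewrite -fconnect_orbit => /iter_findex <-; apply: Ew.
exists (fingraph.orbit psi w) => //; split.
- by rewrite -size_eq0 size_orbit -lt0n fingraph.order_gt0.
- by apply/allP => x /EO /Eout.
- move: cw; apply: sub_in_cycle (allss _) => x y /EO/psiP[_ H] _ /=.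
  by move=> /eqP <-.
have := orbit_uniq psi w; rewrite uniq_pairwise.
apply: sub_in_pairwise (allss _) => x y xc yc /=; apply: contra => xy.
have cp z : z \in fingraph.orbit psi w -> exists2 u, u \in fingraph.orbit psi w & psi u = z.
  by move=> zc; exists (prev (fingraph.orbit psi w) z); rewrite ?mem_prev //; apply/eqP/(prev_cycle cw).
have [u uc ux] := cp x xc; have [v vc vy] := cp y yc.
rewrite -ux -vy /psi; apply/eqP; congr ch; apply/(fingraph.rootP sC).
have [_] := psiP u (EO u uc); have [_] := psiP v (EO v vc); rewrite ux vy => vy' ux'.
by apply: samev_trans ux' _; apply: samev_trans xy _; rewrite samev_sym.
Qed.

(* A union [X] of faces whose boundary edges all have [X] on their left
   contains the root-face. *)
Lemma minimal_cut (X : pred D) : minimal O ->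
  (forall x, X (phi x) = X x) -> (forall x, X x -> ~~ X (a x) -> out x) ->
  (exists x, X x) -> X (@oroot O).
Proof.
move=> Omin Xphi Xout [x0 Xx0]; apply/negPn/negP => nXr.
(* [G] is the part of the complement of [X] reached from the root-face across edges with no side in
   [X]. *)
pose g x y := samef x y || [&& y == a x, ~~ X x & ~~ X y].
pose G := connect g (@oroot O).
have Gnear x y : G x -> g x y -> G y.
  by move=> Gx gxy; apply: connect_trans Gx (connect1 _).
have GX y : G y -> ~~ X y.
  case/connectP=> p; elim/last_ind: p y => [|p z IHp] y /=; first by move=> _ ->.
  rewrite rcons_path last_rcons => /andP[/IHp/(_ erefl) nX gz] ->.
  case/orP: gz => [sf|/and3P[_ _ //]]; by rewrite (samef_inv Xphi sf).
have Gphi x : G (phi x) = G x.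
  apply: homo_inj_closed; first exact: perm_inj.
  by move=> z Gz; apply: Gnear Gz _; rewrite /g /samef fconnect1.
(* The edges with [X] on their left and [G] on their right; a circuit made of them has the root-face
   on the wrong side. *)
pose E x := X x && G (a x).
have GE z : ~~ G z -> G (a z) -> E z.
  move=> nGz Gaz; rewrite /E Gaz andbT; apply: contraR nGz => nXz.
  by apply: (Gnear _ _ Gaz); rewrite /g plane_alpK eqxx nXz (GX _ Gaz) orbT.
have [E0|E0] := boolP [exists x, E x]; last first.
  have Ga x : G (a x) = G x.
    apply: homo_inj_closed; first exact: perm_inj.
    move=> z Gz; apply: contraR E0 => nG; apply/existsP; exists (a z).
    by apply: GE; rewrite ?plane_alpK.
  have Gs x : G (s x) = G x by rewrite -{1}[x]plane_alpK -ophiE Gphi Ga.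
  have Gx0 : G x0 by rewrite (plane_trans Gs Ga x0 (@oroot O)); apply: connect0.
  by have := GX _ Gx0; rewrite Xx0.
have [|||c Oc cE] := @circuit_exists E.
- by move=> x /andP[Xx /GX]; apply: Xout.
(* Turning clockwise at the head from [phi x], in [X], to [a x], in [G], the entry into [G] crosses
   an edge of [E]. *)
- move=> x /andP[Xx Gax]; apply/exists_inP; apply: contraTT Gax => /exists_inPn H.
  have nGi n : ~~ G (iter n s (s (a x))).
    elim: n => [|n IHn]; first by rewrite /= -ophiE Gphi; apply: contraL Xx; apply: GX.
    apply: contra IHn => /= Gs; apply/negPn/negP => nG.
    have /H : E (iter n s (s (a x))) by apply: GE => //; rewrite -Gphi ophiE plane_alpK.
    by rewrite /samev -iterSr fconnect_iter.
  have /iter_findex <- : fconnect s (s (a x)) (a x); last exact: nGi.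
  by rewrite fconnect_sym ?fconnect1 //; apply: perm_inj.
- exact/existsP.
have [Z [Zphi Zc nZc Za]] := circuit_sides Oc.
have [c0 _ _ _] := Oc; have [x xc] : exists x, x \in c by case: (c) c0 => // x ? _; exists x; rewrite inE eqxx.
have Zr : Z (@oroot O).
  have hc : Z (head (@oroot O) c) by apply: Zc; case: (c) c0 => //= *; rewrite inE eqxx.
  have /connectP[p] := Omin c Oc; elim: p (head _ _) hc => [|z p IHp] y Zy /=; first by move=> _ ->.
  case/andP=> st; apply: IHp; case/orP: st => [sf|/andP[/andP[/eqP-> yc] ayc]].
    by rewrite (samef_inv Zphi sf).
  by rewrite Za.
have := cE x xc; rewrite unfold_in => /andP[_ Gax].
(* Every circuit edge has a side in [X], so a path inside [G] crosses none and carries [Z] from the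
   root-face to the right of [x]. *)
have nXc y : ~~ X y -> y \notin c by apply: contra => /cE /andP[].
have : Z (a x); last by apply/negP/nZc.
case/connectP: Gax => p; elim: p (@oroot O) Zr => [|z p IHp] y Zy /=; first by move=> _ ->.
case/andP=> st; apply: IHp; case/orP: st => [sf|/and3P[/eqP zE nXy nXz]].
  by rewrite (samef_inv Zphi sf).
by rewrite zE Za ?nXc // -zE.
Qed.

(** The nearest ingoing dart counterclockwise, given by axioms because a reconstructed map obtains
    it from the contour word and not by a search around the vertex. *)
Record is_owner (o : D -> D) : Prop := IsOwner {
  owner_head : forall x, ~~ out x -> o x = x;
  owner_tail : forall x, out x -> o x = o ((s^-1)%g x);
  owner_in : forall x, ~~ out (o x);
  owner_samev : forall x, samev (o x) x }.

Lemma owner_exists : (forall x, exists2 h, samev x h & ~~ out h) -> exists o, is_owner o.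
Proof.
move=> H; have sI := @perm_inj _ (s^-1)%g.
pose nh := nextp (s^-1)%g (fun x => ~~ out x).
have sVs x y : fconnect (s^-1)%g x y = samev x y.
  by rewrite -!porbit_fconnect porbitV porbit_fconnect.
have nhP x : ~~ out (nh x).
  by have [h xh oh] := H x; apply: (@nextp_P _ _ (fun y => ~~ out y) sI x h); rewrite ?sVs.
exists (fun x => if out x then nh x else x); split=> [x /negPf-> //|x ox|x|x].
- by rewrite ox [LHS](nextp_step_in sI (nhP x)) if_neg.
- by case: ifPn => // _; apply: nhP.
- case: ifPn => _; last exact: connect0.
  by rewrite samev_sym -sVs; apply: nextp_fconnect.
Qed.

Section Owner.
Variable o : D -> D.
Hypothesis oP : is_owner o.

(** The descent to the owner read clockwise: from just after the owner up to [x] every dart is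
    outgoing and has the same owner. *)
Lemma owner_sector x : out x -> exists i, x = iter i.+1 s (o x) /\
  forall j, j <= i -> out (iter j.+1 s (o x)) /\ o (iter j.+1 s (o x)) = o x.
Proof.
move=> ox; pose v n := iter n (s^-1)%g x.
have sv n : s (v n.+1) = v n by rewrite /v iterS permKV.
have [m [Hm hm]] : exists m, ~~ out (v m.+1) /\ forall j, j <= m -> out (v j).
  have ex : exists k, ~~ out (v k).
    have /iter_findex := owner_samev oP x; set k := findex _ _ _ => E; exists k.
    suff -> : v k = o x by apply: owner_in.
    rewrite /v -[X in iter _ _ X]E; elim: k {E} => //= k IHk.
    by rewrite -iterS iterSr permK.
  case: (ex_minnP ex) => -[|m] hm mmin; first by rewrite /v /= ox in hm.
  by exists m; split=> // j lej; apply: contraTT lej => /mmin; rewrite -ltnNge.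
have ov j : j <= m.+1 -> o (v j) = o x.
  elim: j => // j IHj lt; rewrite -(IHj (ltnW lt)) [in RHS](owner_tail oP) //.
  exact: hm.
have oE : o x = v m.+1 by rewrite -(ov m.+1) // (owner_head oP).
have it j : j <= m.+1 -> iter j s (v m.+1) = v (m.+1 - j).
  elim: j => [|j IHj] lt; first by rewrite subn0.
  by rewrite iterS IHj ?(ltnW lt) // subSS subSn // sv.
exists m; rewrite oE; split=> [|j le]; first by rewrite it // subnn.
by rewrite it // subSS; split; [apply: hm; apply: leq_subr|rewrite ov ?leqW ?leq_subr].
Qed.

End Owner.
End Plane.
End Orient.

(** * Chains of leftmost incoming edges *)

Section Drain.
Variable O : fro.
Local Notation D := (oD O).
Local Notation s := (@osig O).
Local Notation a := (@oalp O).
Local Notation out := (@oout O).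
Local Notation phi := (ophi O).
Hypotheses (Opl : is_plane_map O) (Oor : is_orientation O).

Definition par (o : D -> D) (h : D) := o (a h).

Definition drains (o : D -> D) :=
  forall h, ~~ out h -> exists n, inroot (a (iter n (par o) h)).

Let aK := plane_alpK Opl.
Let phiV := phiV_alp Opl.

Lemma par_head o : is_owner o -> forall n h, ~~ out h -> ~~ out (iter n (par o) h).
Proof. by move=> oP [|n] h oh //; apply: (owner_in oP). Qed.

Section Sufficient.
Variable o : D -> D.
Hypotheses (oP : is_owner o) (odr : drains o).
Hypothesis root_out : forall x, inroot x -> out x.

Lemma root_sV x : inroot x -> (s^-1)%g x = a ((phi^-1)%g x).
Proof. by rewrite phiV aK. Qed.

(** The preceding edge of the root contour arrives immediately counterclockwise of [x]; a chain that
    meets the contour thus runs along it backwards. *)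
Lemma root_owner x : inroot x -> o x = a ((phi^-1)%g x).
Proof.
move=> rx; rewrite (owner_tail oP) ?root_out // root_sV // (owner_head oP) //.
by rewrite Oor root_out // inroot_phiV.
Qed.

Lemma par_root h : inroot (a h) -> inroot (a (par o h)).
Proof. by move=> rh; rewrite /par root_owner // aK inroot_phiV. Qed.

(** A draining chain, read backwards, is a directed path from an outer vertex. *)
Lemma drains_accessible : accessible O.
Proof.
have Hh h : ~~ out h -> exists2 r, inroot r & connect (@reach_step O) r h.
  move=> oh; have [n] := odr oh; elim: n h oh => [|n IHn] h oh.
    move=> ra; have {}ra : inroot (a h) := ra; exists (a h) => //; apply: connect1.
    by rewrite /reach_step aK eqxx andbT root_out ?orbT.
  rewrite iterSr => /IHn[]; first exact: (owner_in oP).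
  move=> r rr c; exists r => //; apply: (connect_trans c).
  apply: (@connect_trans _ _ (a h)).
    by apply: connect1; rewrite /reach_step (owner_samev oP).
  by apply: connect1; rewrite /reach_step Oor oh aK eqxx andbT orbT.
move=> d; have [r rr c] := Hh (o d) (owner_in oP d); exists r => //.
by apply: (connect_trans c); apply: connect1; rewrite /reach_step (owner_samev oP).
Qed.

(* Heads with a circuit on or strictly left of it have their [par]-chain on the
   same side, since the chain always takes the leftmost incoming edge. *)
Lemma drains_minimal : minimal O.
Proof.
move=> c Oc; rewrite /clockwise; set x0 := head _ c; set L := connect (left_step c) x0.
have [c0 _ _ _] := Oc.
have x0c : x0 \in c by rewrite /x0; case: (c) c0 => //= *; rewrite inE eqxx.
have Lnear x y : L x -> left_step c x y -> L y.
  by move=> Lx xy; apply: (connect_trans Lx); apply: connect1.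
have Lphi x : L (phi x) = L x.
  apply: homo_inj_closed; first exact: perm_inj.
  by move=> z Gz; apply: (Lnear _ _ Gz); rewrite /left_step /samef fconnect1.
have La x : x \notin c -> a x \notin c -> L x -> L (a x).
  by move=> xc axc Lx; apply: (Lnear _ _ Lx); rewrite /left_step eqxx xc axc orbT.
(* Each left sector leads from one circuit edge to the next without crossing the circuit. *)
have Lc x : x \in c -> L x.
  move=> xc; have /iter_findex <- := connect_cycle (circuit_fcycle Opl Oor Oc) x0c xc.
  set nx := (fun x => _); set k := findex _ _ _.
  suff [] : L (iter k nx x0) /\ iter k nx x0 \in c by [].
  elim: k => [|n [Ln cn]]; first by split=> //; apply: connect0.
  rewrite iterS; move: (iter n _ _) Ln cn => {xc}x Lx xc.
  have xn : nx x = next c x by apply: circuit_next.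
  split; last by rewrite xn mem_next.
  pose B y := (y \in c) || (a y \in c).
  have sI := @perm_inj _ s; have nv : fconnect s (a x) (nx x) by apply: nextp_fconnect.
  have [|m [Em _ Hm]] := @nextp_ex _ s B (a x).
    exists (findex s (s (a x)) (nx x)); rewrite iterSr iter_findex.
      by rewrite /B xn mem_next xc.
    by rewrite -same_fconnect1.
  suff : L (iter m.+1 s (a x)) by rewrite -Em.
  elim: m Hm {Em} => [|m IHm] Hm; first by rewrite /= -ophiE Lphi.
  have {IHm}Lz := IHm (fun i lt => Hm i (ltnW lt)).
  have := Hm m (leqnn _); rewrite negb_or => /andP[zc azc].
  by rewrite iterS -{1}[iter _ _ _]aK -ophiE Lphi La.
(* Turning counterclockwise from [t] to its owner passes outgoing darts only: one on the circuit is
   in [L] already, any other may be crossed. *)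
have walk t : out t -> L t -> L (a (o t)).
  move=> ot Lt; have [i [tE Hi]] := owner_sector oP ot.
  have aux j : j <= i -> L (iter (i - j).+1 s (o t)).
    elim: j => [|j IHj] lt; first by rewrite subn0 -tE.
    have := IHj (ltnW lt); have [oz _] := Hi (i - j.+1) (leq_subr _ _).
    rewrite -(subnSK lt) iterS; set z := iter (i - j.+1).+1 s (o t) in oz *.
    rewrite -{1}[z]aK -ophiE Lphi => Laz.
    have [/Lc //|zc] := boolP (z \in c).
    have azc : a z \notin c by apply/negP => /(circuit_out Oc); rewrite Oor oz.
    by rewrite -[z]aK; apply: La; rewrite ?aK.
  by have := aux i (leqnn _); rewrite subnn /= -{1}[o t]aK -ophiE Lphi.
have ox0 : out x0 := circuit_out Oc x0c.
have oh0 : ~~ out (a x0) by rewrite Oor ox0.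
have [n rn] := odr oh0.
have Ln : L (a (iter n (par o) (a x0))).
  elim: n {rn} => [|n IHn] /=; first by rewrite aK; apply: connect0.
  by apply: walk => //; rewrite Oor par_head.
apply: (connect_trans Ln); apply: connect1; rewrite /left_step.
by rewrite samef_sym [samef _ _]rn.
Qed.

End Sufficient.

(** A directed path that starts outside [Y] cannot enter it, so the path that reaches [y] starts in
    [Y]. *)
Lemma accessible_cut (Y : pred D) : accessible O -> (forall x, Y (s x) = Y x) ->
  (forall t, out t -> ~~ Y t -> ~~ Y (a t)) -> (exists y, Y y) ->
  exists2 t, inroot t & Y t.
Proof.
move=> acc Ys Yin [y Yy]; have [r rr c] := acc y; exists r => //.
apply: contraTT Yy; case/connectP: c => p; elim: p r {rr} => [|z p IHp] r /=; first by move=> _ ->.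
case/andP=> /orP[rz|/andP[or /eqP->]] pp ye nYr; apply: IHp ye _ => //.
  by rewrite (samev_inv Ys rz).
exact: Yin.
Qed.

Section Necessary.
Hypotheses (Ocw : cw_minimal O) (Oacc : accessible O).

Lemma cw_root_out x : inroot x -> out x.
Proof.
move=> rx; apply: contraT => ox; have [_ H] := Ocw.
by have := H (a x); rewrite Oor ox aK rx orbT => /(_ isT isT).
Qed.

(** A vertex without ingoing edge is accessible only if it is outer, and an outer vertex receives
    the preceding edge of the root contour. *)
Lemma cw_has_head x : exists2 h, samev x h & ~~ out h.
Proof.
apply/exists_inP; apply: contraT => /exists_inPn H.
have {}H h : samev x h -> out h by move=> /H; rewrite negbK.
have [||||t rt xt] := @accessible_cut (samev x).
- exact: Oacc.
- by move=> z; rewrite /samev -same_fconnect1_r //; apply: perm_inj.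
- by move=> t ot _; apply/negP => /H; rewrite Oor ot.
- by exists x; apply: connect0.
have /H : samev x ((s^-1)%g t).
  by move: xt; rewrite -{1}[t](permKV s) /samev -same_fconnect1_r //; apply: perm_inj.
by rewrite root_sV // Oor cw_root_out // inroot_phiV.
Qed.

(** The chain ends in a cycle, whose edges form a directed closed walk with left sectors free of
    walk edges. Its left side [X] contains the root-face by minimality. Accessibility then yields an
    outer vertex that has a corner off [X]; its root corner, being in [X], is owned by a dart of the
    cycle, so the cycle meets the root contour. *)
Lemma in_O_drains o : is_owner o -> drains o.
Proof.
move=> oP h oh; pose f := par o.
have [i lti Ei] := trajectP (looping_order f h).
set w := iter i f h in Ei; set W := fingraph.orbit f w.
have cw : fcycle f W.
  apply/(@orbitPcycle _ f w 3 0); exists (fingraph.order f h - i).-1.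
  by rewrite prednK ?subn_gt0 // /w -iterD subnK ?(ltnW lti).
have Wf z : z \in W -> f z \in W by move=> ?; apply: fingraph.mem_orbit.
have Wh z : z \in W -> exists n, z = iter n f h.
  rewrite -fconnect_orbit => /iter_findex <-; exists (findex f w z + i).
  by rewrite iterD.
have Win z : z \in W -> ~~ out z by case/Wh=> n ->; apply: par_head.
have finj : {in W &, injective f} by apply/(@orbitPcycle _ f w 0 5).
(* The tails of the edges of the cycle: the walk follows the orientation, against the chain. *)
pose C x := a x \in W.
have Cout x : C x -> out x by move=> /Win; rewrite Oor negbK.
pose B y := C y || C (a y).
pose nx x := nextp s B (a x).
have sI := @perm_inj _ s.
(* From a dart of the cycle clockwise to the cycle tail that it owns all darts are outgoing, so the
   first walk edge met is left through its tail. *)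
have nxP x : C x -> exists n, [/\ nx x = iter n.+1 s (a x), C (nx x), f (a (nx x)) = a x &
    forall j, j <= n -> out (iter j.+1 s (a x)) /\ o (iter j.+1 s (a x)) = a x].
  move=> Cx; pose g := prev W (a x).
  have gW : g \in W by rewrite mem_prev.
  have fg : f g = a x by apply/eqP; apply: (prev_cycle cw).
  have Cx' : C (a g) by rewrite /C aK.
  have [k [kE Hk]] := owner_sector oP (Cout _ Cx').
  have oE : o (a g) = a x by [].
  rewrite oE in kE Hk.
  have [|n [En Bn Hn]] := @nextp_ex _ s B (a x).
    by exists k; rewrite -kE /B Cx'.
  have le : n <= k by rewrite leqNgt; apply/negP => /Hn; rewrite -kE /B Cx'.
  have [on o1] := Hk n le; rewrite -En in on o1.
  have Cn : C (nx x).
    by case/orP: Bn => // /Cout; rewrite Oor on.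
  exists n; split=> //; first by rewrite /f /par aK.
  by move=> j lej; apply: Hk; apply: leq_trans le.
have Cnx x : C x -> C (nx x) by move=> /nxP[n []].
have [|||X [Xphi XC nXC Xa]] := @plane_jordan O Opl C.
- by move=> x /Cout ox; apply/negP => /Cout; rewrite Oor ox.
- exact: Cnx.
- move=> x y Cx Cy; have := connect_cycle cw Cy Cx => /iter_findex.
  move: (findex f (a y) (a x)) => n; elim: n x Cx => [|n IHn] x Cx /=.
    by move/(@perm_inj _ a) ->; apply: connect0.
  have [m [_ Cn fn _]] := nxP x Cx; rewrite -fn => /finj E.
  apply: (connect_trans (fconnect1 _ _)); apply: IHn => //; apply: E => //.
  by elim: (n) => //= k; apply: Wf.
have bound u : ~~ X u -> X (a u) -> u \in W.
  move=> nXu Xau; rewrite -[u]aK -/(C (a u)); apply/negPn/negP => nC.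
  have nCu : ~~ C u by apply: contra nXu; apply: XC.
  by move: nXu; rewrite -(Xa u) // Xau.
have Xr : X (@oroot O).
  apply: minimal_cut => //; first by case: Ocw.
    move=> x Xx nXa; have := bound (a x) nXa; rewrite aK => /(_ Xx) /Win.
    by rewrite Oor negbK.
  by exists (a w); apply: XC; rewrite /C aK /W in_orbit.
(* The vertices with a corner off [X]. Their darts in [X] are outgoing, so no edge enters [Y] from a
   vertex lying wholly in [X]. *)
pose Y v := [exists d, samev v d && ~~ X d].
have Ys x : Y (s x) = Y x.
  by apply: eq_existsb => d; rewrite /samev -same_fconnect1.
have Y_left d : X d -> Y d -> out d /\ o d \in W.
  move=> Xd /existsP[e /andP[de nXe]].
  have [i0 [Xi nXi]] : exists i0, (forall j, j <= i0 -> X (iter j (s^-1)%g d)) /\ ~~ X (iter i0.+1 (s^-1)%g d).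
    have ex : exists k, ~~ X (iter k (s^-1)%g d).
      have : fconnect (s^-1)%g d e.
        by rewrite -porbit_fconnect porbitV porbit_fconnect.
      by move/iter_findex=> E; exists (findex (s^-1)%g d e); rewrite E.
    case: (ex_minnP ex) => -[|m] hm mmin; first by rewrite Xd in hm.
    by exists m; split=> // j lej; apply: contraTT lej => /mmin; rewrite -ltnNge.
  set u := iter i0.+1 _ d in nXi.
  have it j : j <= i0.+1 -> iter j s u = iter (i0.+1 - j) (s^-1)%g d.
    elim: j => [|j IHj] lt; first by rewrite subn0.
    by rewrite iterS IHj ?(ltnW lt) // subSS subSn // iterS permKV.
  have Xs j : j <= i0 -> X (iter j.+1 s u).
    by move=> le; rewrite it // subSS; apply: Xi; apply: leq_subr.
  have uW : u \in W by apply: bound => //; have := Xs 0 isT; rewrite /= -{1}[u]aK -ophiE Xphi.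
  have Cu : C (a u) by rewrite /C aK.
  have [n [En Cn _ Hn]] := nxP _ Cu; rewrite aK in En Hn.
  have le : i0 <= n.
    rewrite leqNgt; apply/negP => /Xs; rewrite iterS -En -{1}[nx _]aK -ophiE Xphi.
    by apply/negP/nXC.
  have dE : d = iter i0.+1 s u by rewrite it // subnn.
  by have [oi oo] := Hn i0 le; rewrite -dE in oi oo; rewrite oi oo.
have [||t rt Yt] := @accessible_cut Y Oacc Ys.
- move=> t ot nYt; have Xv d : samev t d -> X d.
    by move=> td; apply: contraR nYt => nXd; apply/existsP; exists d; rewrite td.
  have Xat : X (a t) by rewrite -Xphi ophiE aK Xv ?/samev ?fconnect1.
  by apply/negP => /(Y_left _ Xat)[]; rewrite Oor ot.
- exists w; apply/existsP; exists w; rewrite /samev connect0 /=.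
  by rewrite -[w]aK; apply: nXC; rewrite /C aK /W in_orbit.
have Xt : X t by rewrite (samef_inv Xphi rt).
have [ot] := Y_left t Xt Yt; case/Wh => n oE; exists n; rewrite -oE.
by rewrite (root_owner oP cw_root_out rt) aK inroot_phiV.
Qed.

End Necessary.
End Drain.

(** * The contour word of the mobile *)

(** The letters from [x] included to [y] excluded form a concatenation of balanced blocks. *)
Inductive skips (T : Type) (f : T -> T) (op cl : T -> bool) : T -> T -> Prop :=
| Skip0 x : skips f op cl x x
| SkipS x t y : op x -> skips f op cl (f x) t -> cl t -> skips f op cl (f t) y ->
    skips f op cl x y.

Lemma skips_trans (T : Type) (f : T -> T) (op cl : T -> bool) (x y z : T) :
  skips f op cl x y -> skips f op cl y z -> skips f op cl x z.
Proof.
by move=> xy; elim: xy z => // {x y}x t y ox xt _ ct _ IH z /IH; apply: SkipS.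
Qed.

Lemma skips_rcons (T : Type) (f : T -> T) (op cl : T -> bool) (x y t : T) : skips f op cl x y ->
  op y -> skips f op cl (f y) t -> cl t -> skips f op cl x (f t).
Proof.
by move=> xy oy yt ct; apply: skips_trans xy (SkipS oy yt ct (Skip0 _ _ _ _)).
Qed.

(** A closing letter at level zero ends the balanced prefix, so there is only one place to stop. *)
Lemma skips_det (T : Type) (f : T -> T) (op cl : T -> bool) (x t t' : T) : (forall z, op z -> ~~ cl z) ->
  skips f op cl x t -> cl t -> skips f op cl x t' -> cl t' -> t = t'.
Proof.
move=> disj xt; elim: xt t' => [{x t}x t'|{x t}x t y ox xt IH1 ct ty IH2 t'] cy xt' ct'.
  by case: xt' cy ct' => // z t'' y oz _ _ _; rewrite (negPf (disj _ oz)).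
case: xt' ox IH1 IH2 ct'.
  by move=> z oz _ _ /(negP (disj _ oz)).
move=> z t1 z' oz xt1 ct1 tz' _ IH1 IH2 cz'.
by rewrite -(IH1 _ ct xt1 ct1) in tz'; apply: IH2.
Qed.

(** Backwards, opening and closing letters are exchanged; the shift by [g] comes from the half-open
    interval. *)
Lemma skips_rev (T : Type) (f g : T -> T) (op cl : T -> bool) x y : cancel f g ->
  skips f op cl x y -> skips g cl op (g y) (g x).
Proof.
move=> fK; elim=> [z|{x y}x t y ox _ IH1 ct _ IH2]; first exact: Skip0.
apply: skips_trans IH2 _; rewrite fK; apply: (SkipS ct _ ox); last exact: Skip0.
by rewrite fK in IH1.
Qed.

Lemma skips_map (T T' : Type) (m : T -> T') (f : T -> T) (f' : T' -> T') (op cl : T -> bool) (op' cl' : T' -> bool) x y :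
  (forall z, op z || cl z -> m (f z) = f' (m z)) ->
  (forall z, op z -> op' (m z)) -> (forall z, cl z -> cl' (m z)) ->
  skips f op cl x y -> skips f' op' cl' (m x) (m y).
Proof.
move=> mf mo mc; elim=> [z|{x y}x t y ox _ IH1 ct _ IH2]; first exact: Skip0.
by rewrite !mf ?ox ?ct ?orbT // in IH1 IH2; apply: SkipS IH1 _ IH2; auto.
Qed.

(** * The core of an orientation and its contour *)

Section CoreOf.
Variable O : fro.
Local Notation D := (oD O).
Local Notation s := (@osig O).
Local Notation a := (@oalp O).
Local Notation out := (@oout O).
Local Notation phi := (ophi O).
Hypotheses (Opl : is_plane_map O) (Oor : is_orientation O).
Hypothesis root_out : forall x : D, inroot x -> out x.
Hypothesis has_head : forall x : D, exists2 h, samev x h & ~~ out h.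

Let aK := plane_alpK Opl.
Let sI := @perm_inj _ s.

Definition head_next (x : D) := nextp s (fun y => ~~ out y) x.
Definition shat (x : D) := if out x then x else head_next x.

Lemma head_next_in x : ~~ out (head_next x).
Proof. by have [h xh oh] := has_head x; apply: (@nextp_P _ _ (fun y => ~~ out y) sI x h). Qed.

Lemma out_shat x : out (shat x) = out x.
Proof. by rewrite /shat; case: ifP => // _; apply/negbTE/head_next_in. Qed.

Lemma shat_inj : injective shat.
Proof.
move=> x y E; have := out_shat x; rewrite E out_shat => oE; move: E; rewrite /shat oE.
case: ifPn => // ox; apply: nextp_inj => //; by rewrite unfold_in ?oE.
Qed.

Lemma root_shat x : inroot (shat x) = inroot x.
Proof.
rewrite /shat; case: ifPn => // ox; rewrite [RHS](negbTE (contra (@root_out _) ox)).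
by apply: contraNF (head_next_in x); apply: root_out.
Qed.

Local Notation N := {x : D | ~~ inroot x}.

Fact rootN_phiV (x : N) : ~~ inroot ((phi^-1)%g (val x)).
Proof. by rewrite inroot_phiV (valP x). Qed.
Fact rootN_shat (x : N) : ~~ inroot (shat (val x)).
Proof. by rewrite root_shat (valP x). Qed.

Definition coreb (x : N) : N := Sub ((phi^-1)%g (val x)) (rootN_phiV x).
Definition corew (x : N) : N := Sub (shat (val x)) (rootN_shat x).

Fact coreb_inj : injective coreb.
Proof. by move=> x y /(congr1 val) /perm_inj /val_inj. Qed.
Fact corew_inj : injective corew.
Proof. by move=> x y /(congr1 val) /shat_inj /val_inj. Qed.

Definition core_of (h : pred D) := Core (perm coreb_inj) (perm corew_inj) (fun x => h (val x)).

Lemma core_of_cb h (x : cN (core_of h)) : val (cb (core_of h) x) = (phi^-1)%g (val x).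
Proof. by rewrite permE. Qed.

Lemma core_of_cw h (x : cN (core_of h)) : val (cw (core_of h) x) = shat (val x).
Proof. by rewrite permE. Qed.

Section Tree.
Variable o : D -> D.
Hypotheses (oP : is_owner o) (odr : drains o).

(* [chi] walks around the mobile: an edge off the root-face contour opens a
   parenthesis at its ingoing dart and closes it at its outgoing dart. *)
Definition chi (x : D) := (phi^-1)%g (shat x).
Definition mopen (x : D) := ~~ out x && ~~ inroot (a x).
Definition mclose (x : D) := out x && ~~ inroot x.
Local Notation skp := (skips chi mopen mclose).

Lemma root_chi x : inroot (chi x) = inroot x.
Proof. by rewrite /chi inroot_phiV root_shat. Qed.

(** The contour enters the sector of [p] at its clockwise end and comes back towards [p]. For each
    outgoing dart [t] on the way it reads the block of the child [a t], closed by [t], and then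
    moves one dart counterclockwise. *)
Lemma sector_skips p : ~~ out p ->
  (forall h, mopen h -> par o h = p -> skp (chi h) (a h)) ->
  (forall t, out t -> o t = p -> skp (chi p) (a t)) /\
  (mopen p -> skp (chi p) (a p)).
Proof.
move=> op IH.
have [|n [En _ Hn]] := @nextp_ex _ s (fun y => ~~ out y) p.
  have [h ph oh] := has_head (s p); exists (findex s (s p) h).
  by rewrite iterSr iter_findex.
have {}Hn m : m < n -> out (iter m.+1 s p) by move/Hn; rewrite negbK.
have on m : m < n -> o (iter m.+1 s p) = p.
  elim: m => [|m IHm] lt; rewrite (owner_tail oP) ?Hn // iterS permK ?IHm ?(ltnW lt) //.
  by rewrite (owner_head oP).
have st i : i <= n -> (i < n) || mopen p -> skp (chi p) (a (iter (n - i) s p)).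
  elim: i => [|i IHi] le cond.
    rewrite subn0 /chi /shat (negPf op) [head_next _]En iterS.
    by rewrite (phiV_alp Opl) permK; apply: Skip0.
  have {IHi} := IHi (ltnW le); rewrite le => /(_ isT).
  rewrite -(subnSK le); set j := n - i.+1; set t := iter j.+1 s p => st.
  have ltj : j < n by rewrite /j ltn_subrL (leq_trans _ le).
  have ot : out t := Hn j ltj; have oo : o t = p := on j ltj.
  (* An outer dart comes directly after its owner [p], hence only at the last step; [p] is then on
     the root contour and [cond] excludes that step. *)
  have [rt|nrt] := boolP (inroot t).
    have sp : (s^-1)%g t = p.
      have := root_owner Opl Oor oP root_out rt; rewrite oo => ->.
      by rewrite root_sV.
    have E : iter j s p = p by move: sp; rewrite /t iterS permK.
    have r : inroot (a p) by rewrite -{1}sp root_sV // aK inroot_phiV.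
    move: cond; rewrite /mopen r andbF orbF => lt2.
    have j0 : 0 < j by rewrite /j subn_gt0.
    by have := Hn j.-1; rewrite prednK // E (negPf op) => /(_ (ltnW ltj)).
  have hat : mopen (a t) by rewrite /mopen Oor ot aK nrt.
  have := IH (a t) hat; rewrite /par aK => /(_ oo) H.
  have ct : mclose t by rewrite /mclose ot nrt.
  have cE : chi t = a (iter j s p) by rewrite /chi /shat ot (phiV_alp Opl) /t iterS permK.
  by have := skips_rcons st hat H ct; rewrite cE.
split=> [t ot oe|mp]; last by have := st n (leqnn _); rewrite mp orbT subnn; apply.
have [i [tE Hi]] := owner_sector oP ot; rewrite oe in tE Hi.
have lt : i < n.
  rewrite ltnNge; apply/negP => /Hi[]; rewrite -En.
  by rewrite (negPf (head_next_in p)).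
have := st (n - i.+1) (leq_subr _ _); rewrite subKn // -tE; apply.
by rewrite ltn_subrL (leq_trans _ lt).
Qed.

(** Induction on the number of darts whose chain meets [h]. It drops at the children of [h]: a dart
    on a cycle of [par] lies on the root contour because its chain drains, and [h] does not. *)
Lemma open_skips h : mopen h -> skp (chi h) (a h).
Proof.
have [m] := ubnP #|[set x | fconnect (par o) x h]|; elim: m h => // m IHm h lt mh.
have [oh nr] := andP mh.
apply: (proj2 (sector_skips oh _)) => // g mg pg; apply: IHm => //.
rewrite -ltnS; apply: leq_trans lt; rewrite ltnS; apply: proper_card; apply/properP; split.
  apply/subsetP => x; rewrite !inE => xg; apply: (connect_trans xg).
  by rewrite -pg fconnect1.
exists h; rewrite !inE ?connect0 //; apply: contra nr => hg.
have gh : fconnect (par o) g h by rewrite -pg fconnect1.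
have ph : fconnect (par o) (par o h) h.
  move: hg; rewrite fconnect_eqVf => /orP[/eqP E|hg]; last exact: connect_trans hg gh.
  by rewrite {1}E pg connect0.
have back n : fconnect (par o) (iter n (par o) h) h.
  elim: n => [|n]; first exact: connect0.
  by rewrite fconnect_eqVf => /orP[/eqP E|//]; rewrite iterS E.
have [n rn] := odr oh; have /iter_findex <- := back n.
elim: (findex _ _ _) => //= k; exact: par_root.
Qed.

(** Valid also when the parent is never closed, which ties the root contour to the rest of the
    word. *)
Lemma par_skips h : ~~ out h -> skp (chi (par o h)) h.
Proof.
move=> oh; have := proj1 (sector_skips (owner_in oP (a h)) (fun g mg _ => open_skips mg)) (a h).
by rewrite aK Oor oh; apply.
Qed.

(** [P] is constant along [chi], so a head agrees with its parent and with its closing dart. Chains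
    carry every head to the root contour, where parents run around the cycle. *)
Lemma core_of_trans (P : pred D) :
  (forall x, ~~ inroot x -> P ((phi^-1)%g x) = P x) ->
  (forall x, ~~ inroot x -> P (shat x) = P x) ->
  forall x y, ~~ inroot x -> ~~ inroot y -> P x = P y.
Proof.
move=> Pphi Pshat.
have Pchi x : ~~ inroot x -> P (chi x) = P x.
  by move=> rx; rewrite Pphi ?root_shat // Pshat.
have headN h : ~~ out h -> ~~ inroot h by apply: contra; apply: root_out.
have Psk x y : skp x y -> ~~ inroot x -> P x = P y.
  elim=> // {x y}x t y /andP[ox _] _ IH1 /andP[_ ct] _ IH2 rx.
  by rewrite -Pchi // IH1 ?root_chi // -Pchi // IH2 ?root_chi.
have Ppar h : ~~ out h -> P (par o h) = P h.
  move=> oh; have op := owner_in oP (a h).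
  by rewrite -Pchi ?headN // (Psk _ _ (par_skips oh)) // root_chi headN.
have Proot x : inroot x -> P (a x) = P (a (@oroot O)).
  move=> /iter_findex <-; elim: (findex _ _ _) => //= n <-.
  have rn k : inroot (iter k phi (@oroot O)) by apply: fconnect_iter.
  rewrite -[LHS]Ppar; last by rewrite Oor root_out // (rn n.+1).
  by rewrite /par aK (root_owner Opl Oor oP root_out (rn n.+1)) permK.
have Phead h : ~~ out h -> P h = P (a (@oroot O)).
  move=> oh; have [n rn] := odr oh.
  rewrite -(Proot _ rn) aK; elim: n {rn} => //= n ->.
  by rewrite Ppar // par_head.
suff H x : ~~ inroot x -> P x = P (a (@oroot O)) by move=> x y /H-> /H->.
move=> rx; have [ox|/Phead //] := boolP (out x).
have mx : mopen (a x) by rewrite /mopen Oor ox aK.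
rewrite -[x in LHS]aK -(Psk _ _ (open_skips mx)).
  by rewrite Pchi ?Phead ?headN // Oor ox.
by rewrite root_chi headN // Oor ox.
Qed.

Let R := [pred x | @inroot O x].
Let nH : #|[pred x | ~~ out x]| = fcard a predT.
Proof.
have [_ aN _ _] := Opl; have := card_involution aK aN.
rewrite -(cardC [pred x | ~~ out x]).
have -> : #|[predC [pred x | ~~ out x]]| = #|[pred x | ~~ out x]|.
  rewrite -[RHS](card_image (@perm_inj _ a)); apply: eq_card => x; rewrite !inE negbK.
  apply/idP/imageP => [ox|[y oy ->]]; last by rewrite Oor.
  by exists (a x); rewrite ?aK // inE Oor ox.
by move: #|_| (fcard _ _) => *; lia.
Qed.

Lemma core_of_card : #|{: N}| + outdeg O = fcard a predT * 2.
Proof.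
have [_ aN _ _] := Opl; rewrite -(card_involution aK aN) card_sig addnC.
by rewrite -(cardC R).
Qed.

(** With V, E, F the counts of [O]: [cb] has F - 1 orbits, and [cw] has V orbits of heads and E -
    [outdeg] fixed tails, on 2E - [outdeg] darts. The tree relation is Euler's formula. *)
Lemma core_of_tree h : core_tree (core_of h).
Proof.
split.
  move=> P Pb Pw x y.
  pose P' d := if insub d is Some z then P (z : N) else false.
  have P'E (z : N) : P' (val z) = P z by rewrite /P' valK.
  rewrite -!P'E; apply: core_of_trans; rewrite ?(valP x) ?(valP y) // => z rz.
    by have := Pb (Sub z rz); rewrite -!P'E core_of_cb SubK.
  by have := Pw (Sub z rz); rewrite -!P'E core_of_cw SubK.
have [_ _ _ eu] := Opl; have := core_of_card.
have cbE : fcard (cb (core_of h)) predT + 1 = nfaces O.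
  have phiVI := @perm_inj _ (phi^-1)%g.
  have rootE : fcard (phi^-1)%g R = 1.
    rewrite -(n_comp_connect (fconnect_sym phiVI) (@oroot O)); apply: eq_n_comp_r => x.
    change (fconnect phi (@oroot O) x = fconnect (phi^-1)%g (@oroot O) x).
    by rewrite -!porbit_fconnect porbitV.
  have VE : nfaces O = fcard (phi^-1)%g predT by rewrite /nfaces !fcard_porbits porbitsV.
  rewrite VE (n_compC R) rootE addnC; congr (_ + _).
  apply/esym; apply: (@fcard_embed _ _ val) => //; first exact: perm_inj.
  - exact: val_inj.
  - exact: core_of_cb.
  - by move=> x /=; split=> [rx|[y <-]]; [exists (Sub x rx)|exact: (valP y)].
have cwE : fcard (cw (core_of h)) predT + outdeg O = nverts O + fcard a predT.
  have shI := shat_inj; transitivity (fcard shat predT).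
    rewrite [in RHS](n_compC R) addnC; congr (_ + _).
      by rewrite fcard_fix // => x rx; rewrite /shat root_out.
    apply/esym; apply: (@fcard_embed _ _ val) => //; first exact: perm_inj.
    - exact: val_inj.
    - exact: core_of_cw.
    - by move=> x /=; split=> [rx|[y <-]]; [exists (Sub x rx)|exact: (valP y)].
  rewrite (n_compC [pred x | ~~ out x]); congr (_ + _).
    rewrite (@fcard_nextp _ s shat (fun x => ~~ out x)) //.
    by move=> x /negPf ox; rewrite /shat ox.
  rewrite fcard_fix; last by move=> x; rewrite /= negbK /shat => ->.
  have := cardC [pred x | ~~ out x]; rewrite nH => E; apply/eqP.
  rewrite -(eqn_add2l (fcard a predT)) E; have [_ aN _ _] := Opl.
  by rewrite (card_involution aK aN) muln2 addnn.
rewrite -[fcard a predT]/(nedgs O) in cwE *.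
move: cbE cwE eu; rewrite [#|cN _|](_ : _ = #|{: N}|) //.
move: (fcard _ _) (fcard _ _) #|_| (nfaces O) (nverts O) (nedgs O) (outdeg O) => *; lia.
Qed.

Lemma core_of_excess : (#|@ch (core_of (fun x => ~~ out x))|%:Z -
  #|predC (@ch (core_of (fun x => ~~ out x)))|%:Z = (outdeg O)%:Z)%R.
Proof.
have E : #|@ch (core_of (fun x => ~~ out x))| = fcard a predT.
  rewrite -nH -(card_image (@val_inj _ _ (cN (core_of (fun x => ~~ out x))))).
  apply: eq_card => x; apply/imageP/idP => [[y oy ->] //|ox].
  have rx : ~~ inroot x by apply: contra ox; apply: root_out.
  by exists (Sub x rx).
have := cardC (@ch (core_of (fun x => ~~ out x))); rewrite E.
have := core_of_card; rewrite -[#|{: N}|]/(#|cN (core_of (fun x => ~~ out x))|).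
by move: #|_| #|_| (outdeg O) (fcard _ _) => *; lia.
Qed.

Lemma core_of_excessM : (#|@ch (core_of mopen)|%:Z -
  #|predC (@ch (core_of mopen))|%:Z = - (outdeg O)%:Z)%R.
Proof.
have E : #|@ch (core_of mopen)| + outdeg O = fcard a predT.
  rewrite -nH -(cardID (fun x => inroot (a x)) [pred x | ~~ out x]) addnC; congr (_ + _).
    rewrite /outdeg -(card_image (@perm_inj _ a)); apply: eq_card => x; rewrite !inE.
    apply/imageP/andP => [[y ry ->]|[rx ox]]; last by exists (a x); rewrite ?aK.
    by rewrite -[_ \in _]/(inroot (a (a y))) aK Oor root_out.
  rewrite -(card_image (@val_inj _ _ (cN (core_of mopen)))).
  apply: eq_card => x; rewrite !inE; apply/imageP/andP => [[y /andP[oy ry] ->] //|[rx ox]].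
  have nx : ~~ inroot x by apply: contra ox; apply: root_out.
  by exists (Sub x nx) => //; rewrite unfold_in /= /mopen ox.
have := cardC (@ch (core_of mopen)).
have := core_of_card; rewrite -[#|{: N}|]/(#|cN (core_of mopen)|).
by move: E; move: #|_| #|_| #|_| (outdeg O) (fcard _ _) => *; lia.
Qed.

End Tree.
End CoreOf.

Lemma nextp_ext (T : finType) (f : T -> T) (P P' : pred T) x :
  (forall y, fconnect f x y -> P y = P' y) -> nextp f P x = nextp f P' x.
Proof.
move=> PP'; rewrite /nextp (@eq_in_find _ P P') // => y /trajectP[i _ ->].
by apply: PP'; rewrite -iterSr fconnect_iter.
Qed.

(** * The cores describe [PhiP] and [PhiM] *)

Section MobOf.
Variable O : fro.
Local Notation D := (oD O).
Local Notation s := (@osig O).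
Local Notation a := (@oalp O).
Local Notation out := (@oout O).
Local Notation phi := (ophi O).
Hypotheses (Opl : is_plane_map O) (Oor : is_orientation O).
Hypothesis root_out : forall x : D, inroot x -> out x.
Hypothesis has_head : forall x : D, exists2 h, samev x h & ~~ out h.

Let aK := plane_alpK Opl.
Local Notation C h := (core_of root_out has_head h).

Lemma mob_of_core (out' del h : pred D) :
  (forall x, ~~ inroot x -> out' x = ~~ h x) -> (forall x, h x -> ~~ del x) ->
  (forall x, h x -> ~~ out x) ->
  (forall x, h x -> nextp s (fun y => ~~ out' y && ~~ inroot y && ~~ del y) x = shat x) ->
  (forall x, h x -> h (shat x)) ->
  mob_iso (mob_core (C h)) (mob_of s a out' (@oroot O) del).
Proof.
move=> out'h hdel hout hnext hshat.
have hroot x : h x -> ~~ inroot x by move/hout; apply: contra; apply: root_out.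
have validE x : (~~ out' x && ~~ inroot x && ~~ del x) = h x.
  have [rx|rx] := boolP (inroot x).
    by rewrite andbF; apply/esym/negP => /hroot; rewrite rx.
  by rewrite out'h // negbK andbT; have [/hdel ->|//] := boolP (h x).
pose F (d : mD (mob_core (C h))) : mdart D := match d with
  | inl x => if h (val x) then inl (inr (val x)) else inr (val x)
  | inr k => inl (inl (val (val k))) end.
have Fv d : mvalid s a out' (@oroot O) del (F d).
  case: d => [x|k] /=; last by move: (valP k); rewrite /= -validE.
  case: ifP => hx /=; first by move: hx; rewrite -validE.
  by rewrite -[fconnect _ _ _]/(inroot _) (valP x) out'h ?(valP x) // hx.
have rawsigF d : rawsig s a out' (@oroot O) del (F d) = F (@msig (mob_core (C h)) d).
  (* No corner off the root-face is discarded, so the search in [bnext] stops after one step of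
     [phi^-1]. *)
  have bn x : ~~ inroot x -> bnext s a out' (@oroot O) del x =
      if out' ((phi^-1)%g x) then inr ((phi^-1)%g x) else inl (inr ((phi^-1)%g x)).
    move=> rx; have rx' : ~~ inroot ((phi^-1)%g x) by rewrite inroot_phiV.
    rewrite /bnext /= [nextp _ _ _](_ : _ = (phi^-1)%g x) //.
    rewrite nextp_step; last exact: perm_inj.
    rewrite ifT // -[fconnect _ _ _]/(inroot _) rx' /= out'h //.
    by have [/hdel ->|//] := boolP (h _); rewrite ?orbT.
  case: d => [x|k].
    have -> : rawsig s a out' (@oroot O) del (F (inl x)) = bnext s a out' (@oroot O) del (val x).
      by rewrite /F; case: ifP.
    by rewrite bn ?(valP x) // out'h ?inroot_phiV ?(valP x) // if_neg /= permE.
  rewrite /= [nextp _ _ _]hnext; last exact: (valP k).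
  rewrite val_insubd /= permE /= hshat //; exact: (valP k).
have rawalpF d : rawalp (F d) = F (@malp (mob_core (C h)) d).
  case: d => [x|k] /=; last by rewrite ifT //; exact: (valP k).
  case: ifP => hx; first by rewrite insubT.
  by rewrite insubF //= hx.
pose G (d : mD (mob_core (C h))) : mD (mob_of s a out' (@oroot O) del) := Sub (F d) (Fv d).
exists G; split.
- apply: inj_surj_bij.
    move=> d d' /(congr1 val); rewrite !SubK; case: d d' => [x|k] [y|l] /=; do ?[by case: ifP].
    + by case: ifP => _; case: ifP => _ // [] /val_inj ->.
    + by move=> [] /val_inj /val_inj ->.
  case=> -[[x|x]|x] vx.
  + have hx : h x by rewrite -validE.
    have hx' : ch (Sub x (hroot x hx) : cN (C h)) by [].
    by exists (inr (Sub _ hx')); apply: val_inj.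
  + have hx : h x by rewrite -validE.
    by exists (inl (Sub x (hroot x hx))); apply: val_inj; rewrite /= hx.
  have /andP[ox rx] : out' x && ~~ inroot x by [].
  exists (inl (Sub x rx)); apply: val_inj; rewrite /= ifF //.
  by apply: negbTE; rewrite -out'h.
- by move=> d; apply: val_inj; rewrite val_insubd !SubK rawsigF Fv.
- by move=> d; apply: val_inj; rewrite val_insubd !SubK rawalpF Fv.
- by case=> [x|k] /=; first by case: ifP.
Qed.

Lemma PhiP_core : mob_iso (mob_core (C (fun x => ~~ out x))) (PhiP O).
Proof.
apply: mob_of_core => //= [x _|x /negPf ox|x ox]; rewrite ?negbK //; last by rewrite out_shat.
rewrite /shat ox; apply: nextp_ext => y _ /=; rewrite andbT.
by have [/root_out ->|] := boolP (inroot y); rewrite ?andbT.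
Qed.

Lemma admissible_outer_head : admissible O -> forall x h : D,
  inroot x -> samev x h -> ~~ out h -> h = a ((phi^-1)%g x).
Proof.
case=> [_ _ indeg] x h rx xh oh; have /card_le1_eqP := eq_leq (indeg x rx).
apply; rewrite inE ?xh //; apply/andP; split; last by rewrite Oor root_out ?inroot_phiV.
rewrite (phiV_alp Opl) aK /samev; have := fconnect1 s ((s^-1)%g x).
by rewrite permKV fconnect_sym //; apply: perm_inj.
Qed.

Lemma core_of_wfP : core_wf (C (fun x => ~~ out x)).
Proof. by move=> x /= /negPn ox; apply: val_inj; rewrite core_of_cw /shat ox. Qed.

Lemma core_of_wfM : admissible O -> core_wf (C (@mopen O)).
Proof.
move=> adm x nm; apply: val_inj; rewrite core_of_cw /shat.
case: ifPn => // ox; have rx : inroot (s (val x)).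
  rewrite -[val x]aK -ophiE inroot_phi; move: nm.
  by rewrite /= /mopen ox negbK.
have sx : samev (s (val x)) (val x) by rewrite samev_sym /samev fconnect1.
rewrite (admissible_outer_head adm rx sx ox).
apply: admissible_outer_head => //; last exact: head_next_in.
apply: (samev_trans sx); rewrite -(admissible_outer_head adm rx sx ox).
exact: nextp_fconnect.
Qed.

(** At an outer vertex the only ingoing dart is that of a contour edge. Reversed, this edge leaves a
    bud in the inner face, and its new head lies in the root-face; deleting the outer vertices
    removes nothing else. *)
Lemma PhiM_core : admissible O -> mob_iso (mob_core (C (@mopen O))) (PhiM O).
Proof.
move=> adm; have outer_head := admissible_outer_head adm.
have open_outer (x : D) : mopen x -> ~~ outer_vertex x.
  case/andP=> ox rax; apply/existsP => -[y /andP[ry yx]].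
  by move: rax; rewrite (outer_head y x) // aK inroot_phiV ry.
have samev_outer (x y : D) : samev x y -> outer_vertex y = outer_vertex x.
  move=> xy; apply: eq_existsb => z; congr (_ && _); rewrite /samev.
  by rewrite (same_connect_r (fconnect_sym (@perm_inj _ s)) xy).
have not_outer (x : D) : ~~ outer_vertex x -> ~~ inroot x /\ ~~ inroot (a x).
  move=> no; split; apply: contra no => rx; apply/existsP.
    by exists x; rewrite rx /samev connect0.
  exists (phi (a x)); rewrite inroot_phi rx ophiE aK samev_sym /samev fconnect1 //.
apply: mob_of_core => [x rx|x /open_outer//|x /andP[]//|x mx|x mx].
- rewrite /rev_out (negPf rx) /mopen /=; case: ifP => rax; last by rewrite andbT negbK.
  by rewrite andbF -Oor root_out.
- have no := open_outer x mx; have [/negPf ox _] := andP mx.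
  rewrite /shat ox; apply: nextp_ext => y xy.
  have no' : ~~ outer_vertex y by rewrite (samev_outer _ _ xy).
  have [ry ray] := not_outer _ no'.
  by rewrite /rev_out no' ry (negPf ry) (negPf ray) /= !andbT.
- have /andP[ox _] := mx; rewrite /mopen (out_shat has_head) ox /=.
  have no := open_outer x mx.
  have : ~~ outer_vertex (shat x).
    rewrite (samev_outer x) // /shat (negPf ox) /samev; exact: nextp_fconnect.
  by case/not_outer.
Qed.

End MobOf.

(** * Reconstructing the orientation from the contour word *)

Section Natural.
Variables O1 O2 : fro.
Hypotheses (pl1 : is_plane_map O1) (or1 : is_orientation O1)
  (ro1 : forall x : oD O1, inroot x -> oout x)
  (hh1 : forall x : oD O1, exists2 h, samev x h & ~~ oout h).
Hypotheses (pl2 : is_plane_map O2) (or2 : is_orientation O2)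
  (ro2 : forall x : oD O2, inroot x -> oout x)
  (hh2 : forall x : oD O2, exists2 h, samev x h & ~~ oout h).

Let aK1 := plane_alpK pl1.
Let aK2 := plane_alpK pl2.

Lemma fro_iso_core (h1 : pred (oD O1)) (h2 : pred (oD O2)) :
  (forall f, bijective f -> (forall x, f (oalp O1 x) = oalp O2 (f x)) ->
     (forall x, oout (f x) = oout x) -> (forall x, inroot (f x) = inroot x) ->
     forall x, h2 (f x) = h1 x) ->
  fro_iso O1 O2 -> core_iso (core_of ro1 hh1 h1) (core_of ro2 hh2 h2).
Proof.
move=> hE [f [fB fs fa fo fr]].
have fI := bij_inj fB.
have fphi x : f (ophi O1 x) = ophi O2 (f x) by rewrite !ophiE fs fa.
have fphiV x : f ((ophi O1)^-1%g x) = (ophi O2)^-1%g (f x).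
  by apply: (@perm_inj _ (ophi O2)); rewrite -fphi !permKV.
have it n x : f (iter n (ophi O1) x) = iter n (ophi O2) (f x).
  by elim: n => //= n <-.
have frE x : inroot (f x) = inroot x.
  rewrite /inroot -[RHS]/(fconnect (ophi O1) (oroot O1) x).
  have -> : samef (oroot O2) (f x) = samef (f (oroot O1)) (f x).
    by rewrite /samef (same_connect (fconnect_sym (@perm_inj _ (ophi O2))) fr).
  apply/idP/idP => /iter_findex; first by rewrite -it => /fI <-; apply: fconnect_iter.
  by move=> <-; rewrite it; apply: fconnect_iter.
have fshat x : f (shat x) = shat (f x).
  rewrite /shat fo; case: ifP => // _; have sI := @perm_inj _ (osig O1).
  have [|n [En On Hn]] := @nextp_ex _ (osig O1) (fun y => ~~ oout y) x.
    have [h xh oh] := hh1 (osig O1 x).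
    by exists (findex (osig O1) (osig O1 x) h); rewrite iterSr iter_findex.
  have its m y : f (iter m (osig O1) y) = iter m (osig O2) (f y).
    by elim: m => //= m <-.
  rewrite /head_next En its; apply/esym/nextpE => [|m /Hn].
    by rewrite -its fo -En.
  by rewrite -its fo.
have Nf (z : {x : oD O1 | ~~ inroot x}) : ~~ inroot (f (val z)) by rewrite frE (valP z).
exists (fun z => Sub (f (val z)) (Nf z)); split.
- apply: inj_surj_bij => [x y /(congr1 val) /fI /val_inj //|y].
  case: fB => f' fK f'K; have ry : ~~ inroot (f' (val y)) by rewrite -frE f'K (valP y).
  by exists (Sub (f' (val y)) ry); apply: val_inj; rewrite /= f'K.
- by move=> x; apply: val_inj; rewrite /= !permE /= fphiV.
- by move=> x; apply: val_inj; rewrite /= !permE /= fshat.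
- by move=> x /=; apply: hE.
Qed.

Section Rigid.
Variables (h1 : pred (oD O1)) (h2 : pred (oD O2)).
Variable g : {x : oD O1 | ~~ inroot x} -> {x : oD O2 | ~~ inroot x}.
Hypothesis gB : bijective g.
Hypothesis gb : forall x : cN (core_of ro1 hh1 h1),
  g (cb (core_of ro1 hh1 h1) x) = cb (core_of ro2 hh2 h2) (g x).
Hypothesis gw : forall x : cN (core_of ro1 hh1 h1),
  g (cw (core_of ro1 hh1 h1) x) = cw (core_of ro2 hh2 h2) (g x).

(** The default value is a placeholder: darts of the root-face are outside the core and are reached
    through their opposites in [rigid]. *)
Definition unroot_map (x : oD O1) : oD O2 := if insub x is Some z then val (g z) else oroot O2.
Local Notation gt := unroot_map.

Lemma unroot_mapE z : gt (val z) = val (g z).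
Proof. by rewrite /gt valK. Qed.

Lemma unroot_map_root x : ~~ inroot x -> ~~ inroot (gt x).
Proof. by move=> rx; rewrite -[x]/(val (Sub x rx : {x : oD O1 | ~~ inroot x})) unroot_mapE (valP (g _)). Qed.

Lemma unroot_map_inj x y : ~~ inroot x -> ~~ inroot y -> gt x = gt y -> x = y.
Proof.
move=> rx ry; rewrite -[x]/(val (Sub x rx : {x : oD O1 | ~~ inroot x})).
rewrite -[y]/(val (Sub y ry : {x : oD O1 | ~~ inroot x})) !unroot_mapE.
by move=> /val_inj /(bij_inj gB) ->.
Qed.

Lemma unroot_map_surj y : ~~ inroot y -> exists2 x, ~~ inroot x & gt x = y.
Proof.
move=> ry; have [g' _ g'K] := gB; exists (val (g' (Sub y ry))); first exact: (valP (g' _)).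
by rewrite unroot_mapE g'K.
Qed.

Lemma unroot_map_phiV x : ~~ inroot x -> gt ((ophi O1)^-1%g x) = (ophi O2)^-1%g (gt x).
Proof.
move=> rx; have := congr1 val (gb (Sub x rx)).
by rewrite -unroot_mapE core_of_cb [in RHS]core_of_cb -unroot_mapE.
Qed.

Lemma unroot_map_shat x : ~~ inroot x -> gt (shat x) = shat (gt x).
Proof.
move=> rx; have := congr1 val (gw (Sub x rx)).
by rewrite -unroot_mapE core_of_cw [in RHS]core_of_cw -unroot_mapE.
Qed.

Lemma unroot_map_chi x : ~~ inroot x -> gt (chi x) = chi (gt x).
Proof.
by move=> rx; rewrite /chi unroot_map_phiV ?root_shat // unroot_map_shat.
Qed.

Lemma unroot_map_phi x : ~~ inroot x -> gt (ophi O1 x) = ophi O2 (gt x).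
Proof.
move=> rx; apply: (@perm_inj _ (ophi O2)^-1%g).
by rewrite -unroot_map_phiV ?inroot_phi // !permK.
Qed.

Hypothesis gout : forall x, ~~ inroot x -> oout (gt x) = oout x.
Hypothesis galp : forall t, mclose t -> gt (oalp O1 t) = oalp O2 (gt t).

(** A core isomorphism that respects directions and matching extends to the root-face through
    opposite darts. *)
Lemma rigid : fro_iso O1 O2.
Proof.
have headN1 x : ~~ oout x -> ~~ @inroot O1 x by apply: contra; apply: ro1.
have rootN1 x : @inroot O1 x -> ~~ inroot (oalp O1 x).
  by move=> rx; apply: headN1; rewrite or1 ro1.
pose f x := if inroot x then oalp O2 (gt (oalp O1 x)) else gt x.
have fR x : inroot x -> f x = oalp O2 (gt (oalp O1 x)) by rewrite /f => ->.
have fN x : ~~ inroot x -> f x = gt x by rewrite /f => /negPf ->.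
have fa x : f (oalp O1 x) = oalp O2 (f x).
  have [rx|nx] := boolP (inroot x); first by rewrite (fR x) // aK2 fN ?rootN1.
  have [ra|na] := boolP (inroot (oalp O1 x)); first by rewrite (fN x) // fR // aK1.
  rewrite !fN //; have [ox|ox] := boolP (oout x); first by rewrite galp // /mclose ox.
  have mc : mclose (oalp O1 x) by rewrite /mclose or1 ox.
  by rewrite -[in RHS](aK1 x) (galp mc) aK2.
have fo x : oout (f x) = oout x.
  have [rx|nx] := boolP (inroot x); last by rewrite fN ?gout.
  by rewrite fR // or2 gout ?rootN1 // or1 negbK.
have frR x : inroot x -> inroot (f x).
  move=> rx; apply: contraT => nr; have [t rt tE] := unroot_map_surj nr.
  have ot : oout t by rewrite -gout // tE fo ro1.
  have := galp; move=> /(_ t); rewrite /mclose ot rt tE fR // aK2 => /(_ isT) E.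
  have {}E : oalp O1 t = oalp O1 x.
    by apply: unroot_map_inj E; [apply: headN1; rewrite or1 ot|apply: rootN1].
  by move/perm_inj: E rt => ->; rewrite rx.
have fr x : inroot (f x) = inroot x.
  have [/frR ->//|nx] := boolP (inroot x); rewrite fN //.
  exact/negbTE/unroot_map_root.
have fI : injective f.
  move=> x y E; have : inroot x = inroot y by rewrite -!fr E.
  have [rx /esym ry|nx /esym/negbT ny] := boolP (inroot x).
    move: E; rewrite !fR // => /perm_inj /unroot_map_inj H.
    by apply: (@perm_inj _ (oalp O1)); apply: H; apply: rootN1.
  by move: E; rewrite !fN //; apply: unroot_map_inj.
have fS y : exists x, f x = y.
  have [ry|/unroot_map_surj[x rx <-]] := boolP (inroot y); last by exists x; rewrite fN.
  have nay : ~~ inroot (oalp O2 y) by apply: contraL (ro2 ry) => /ro2; rewrite or2.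
  have [h rh hE] := unroot_map_surj nay; exists (oalp O1 h).
  by rewrite fa fN // hE aK2.
have fs_in x : ~~ inroot (oalp O1 x) -> f (osig O1 x) = osig O2 (f x).
  move=> ra; rewrite -{1}[x]aK1 -ophiE fN ?inroot_phi // unroot_map_phi // ophiE.
  by rewrite -fN // fa aK2.
exists f; split=> //; first exact: inj_surj_bij.
(* When [s x] is in the root-face the core does not give its image. The dart before that image and
   [f x] are ingoing with the same next ingoing dart, hence equal. *)
- move=> x; have [ra|/fs_in //] := boolP (inroot (oalp O1 x)).
  have ox : ~~ oout x by rewrite -[x]aK1 or1 ro1.
  have rs : inroot (osig O1 x) by rewrite -[x]aK1 -ophiE inroot_phi.
  have sI := @perm_inj _ (osig O1); have s2I := @perm_inj _ (osig O2).
  have [|n [En On Hn]] := @nextp_ex _ (osig O1) (fun y => ~~ oout y) x.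
    have [h xh oh] := hh1 (osig O1 x).
    by exists (findex (osig O1) (osig O1 x) h); rewrite iterSr iter_findex.
  have it i : i <= n -> f (iter i.+1 (osig O1) x) = iter i (osig O2) (f (osig O1 x)).
    elim: i => // i IHi lt; rewrite iterS fs_in ?IHi ?(ltnW lt) //.
    apply: headN1; rewrite or1; exact: Hn.
  pose u := (osig O2)^-1%g (f (osig O1 x)).
  have su : osig O2 u = f (osig O1 x) by rewrite /u permKV.
  have ou : ~~ oout u by rewrite /u (root_sV pl2) ?fr // or2 negbK ro2 // inroot_phiV fr.
  have itu i : i <= n -> iter i.+1 (osig O2) u = f (iter i.+1 (osig O1) x).
    by move=> le; rewrite it // iterSr su.
  have hu : head_next u = f (head_next x).
    rewrite /head_next En -itu //; apply: nextpE => // [|m lt].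
      by rewrite itu // fo -En.
    by rewrite itu ?(ltnW lt) // fo Hn.
  have hx : f (head_next x) = head_next (f x).
    have hn := head_next_in hh1 x.
    have -> : head_next x = shat x by rewrite /shat (negPf ox).
    rewrite fN ?root_shat ?headN1 // unroot_map_shat ?headN1 // -fN ?headN1 //.
    by rewrite /shat fo (negPf ox).
  rewrite -su; congr (osig O2 _).
  by apply: (nextp_inj s2I (P := fun y => ~~ oout y)); rewrite ?unfold_in ?fo //; exact: etrans hu hx.
- by rewrite samef_sym [samef _ _]fr inroot_root.
Qed.

End Rigid.

Section Matching.
Variables (o1 : oD O1 -> oD O1) (o2 : oD O2 -> oD O2).
Hypotheses (oP1 : is_owner o1) (dr1 : drains o1) (oP2 : is_owner o2) (dr2 : drains o2).

Let headN1 x : ~~ oout x -> ~~ @inroot O1 x. Proof. by apply: contra; apply: ro1. Qed.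
Let headN2 x : ~~ oout x -> ~~ @inroot O2 x. Proof. by apply: contra; apply: ro2. Qed.

Let mopenN (x : oD O1) : mopen x || mclose x -> ~~ inroot x.
Proof. by case/orP=> /andP[]// /headN1. Qed.

(** The marks tell heads from tails but not which heads are closed. Every tail off the root-face is
    matched, so the word is read backwards from it. *)
Lemma core_iso_froP :
  core_iso (core_of ro1 hh1 (fun x => ~~ oout x)) (core_of ro2 hh2 (fun x => ~~ oout x)) ->
  fro_iso O1 O2.
Proof.
case=> g [gB gb gw gc]; pose gt := unroot_map g.
have gtN := unroot_map_root g.
have gout x : ~~ inroot x -> oout (gt x) = oout x.
  by move=> rx; apply: negb_inj; have := gc (Sub x rx); rewrite /= -unroot_mapE.
apply: (rigid gB gb gw gout) => t ct; have [ot rt] := andP ct.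
have mh : mopen (oalp O1 t) by rewrite /mopen or1 ot aK1.
have mh2 : mopen (oalp O2 (gt t)) by rewrite /mopen or2 gout // ot aK2 gtN.
have chiI := inj_comp (@perm_inj _ (ophi O2)^-1%g) (shat_inj hh2).
have chiK : cancel (@chi O2) (finv (@chi O2)) by apply: finv_f; exact: chiI.
have ra : ~~ inroot (oalp O1 t) by rewrite headN1 // or1 ot.
have s1 := open_skips pl1 or1 ro1 hh1 oP1 dr1 mh; rewrite aK1 in s1.
have {}s1 : skips (@chi O2) (fun x => ~~ oout x) (@oout O2) (gt (chi (oalp O1 t))) (gt t).
  apply: skips_map s1 => z.
  - by move/mopenN=> nz; rewrite /gt (unroot_map_chi gb gw).
  - by move=> /[dup] mz /andP[oz _]; rewrite gout ?mopenN ?mz.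
  - by move=> /[dup] mz /andP[oz _]; rewrite gout ?mopenN ?mz ?orbT.
have s2 := open_skips pl2 or2 ro2 hh2 oP2 dr2 mh2; rewrite aK2 in s2.
have {}s2 : skips (@chi O2) (fun x => ~~ oout x) (@oout O2) (chi (oalp O2 (gt t))) (gt t).
  by apply: (@skips_map _ _ id) s2 => // z /andP[].
have := skips_rev chiK s1; have := skips_rev chiK s2.
rewrite [gt (chi _)](unroot_map_chi gb gw) // !chiK => r2 r1.
apply: (skips_det _ r1 _ r2) => [z oz||]; rewrite ?negbK ?gout ?or1 ?or2 ?gout ?ot //.
Qed.

(** Here the marks give the closed openings, so the word is read forwards from them; directions are
    recovered afterwards. *)
Lemma core_iso_froM :
  core_iso (core_of ro1 hh1 (@mopen O1)) (core_of ro2 hh2 (@mopen O2)) -> fro_iso O1 O2.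
Proof.
case=> g [gB gb gw gc]; pose gt := unroot_map g.
have gtN := unroot_map_root g.
have gm x : ~~ inroot x -> mopen (gt x) = mopen x.
  by move=> rx; have := gc (Sub x rx); rewrite /= -unroot_mapE.
have galp h : mopen h -> gt (oalp O1 h) = oalp O2 (gt h).
  move=> mh; have rh : ~~ inroot h by rewrite mopenN ?mh.
  have mh2 : mopen (gt h) by rewrite gm.
  have s1 := open_skips pl1 or1 ro1 hh1 oP1 dr1 mh.
  have {}s1 : skips (@chi O2) (@mopen O2) (fun x => ~~ mopen x) (gt (chi h)) (gt (oalp O1 h)).
    apply: skips_map s1 => z.
    - by move/mopenN=> nz; rewrite /gt (unroot_map_chi gb gw).
    - by move=> mz; rewrite gm ?mopenN ?mz.
    - by move=> /[dup] mz /andP[oz nz]; rewrite gm // /mopen oz.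
  have s2 := open_skips pl2 or2 ro2 hh2 oP2 dr2 mh2.
  have {}s2 : skips (@chi O2) (@mopen O2) (fun x => ~~ mopen x) (chi (gt h)) (oalp O2 (gt h)).
    by apply: (@skips_map _ _ id) s2 => // z /andP[oz nz]; rewrite /mopen oz.
  rewrite [gt (chi h)](unroot_map_chi gb gw) // in s1.
  have [oh ra] := andP mh; have [oh2 _] := andP mh2.
  apply: (skips_det _ s1 _ s2) => [z -> //||]; first by rewrite gm // /mopen or1 oh.
  by rewrite /mopen or2 oh2.
have gclose t : mclose t -> oalp O2 (gt (oalp O1 t)) = gt t.
  move=> /andP[ot rt]; have mh : mopen (oalp O1 t) by rewrite /mopen or1 ot aK1.
  by rewrite -galp // aK1.
(* Unmarked darts are tails or contour heads; the tails are those that close an opening. *)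
have gout x : ~~ inroot x -> oout (gt x) = oout x.
  move=> rx; have [ox|ox] := boolP (oout x).
    have mh : mopen (oalp O1 x) by rewrite /mopen or1 ox aK1.
    have rh : ~~ inroot (oalp O1 x) by rewrite mopenN ?mh.
    have /andP[oh _] : mopen (gt (oalp O1 x)) by rewrite gm.
    by rewrite -gclose ?or2 ?oh // /mclose ox.
  apply: negbTE; apply/negP => og.
  have mh : mopen (oalp O2 (gt x)) by rewrite /mopen or2 og aK2 gtN.
  have [h rh hE] := unroot_map_surj gB (headN2 (proj1 (andP mh))).
  have mh1 : mopen h by rewrite -gm // [gt h]hE.
  have E := galp _ mh1; rewrite [gt h]hE aK2 in E.
  have [oh ra] := andP mh1; have := unroot_map_inj gB ra rx E => xE.
  by rewrite -xE or1 oh in ox.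
apply: (rigid gB gb gw gout) => t ct.
by rewrite -[unroot_map g t]/(gt t) -(gclose t ct) aK2.
Qed.

End Matching.
End Natural.

(** * Parenthesis matching along a cycle *)

Section Height.
Variables (N : finType) (chi : N -> N) (hd : pred N) (x0 : N) (S : nat -> nat).
Local Notation m := (fingraph.order chi x0).
Local Notation xs i := (iter i chi x0).
Hypotheses (chiI : injective chi) (chi_cycle : forall x, fconnect chi x0 x)
  (S0 : S 0 = 0) (Sup : forall i, i < m -> hd (xs i) -> S i.+1 = (S i).+1)
  (Sdown : forall i, i < m -> ~~ hd (xs i) -> S i = (S i.+1).+1)
  (Spos : forall i, 0 < i <= m -> 0 < S i).

Let pos x := findex chi x0 x.
(** The time at which [x] is entered, from 1 to [m]: the starting point gets the end of the turn, so
    there is always a past to look back at. *)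
Let idx x := if pos x == 0 then m else pos x.

Let pos_lt x : pos x < m. Proof. exact/findex_max/chi_cycle. Qed.
Let posK x : xs (pos x) = x. Proof. exact/iter_findex/chi_cycle. Qed.
Let pos_xs i : i < m -> pos (xs i) = i. Proof. exact: findex_iter. Qed.
Let m_gt0 : 0 < m. Proof. exact: fingraph.order_gt0. Qed.
Let xs_m : xs m = x0. Proof. exact: iter_order. Qed.

Let idxK x : xs (idx x) = x.
Proof.
by rewrite /idx; case: eqP => [p0|_]; rewrite ?posK // xs_m -[RHS]posK p0.
Qed.

Let idx_bound x : 0 < idx x <= m.
Proof.
rewrite /idx; case: eqP => [_|/eqP]; first by rewrite m_gt0 leqnn.
by rewrite -lt0n => ->; rewrite ltnW.
Qed.

Let idx_chi x : idx (chi x) = (pos x).+1.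
Proof.
have E : chi x = xs (pos x).+1 by rewrite iterS posK.
have := pos_lt x; rewrite leq_eqVlt /idx E => /orP[/eqP Em|lt].
  by rewrite Em xs_m /pos findex0 eqxx.
by rewrite pos_xs.
Qed.

Let idx_pos x : 0 < pos x -> idx x = pos x.
Proof. by rewrite lt0n /idx => /negPf ->. Qed.

(* the position of the innermost open up-step before time [j] *)
Definition last_below j := \max_(i < j | S i < S j) i.
Local Notation pr := last_below.

Let prP j : 0 < j <= m -> [/\ pr j < j, S (pr j) < S j &
  forall k, pr j < k < j -> S j <= S k].
Proof.
move=> hj; have /andP[j0 jm] := hj; pose i0 := Ordinal j0.
have Pi0 : S i0 < S j by rewrite S0 Spos.
have A0 : 0 < #|[pred i : 'I_j | S i < S j]| by apply/card_gt0P; exists i0.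
have [i Pi E] := @eq_bigmax_cond _ [pred i : 'I_j | S i < S j] (@nat_of_ord j) A0.
have {}E : pr j = i := E; split; rewrite ?E; [exact: ltn_ord|by move: Pi; rewrite inE|].
move=> k /andP[ltk kj].
rewrite leqNgt; apply: contraL ltk => lt; rewrite -leqNgt -E.
exact: (@leq_bigmax_cond _ (fun i : 'I_j => S i < S j) (@nat_of_ord j) (Ordinal kj)).
Qed.

Let prE i j : i < j <= m -> S i < S j -> (forall k, i < k < j -> S j <= S k) -> pr j = i.
Proof.
move=> /andP[ij jm] Sij H; have [] := @prP j; first by rewrite (leq_ltn_trans _ ij).
move=> p1 p2 p3; case: (ltngtP (pr j) i) => // lt.
  by have := p3 i; rewrite lt ij => /(_ isT); rewrite leqNgt Sij.
by have := H (pr j); rewrite lt p1 => /(_ isT); rewrite leqNgt p2.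
Qed.

Let Sstep i : i < m -> S i.+1 = (S i).+1 /\ hd (xs i) \/ S i = (S i.+1).+1 /\ ~~ hd (xs i).
Proof. by move=> lt; have [h|h] := boolP (hd (xs i)); [left|right]; split; auto. Qed.

Let pr_up j : 0 < j <= m -> S j = (S (pr j)).+1 /\ hd (xs (pr j)).
Proof.
move=> hj; have [p1 p2 p3] := prP hj; have /andP[_ jm] := hj.
have ltm : pr j < m by apply: leq_trans jm.
have [[E h]|[E h]] := Sstep ltm.
  split=> //; move: p1; rewrite leq_eqVlt => /orP[/eqP Ej|lt]; first by rewrite -[in LHS]Ej E.
  by have := p3 (pr j).+1; rewrite ltnSn lt => /(_ isT); lia.
move: p1; rewrite leq_eqVlt => /orP[/eqP E2|lt]; first by move: p2; rewrite -[in X in _ < X]E2; lia.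
by have := p3 (pr j).+1; rewrite ltnSn lt => /(_ isT); lia.
Qed.

(** For a tail this is the matching head, for a head the head enclosing it: one function provides
    both the edges and the chains of the map to be built. *)
Definition opener x := xs (pr (idx x)).
Local Notation q := opener.

Let pos_q x : pos (q x) = pr (idx x).
Proof.
rewrite /q pos_xs //; have /andP[_ le] := idx_bound x.
by have [lt _ _] := prP (idx_bound x); apply: leq_trans le.
Qed.

Let pos_q_lt x : pos (q x) < idx x.
Proof. by rewrite pos_q; have [] := prP (idx_bound x). Qed.

Lemma opener_hd x : hd (q x).
Proof. by have [_ h] := pr_up (idx_bound x). Qed.

Lemma opener_chi_hd x : hd x -> q (chi x) = x.
Proof.
move=> hx; rewrite /q idx_chi (@prE (pos x)) ?posK //.
- by rewrite ltnSn pos_lt.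
- by rewrite Sup ?posK.
- by move=> k; rewrite ltnS => /andP[] lt /(leq_trans lt); rewrite ltnn.
Qed.

Lemma hd_x0 : hd x0.
Proof. by apply: contraT => h; have := Sdown m_gt0 h; rewrite S0. Qed.

Let tail_pos t : ~~ hd t -> 0 < pos t.
Proof.
by move=> ht; rewrite lt0n; apply: contra ht => /eqP p0; rewrite -[t]posK p0 hd_x0.
Qed.

(* a tail at [pos t] closes the level opened by [q t] *)
Let tailP t : ~~ hd t -> [/\ idx t = pos t, S (pos t) = (S (pos t).+1).+1,
  S (pos t).+1 = S (pos (q t)) & 0 < pos (q t)].
Proof.
move=> ht; have it := idx_pos (tail_pos ht).
have Sd : S (pos t) = (S (pos t).+1).+1 by apply: Sdown; rewrite ?posK ?pos_lt.
have [E _] := pr_up (idx_bound t); rewrite -pos_q it Sd in E.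
case: E => E; split=> //; rewrite lt0n; apply/eqP => p0.
by have := @Spos (pos t).+1; rewrite pos_lt E p0 S0 => /(_ isT).
Qed.

Lemma opener_chi_tl t : ~~ hd t -> q (chi t) = q (q t).
Proof.
move=> ht; have [it Sd Sq p0] := tailP ht.
rewrite /q idx_chi (idx_pos p0); congr (iter _ _ _).
have hi : 0 < pos (q t) <= m by rewrite p0 ltnW // pos_lt.
have [k1 k2 k3] := prP hi; have [i1 i2 i3] := prP (idx_bound t).
rewrite -pos_q it in i1 i2 i3.
apply: prE; rewrite ?Sq //; first by rewrite pos_lt ltnS (leq_trans (ltnW k1) (ltnW i1)).
move=> k /andP[lk]; rewrite ltnS => kt.
case: (ltngtP k (pos (q t))) => [lt|lt|-> //]; first by apply: k3; rewrite lk lt.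
move: kt; rewrite leq_eqVlt => /orP[/eqP ->|kt]; first by lia.
by have := i3 k; rewrite lt kt => /(_ isT); lia.
Qed.

Definition matched x := [exists t, ~~ hd t && (q t == x)].
Definition unmatched x := hd x && ~~ matched x.

(** The first return to the level of [u] would be a down-step closing [u]. *)
Let unmatched_above u r : unmatched u -> pos u < r <= m -> S (pos u) < S r.
Proof.
case/andP=> hu nm /andP[ur rm]; rewrite ltnNge; apply: contra nm => le.
have ex : exists r, [&& pos u < r, r <= m & S r <= S (pos u)] by exists r; rewrite ur rm.
case: (ex_minnP ex) => {ur rm le}r /and3P[ur rm le] rmin.
case: r ur rm le rmin => // j; rewrite ltnS leq_eqVlt => /orP[/eqP E|uj] jm le rmin.
  by move: le; rewrite -E Sup ?posK ?pos_lt // ltnn.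
have above k : pos u < k <= j -> S (pos u) < S k.
  move=> /andP[uk kj]; rewrite ltnNge; apply/negP => le'.
  by have := rmin k; rewrite uk le' (leq_trans kj (ltnW jm)) => /(_ isT); rewrite ltnNge kj.
have aj : S (pos u) < S j by apply: above; rewrite uj leqnn.
have [[E _]|[E h]] := Sstep jm; first by lia.
apply/existsP; exists (xs j); rewrite h /=; apply/eqP.
have pj := pos_xs jm; rewrite /q idx_pos pj ?(leq_ltn_trans _ uj) //.
rewrite (@prE (pos u)) ?posK ?uj ?(ltnW jm) // => k /andP[uk kj].
by have := above k; rewrite uk (ltnW kj) => /(_ isT); lia.
Qed.

Lemma unmatched_height u r :
  unmatched u -> findex chi x0 u < r <= m -> S (findex chi x0 u) < S r.
Proof. exact: unmatched_above. Qed.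

Lemma opener_tl_height t : ~~ hd t ->
  S (findex chi x0 t).+1 = S (findex chi x0 (q t)) /\ findex chi x0 (q t) < findex chi x0 t.
Proof. by move=> ht; have [it _ Sq _] := tailP ht; split=> //; have := pos_q_lt t; rewrite it. Qed.

(** Closing [q u] before [u] would break the enclosure, and closing it later would close [u]
    first. *)
Lemma opener_unmatched u : unmatched u -> unmatched (q u).
Proof.
move=> uu; rewrite /unmatched opener_hd; apply/existsP => -[t /andP[ht /eqP qE]].
have [it Sd Sq p0] := tailP ht.
have [Su _] := pr_up (idx_bound u); have [k1 k2 k3] := prP (idx_bound u).
rewrite -pos_q -qE in Su k1 k2 k3.
have [i1 i2 i3] := prP (idx_bound t); rewrite -pos_q it in i1 i2 i3.
have [le|lt] := leqP (idx u) (pos t); last first.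
  move: lt; rewrite leq_eqVlt => /orP[/eqP E|lt]; first by rewrite -E in Su; lia.
  have := k3 (pos t).+1; rewrite lt ltnS (ltnW i1) => /(_ isT); lia.
have iu : idx u = pos u.
  rewrite /idx; case: eqP => // p; move: le; rewrite /idx p eqxx leqNgt pos_lt //.
have := unmatched_above uu (r := (pos t).+1); rewrite ltnS -iu le pos_lt => /(_ isT); lia.
Qed.

Lemma opener_unmatched_inj : {in unmatched &, injective q}.
Proof.
suff H u v : unmatched u -> unmatched v -> q u = q v -> idx u <= idx v.
  move=> u v uu uv E; rewrite -[u]idxK -[v]idxK; congr (iter _ _ _).
  by apply/eqP; rewrite eqn_leq !H.
move=> uu uv E; rewrite leqNgt; apply/negP => lt.
have [Su _] := pr_up (idx_bound u); have [Sv _] := pr_up (idx_bound v).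
rewrite -pos_q E in Su; rewrite -pos_q in Sv.
have /andP[_ um] := idx_bound u; have iv : idx v = pos v.
  by rewrite /idx; case: eqP => // p; move: lt; rewrite {1}/idx p eqxx ltnNge um.
have := unmatched_above uv (r := idx u); rewrite -iv lt um => /(_ isT); lia.
Qed.

Lemma opener_tl_inj : {in predC hd &, injective q}.
Proof.
suff H t u : ~~ hd t -> ~~ hd u -> q t = q u -> pos t <= pos u.
  move=> u v uu uv E; rewrite -[u]posK -[v]posK; congr (iter _ _ _).
  by apply/eqP; rewrite eqn_leq !H.
move=> ht hu E; rewrite leqNgt; apply/negP => lt.
have [it Sd Sq p0] := tailP ht; have [iu Sdu Squ p0u] := tailP hu.
have [i1 i2 i3] := prP (idx_bound t); rewrite -pos_q it in i1 i2 i3.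
have [u1 u2 u3] := prP (idx_bound u); rewrite -pos_q -E iu in u1 u2 u3.
rewrite -E -Sq in Squ.
move: lt; rewrite leq_eqVlt => /orP[/eqP E2|lt]; first by rewrite E2 in Squ; lia.
by have := i3 (pos u).+1; rewrite lt ltnS (ltnW u1) => /(_ isT); lia.
Qed.

Lemma unmatched_x0 : unmatched x0.
Proof.
rewrite /unmatched hd_x0; apply/existsP => -[t /andP[ht /eqP E]].
by have [_ _ _] := tailP ht; rewrite E /pos findex0.
Qed.

Lemma opener_drains x : hd x -> exists n, unmatched (iter n q x).
Proof.
have [k] := ubnP (pos x); elim: k x => // k IHk x lt hx.
have [p0|pp] := posnP (pos x).
  by exists 0; rewrite /= -[x]posK p0 unmatched_x0.
have := pos_q_lt x; rewrite (idx_pos pp) => ltq.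
have [||n Hn] := IHk (q x); [exact: leq_trans ltq lt|exact: opener_hd|].
by exists n.+1; rewrite iterSr.
Qed.

(** [q] goes back in time until [x0], whose own opener is looked up from the end of the turn: the
    unmatched openings form one cycle, the future root-face. *)
Lemma unmatched_cycle u : unmatched u -> fconnect q u x0.
Proof.
have [k] := ubnP (pos u); elim: k u => // k IHk x lt ux.
have [p0|pp] := posnP (pos x).
  by rewrite -[x]posK p0 connect0.
have := pos_q_lt x; rewrite (idx_pos pp) => ltq.
apply: connect_trans (fconnect1 _ _) (IHk _ _ _); last exact: opener_unmatched.
exact: leq_trans ltq lt.
Qed.

(** A tail that closes [chi t] comes later than [t]; time thus orders the tails met while turning
    around a vertex. *)
Lemma opener_ind (P : N -> Prop) : (forall t, ~~ hd t ->
    (forall t', ~~ hd t' -> q t' = chi t -> P t') -> P t) ->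
  forall t, ~~ hd t -> P t.
Proof.
move=> H t; have [k] := ubnP (m - pos t); elim: k t => // k IHk t lt ht.
apply: H => // t' ht' qE; apply: IHk => //.
have [it _ _ p0] := tailP ht'; rewrite qE in p0.
have := pos_q_lt t'; rewrite it qE.
have := idx_chi t; rewrite (idx_pos p0) => -> ltp.
have := pos_lt t'; have := pos_lt t; lia.
Qed.

Lemma card_unmatched : #|unmatched| + #|predC hd| = #|hd|.
Proof.
rewrite -(cardID matched hd) addnC; congr (_ + _); last first.
  by apply: eq_card => x; rewrite !inE /unmatched andbC.
rewrite -(card_in_imset opener_tl_inj) -cardsE; apply: eq_card => x; rewrite !inE.
apply/imsetP/andP => [[t ht ->]|[_ /existsP[t /andP[ht /eqP <-]]]]; last by exists t.
by split; [exact: opener_hd|apply/existsP; exists t; rewrite eqxx andbT].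
Qed.

End Height.

(** * The orientation built from a mobile *)

Section Build.
Variables (c : core) (x0 : cN c) (S : nat -> nat).
Local Notation N := (cN c).
Local Notation hd := (@ch c).
Local Notation chi := (@core_chi c).
Local Notation m := (fingraph.order chi x0).
Local Notation xs i := (iter i chi x0).
Hypotheses (cwf : core_wf c) (ctree : core_tree c)
  (S0 : S 0 = 0) (Sup : forall i, i < m -> hd (xs i) -> S i.+1 = (S i).+1)
  (Sdown : forall i, i < m -> ~~ hd (xs i) -> S i = (S i.+1).+1)
  (Spos : forall i, 0 < i <= m -> 0 < S i).

Let chiI : injective chi := @core_chi_inj c.
Let cyc := fun x => core_chi_cycle ctree x0 x.
Local Notation q := (opener chi x0 S).
Local Notation U := (unmatched chi hd x0 S).
Local Notation matched := (matched chi hd x0 S).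

Let q_hd x : hd (q x) := opener_hd cyc S0 Sup Sdown Spos x.
Let q_chi_hd x : hd x -> q (chi x) = x := opener_chi_hd chiI cyc S0 Sup Spos (x := x).
Let q_chi_tl t : ~~ hd t -> q (chi t) = q (q t) := opener_chi_tl chiI cyc S0 Sup Sdown Spos (t := t).
Let q_U u : U u -> U (q u) := opener_unmatched cyc S0 Sup Sdown Spos (u := u).
Let q_U_inj : {in U &, injective q} := opener_unmatched_inj chiI cyc S0 Sup Sdown Spos.
Let q_tl_inj : {in predC hd &, injective q} := opener_tl_inj cyc S0 Sup Sdown Spos.

Let bud_chi t : ~~ hd t -> chi t = cb c t.
Proof. by move=> ht; rewrite /core_chi cwf. Qed.

Lemma hd_cases (P : N -> Prop) : (forall t, ~~ hd t -> P t) -> (forall t, ~~ hd t -> P (q t)) ->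
  (forall u, U u -> P u) -> forall x, P x.
Proof.
move=> Pt Pq PU x; have [hx|/Pt //] := boolP (hd x).
have [/existsP[t /andP[ht /eqP <-]]|nm] := boolP (matched x); first exact: Pq.
by apply: PU; rewrite /unmatched hx.
Qed.

(* The darts of the map: the black half-edges of the mobile, and one dart of the
   root-face for each unmatched edge. *)
Definition map_dart := (N + {u : N | U u})%type.

(** The last [inl x] is never reached: a head that is not matched is in [U]. *)
Definition map_alp (d : map_dart) : map_dart := match d with
  | inl x => if hd x then
      if [pick t | ~~ hd t & q t == x] is Some t then inl t
      else if insub x is Some u then inr u else inl x
    else inl (q x)
  | inr u => inl (val u) end.

Arguments map_alp : simpl never.

Lemma map_alp_tl t : ~~ hd t -> map_alp (inl t) = inl (q t).
Proof. by rewrite /map_alp => /negPf ->. Qed.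

Lemma map_alp_q t : ~~ hd t -> map_alp (inl (q t)) = inl t.
Proof.
move=> ht; rewrite /map_alp q_hd; case: pickP => [t' /andP[ht' /eqP/q_tl_inj ->] //|/(_ t)].
by rewrite ht eqxx.
Qed.

Lemma map_alp_U u (uu : U u) : map_alp (inl u) = inr (Sub u uu).
Proof.
have [hu nm] := andP uu; rewrite /map_alp hu; case: pickP => [t ht|_]; last by rewrite insubT.
by case/negP: nm; apply/existsP; exists t.
Qed.

Lemma map_alpK : involutive map_alp.
Proof.
case=> [x|u]; last first.
  by change (map_alp (inl (val u)) = inr u); rewrite (map_alp_U (valP u)); congr inr; apply: val_inj.
elim/hd_cases: x => [t ht|t ht|u uu].
- by rewrite map_alp_tl // map_alp_q.
- by rewrite map_alp_q // map_alp_tl.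
- by rewrite (map_alp_U uu).
Qed.

(** Faces turn as the black vertices do, and the cycle of unmatched openings closes up into the
    root-face. *)
Definition map_phiV (d : map_dart) : map_dart := match d with
  | inl x => inl (cb c x) | inr u => inr (Sub (q (val u)) (q_U (valP u))) end.

Lemma map_phiV_inj : injective map_phiV.
Proof.
move=> [x|u] [y|v] //= []; first by move/perm_inj->.
move=> /q_U_inj E; congr inr; apply: val_inj; apply: E; exact: valP.
Qed.

Definition map_of_core : fro := @FRO map_dart
  (perm (inv_inj map_alpK) * (perm map_phiV_inj)^-1)%g (perm (inv_inj map_alpK))
  (fun d => if d is inl x then ~~ hd x else true)
  (inr (Sub x0 (unmatched_x0 cyc S0 Sup Sdown Spos))).

Local Notation D := (oD map_of_core).
Local Notation a := (@oalp map_of_core).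
Local Notation s := (@osig map_of_core).
Local Notation out := (@oout map_of_core).

Lemma map_of_core_alp (d : D) : a d = map_alp d. Proof. by rewrite permE. Qed.

Lemma map_of_core_alpK (d : D) : a (a d) = d. Proof. by rewrite !map_of_core_alp map_alpK. Qed.

Lemma map_of_core_phi : ophi map_of_core = (perm map_phiV_inj)^-1%g.
Proof.
apply/permP => d; transitivity ((perm map_phiV_inj)^-1%g (a (a d))); last by rewrite map_of_core_alpK.
by rewrite ophiE; apply: permM.
Qed.

Lemma map_of_core_phiV (d : D) : (ophi map_of_core)^-1%g d = map_phiV d.
Proof. by rewrite map_of_core_phi invgK permE. Qed.

Lemma map_of_core_sV (d : D) : (s^-1)%g d = map_alp (map_phiV d).
Proof.
apply: (@perm_inj _ s); rewrite permKV -map_of_core_alp -ophiE -map_of_core_phiV.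
by rewrite permKV.
Qed.

Lemma map_of_core_root (d : D) : inroot d = if d is inr _ then true else false.
Proof.
rewrite /inroot /samef -porbit_fconnect -porbitV porbit_fconnect.
have it n : forall u, exists v, iter n (ophi map_of_core)^-1%g (inr u : D) = inr v /\ val v = iter n q (val u).
  elim: n => [|n IHn] u; first by exists u.
  have [v [E vE]] := IHn u; rewrite iterS E map_of_core_phiV /=.
  by eexists; split; [reflexivity|rewrite SubK /= vE].
apply/idP/idP => [/iter_findex <-|].
  by have [v [-> _]] := it (findex (ophi map_of_core)^-1%g (oroot map_of_core) d) (Sub x0 (unmatched_x0 cyc S0 Sup Sdown Spos)).
case: d => // u _; rewrite fconnect_sym; last exact: perm_inj.
have := unmatched_cycle cyc S0 Sup Sdown Spos (valP u) => /iter_findex E.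
have [v [Ev vE]] := it (findex q (val u) x0) u.
suff <- : inr v = oroot map_of_core by rewrite -Ev fconnect_iter.
by congr inr; apply: val_inj; rewrite vE E.
Qed.

Lemma map_of_core_or : is_orientation map_of_core.
Proof.
case=> [x|u]; rewrite map_of_core_alp; last by have /andP[hu _] := valP u; rewrite /= hu.
elim/hd_cases: x => [t ht|t ht|u uu].
- by rewrite map_alp_tl //= q_hd ht.
- by rewrite map_alp_q //= q_hd ht.
- by rewrite (map_alp_U uu) /=; case/andP: uu => ->.
Qed.

(** For an outgoing dart, the parent of the opposite head. The inner default is void, since the
    opposite of an outgoing dart is never an added one. *)
Definition map_owner (d : D) : D :=
  if out d then if map_alp d is inl x then inl (q x) else d else d.

Lemma map_owner_tl t : ~~ hd t -> map_owner (inl t) = inl (q (q t)).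
Proof. by move=> ht; rewrite /map_owner /= ht map_alp_tl. Qed.

Lemma map_owner_hd x : hd x -> map_owner (inl x) = inl x.
Proof. by rewrite /map_owner /= => ->. Qed.

Lemma map_owner_alp x : hd x -> map_owner (map_alp (inl x)) = inl (q x).
Proof.
elim/hd_cases: x => [t /negPf-> //|t ht _|u uu _]; first by rewrite map_alp_q // map_owner_tl.
by rewrite (map_alp_U uu).
Qed.

Lemma map_owner_step x : map_owner (map_alp (inl (chi x))) = inl (q (chi x)).
Proof.
have [hx|hx] := boolP (hd (chi x)); first exact: map_owner_alp.
by rewrite map_alp_tl // map_owner_hd // q_hd.
Qed.

Lemma map_owner_in (d : D) : ~~ out (map_owner d).
Proof.
rewrite /map_owner; case: ifPn => // od.
have : ~~ out (map_alp d) by rewrite -map_of_core_alp map_of_core_or od.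
by case: (map_alp d) => [x|u] //= _; rewrite negbK q_hd.
Qed.

Lemma map_owner_tail (d : D) : out d -> map_owner d = map_owner ((s^-1)%g d).
Proof.
rewrite map_of_core_sV; case: d => [t|u] /= ot.
  by rewrite -bud_chi // map_owner_step map_owner_tl // q_chi_tl.
by rewrite map_owner_hd // q_hd.
Qed.

Lemma map_owner_samev (d : D) : samev (map_owner d) d.
Proof.
have sV e : samev ((s^-1)%g e) e.
  by have := fconnect1 s ((s^-1)%g e); rewrite permKV.
have hdv e : ~~ out e -> samev (map_owner e) e.
  by rewrite /map_owner => /negPf ->; apply: connect0.
have [|/hdv //] := boolP (out d); case: d => [t ht|u ou]; last first.
  rewrite map_owner_tail //; apply: samev_trans (hdv _ _) (sV _).
  by rewrite map_of_core_sV /= negbK q_hd.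
move: t ht; apply: (opener_ind chiI cyc S0 Sup Sdown Spos) => t ht IH.
rewrite map_owner_tail //; apply: samev_trans (sV _).
have [|/hdv //] := boolP (out ((s^-1)%g (inl t))).
rewrite map_of_core_sV /= -bud_chi //; have [y yE] : exists y, y = chi t by exists (chi t).
rewrite -yE; elim/hd_cases: y yE => [t' ht' _|t' ht' E|u uu _].
- by rewrite map_alp_tl //= q_hd.
- by rewrite map_alp_q // => _; apply: IH.
rewrite (map_alp_U uu) => _; rewrite map_owner_tail //; apply: samev_trans (hdv _ _) (sV _).
by rewrite map_of_core_sV /= negbK q_hd.
Qed.

Lemma map_of_core_owner : is_owner map_owner.
Proof.
split; [|exact: map_owner_tail|exact: map_owner_in|exact: map_owner_samev].
by move=> d; rewrite /map_owner => /negPf ->.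
Qed.

Lemma map_of_core_has_head (d : D) : exists2 h, samev d h & ~~ out h.
Proof. by exists (map_owner d); [rewrite samev_sym map_owner_samev|exact: map_owner_in]. Qed.

Lemma map_of_core_root_out (d : D) : inroot d -> out d.
Proof. by rewrite map_of_core_root; case: d. Qed.

(** The dart just before [cw c x] is opposite to [chi x], hence owned by [q (chi x)], which is [x]:
    only outgoing darts lie in between. *)
Lemma map_of_core_head_next x : hd x -> head_next (inl x : D) = inl (cw c x).
Proof.
move=> hx; have hwx : hd (cw c x) by rewrite ch_cw.
have sI := @perm_inj _ s; set e := (s^-1)%g (inl (cw c x) : D).
have se : s e = inl (cw c x) by rewrite permKV.
have oe : map_owner e = inl x.
  rewrite /e map_of_core_sV /= -[cb c _]/(chi x) map_owner_step q_chi_hd //.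
rewrite -se; have [oute|ne] := boolP (out e); last first.
  have -> : inl x = e by rewrite -oe /map_owner (negPf ne).
  by rewrite /head_next nextp_step // se /= hwx.
have [i [eE Hi]] := owner_sector map_of_core_owner oute; rewrite oe in eE Hi.
rewrite {1}eE -iterS; apply: nextpE => [|j lt]; first by rewrite iterS -eE se /= hwx.
by have [-> _] := Hi j lt.
Qed.

Lemma map_of_core_drains : drains map_owner.
Proof.
case=> [x|u] //= /negPn hx.
have it n : iter n (par map_owner) (inl x : D) = inl (iter n q x) /\ hd (iter n q x).
  elim: n => // n [IH1 IH2]; rewrite !iterS IH1 /par map_of_core_alp map_owner_alp //.
have [n Un] := opener_drains cyc S0 Sup Sdown Spos hx.
by exists n; rewrite (it n).1 map_of_core_alp (map_alp_U Un) map_of_core_root.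
Qed.

(** The count of [core_of_tree] run backwards; as tails and unmatched openings together are as
    numerous as heads, there is one edge for each head. *)
Lemma map_of_core_plane : is_plane_map map_of_core.
Proof.
have aI := @perm_inj _ a; have sI := @perm_inj _ s.
have aN (d : D) : a d != d by apply/eqP => E; have := map_of_core_or d; rewrite E; case: (out d).
split=> //; first exact: map_of_core_alpK.
  apply/connect_transitive2 => // P Ps Pa x y.
  have Psv (d e : D) : samev d e -> P e = P d by exact: samev_inv.
  have Pphi (d : D) : P ((ophi map_of_core)^-1%g d) = P d.
    by rewrite -[in RHS](permKV (ophi map_of_core) d) ophiE Ps Pa.
  have Pl z w : P (inl z) = P (inl w).
    apply: (proj1 ctree (fun z => P (inl z))) => {z w}z.
      by rewrite -[RHS]Pphi map_of_core_phiV.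
    have [hz|/cwf -> //] := boolP (hd z).
    by rewrite -map_of_core_head_next //; apply/Psv/nextp_fconnect.
  have Pall (d : D) : P d = P (inl x0).
    case: d => [z|u]; first exact: Pl.
    by rewrite -[LHS]Pa map_of_core_alp; apply: Pl.
  by rewrite !Pall.
have cD := card_involution map_of_core_alpK aN.
have cU := card_unmatched cyc S0 Sup Sdown Spos.
have cT : #|{: D}| = #|hd| + #|predC hd| + #|U|.
  by rewrite [LHS](@card_sum N {u : N | U u}) card_sig cardC.
have sum : fcard (cb c) predT + fcard (cw c) predT = #|N| + 1 by case: ctree.
have F : nfaces map_of_core = fcard (cb c) predT + 1.
  have phiVI := @perm_inj _ (ophi map_of_core)^-1%g.
  have -> : nfaces map_of_core = fcard (ophi map_of_core)^-1%g predT.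
    by rewrite /nfaces !fcard_porbits porbitsV.
  rewrite (n_compC [pred d | @inroot map_of_core d]) addnC; congr (_ + _).
    apply: (@fcard_embed _ _ inl) => //; [exact: perm_inj|exact: inl_inj|by move=> z; rewrite map_of_core_phiV|].
    move=> d; change (~~ @inroot map_of_core d <-> exists y : N, inl y = d); rewrite map_of_core_root.
    by case: d => [z|u]; split=> //; [exists z|case].
  rewrite -(n_comp_connect (fconnect_sym phiVI) (oroot map_of_core)); apply: eq_n_comp_r => d.
  change (fconnect (ophi map_of_core) (oroot map_of_core) d = fconnect (ophi map_of_core)^-1%g (oroot map_of_core) d).
  by rewrite -!porbit_fconnect porbitV.
have V : nverts map_of_core + #|predC hd| = fcard (cw c) predT.
  rewrite [RHS](n_compC hd) (@fcard_fix _ (cw c) (predC hd)); last by move=> x /cwf.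
  congr (_ + _); rewrite fcard_cw_heads //.
  have shI := shat_inj map_of_core_has_head.
  rewrite /nverts -(@fcard_nextp _ s (@shat map_of_core) (fun d => ~~ out d)) //; last first.
  - by move=> d /negPf od; rewrite /shat od.
  - by move=> d; have [h] := map_of_core_has_head d; exists h.
  apply: (@fcard_embed _ _ (fun h : {x : N | hd x} => inl (val h) : D)) => //.
  - exact: sub_cw_inj.
  - by move=> h k [] /val_inj.
  - by move=> h; rewrite val_sub_cw // /shat /= (valP h) /= map_of_core_head_next // (valP h).
  case=> [z|u] /=; split=> //; last by case.
    by rewrite negbK => hz; exists (Sub z hz).
  by case=> h [<-]; rewrite negbK; apply: (valP h).
rewrite F; rewrite -/(nedgs map_of_core) in cD.
have cN' := cardC hd; move: cD cU cT sum V cN'; move: #|U| #|hd| #|predC hd| #|N| #|_|.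
move: (nverts _) (nedgs _) (fcard (cb c) predT) (fcard (cw c) predT) => *; lia.
Qed.

Lemma map_of_core_in_O : in_O map_of_core.
Proof.
have pl := map_of_core_plane; have ow := map_of_core_owner.
split=> //; first exact: map_of_core_or.
  split; first exact: (drains_minimal pl map_of_core_or ow map_of_core_drains).
  move=> d od _; apply/negP => /map_of_core_root_out.
  by rewrite map_of_core_or od.
exact: (drains_accessible pl map_of_core_or ow map_of_core_drains map_of_core_root_out).
Qed.

Lemma map_of_core_core (h : pred N) (h' : pred D) ro hh : (forall x, h' (inl x) = h x) ->
  core_iso (Core (cb c) (cw c) h) (@core_of map_of_core ro hh h').
Proof.
move=> hE; have nr x : ~~ @inroot map_of_core (inl x) by rewrite map_of_core_root.
exists (fun x => Sub (inl x : D) (nr x)); split.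
- apply: inj_surj_bij => [x y /(congr1 val) [] //|[[x|u] /= rx]].
    by exists x; apply: val_inj.
  by exfalso; rewrite map_of_core_root in rx.
- by move=> x; apply: val_inj; rewrite core_of_cb /= map_of_core_phiV.
- move=> x; apply: val_inj; rewrite core_of_cw /= /shat /=.
  by case: ifPn => [/cwf -> //|/negPn hx]; rewrite map_of_core_head_next.
- by move=> x /=; rewrite hE.
Qed.

Lemma map_of_core_mopen x : @mopen map_of_core (inl x) = hd x && matched x.
Proof.
rewrite /mopen map_of_core_alp /= negbK; have [hx|//] /= := boolP (hd x).
elim/hd_cases: x hx => [t /negPf-> //|t ht _|u uu _].
  rewrite map_alp_q // map_of_core_root; apply/esym/existsP; exists t; by rewrite ht /=.
rewrite (map_alp_U uu) map_of_core_root; apply/esym/negbTE.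
by case/andP: uu.
Qed.

(** The owner of an added dart is an unmatched opening; fixed by [cw], it is the only head at its
    vertex. *)
Lemma map_of_core_admissible : (forall u, U u -> cw c u = u) -> admissible map_of_core.
Proof.
move=> fixU; have sI := @perm_inj _ s.
have own (u : {u : N | U u}) : map_owner (inr u) = inl (q (val u)) by [].
have single (u : {u : N | U u}) (h : D) : samev (inr u : D) h -> ~~ out h -> h = inl (q (val u)).
  move=> uh oh; have : fconnect s (inl (q (val u)) : D) h.
    by apply: samev_trans uh; rewrite -own map_owner_samev.
  have oq : ~~ out (inl (q (val u))) by rewrite /= negbK q_hd.
  rewrite -(@fconnect_nextp _ s (fun d => ~~ out d)) // => /iter_findex <-.
  have fixq : head_next (inl (q (val u)) : D) = inl (q (val u)).
    by rewrite map_of_core_head_next ?q_hd // fixU // q_U // (valP u).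
  by elim: (findex _ _ _) => //= n ->; exact: fixq.
split.
- move=> [x|u] [y|v]; rewrite !map_of_core_root // => _ _ uv; congr inr; apply: val_inj.
  have := single u (map_owner (inr v)); rewrite own => H.
  apply: q_U_inj; [exact: (valP u)|exact: (valP v)|].
  have [] // : (inl (q (val v)) : D) = inl (q (val u)).
  apply: H; last by rewrite /= negbK q_hd.
  by apply: samev_trans uv _; rewrite samev_sym -own map_owner_samev.
- by move=> d /map_of_core_root_out od; apply/negP => /map_of_core_root_out; rewrite map_of_core_or od.
case=> [x|u]; rewrite map_of_core_root // => _.
rewrite -(card1 (inl (q (val u)) : D)); apply: eq_card => d; rewrite !inE.
apply/andP/eqP => [[ud od]|->]; first exact: single.
by rewrite -own samev_sym map_owner_samev own /= negbK q_hd.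
Qed.

End Build.

(** * Choice of the starting point of the contour *)

Section Walk.
Local Open Scope ring_scope.
Variables (h : nat -> int) (m : nat) (K : int).
Hypotheses (m0 : (0 < m)%N) (h0 : h 0%N = 0)
  (hstep : forall i, h i.+1 = h i + 1 \/ h i.+1 = h i - 1)
  (hper : forall i, h (i + m)%N = h i + K).

Lemma walk_bound i : - i%:Z <= h i <= i%:Z.
Proof. by elim: i => [|i IHi]; rewrite ?h0 //; case: (hstep i) => ->; lia. Qed.

Lemma walk_period n i : h (i + n * m)%N = h i + n%:Z * K.
Proof.
elim: n => [|n IHn]; first by rewrite mul0n addn0 mul0r addr0.
by rewrite mulSn addnCA addnC hper IHn; lia.
Qed.

Lemma walk_last_passage : 0 < K -> exists i0, forall j, (0 < j)%N -> h i0 < h (i0 + j)%N.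
Proof.
(* After [m] periods the gain is at least [m], more than an incomplete period can lose; the
   nonpositive heights are therefore bounded in time and have a last one. *)
move=> Kpos; have big i : (m * m <= i)%N -> 0 < h i.
  move=> le; rewrite (divn_eq i m) addnC walk_period.
  have le1 : (m <= i %/ m)%N by rewrite leq_divRL.
  have le2 := ltn_pmod i m0; have le3 := walk_bound (i %% m).
  move: le1 le2 le3; set q := (i %/ m)%N; set r := (i %% m)%N; move: (h r) => x.
  by clearbody q r => *; nia.
have ex : exists i, h i <= 0 by exists 0%N; rewrite h0.
have bd i : h i <= 0 -> (i <= m * m)%N.
  by move=> hi; rewrite leqNgt; apply/negP => /ltnW/big; lia.
case: (ex_maxnP ex bd) => i0 hi0 imax; exists i0 => j j0.
suff : ~~ (h (i0 + j)%N <= 0) by lia.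
by apply/negP => /imax; lia.
Qed.

Lemma walk_first_passage : K < 0 -> exists i0, h i0.+1 = h i0 - 1 /\
  forall j, (j <= m)%N -> h (i0 + m)%N <= h (i0 + j)%N.
Proof.
(* A walk of unit steps needs more than [m] steps to reach this level, so a full period lies before
   [i0]; there heights are at least that of [i0], and periodicity carries this forward. *)
move=> Kneg; have ex : exists i, h i <= - (m.+1)%:Z.
  by exists (m.+1 * m)%N; rewrite -[(_ * m)%N]add0n walk_period h0; nia.
case: (ex_minnP ex) => i1 hi1 imin.
have lt : (m < i1)%N by have := walk_bound i1; lia.
case: i1 hi1 imin lt => // i0 hi1 imin lt; exists i0.
have low i : (i <= i0)%N -> - m%:Z <= h i.
  move=> le; have : ~~ (h i <= - (m.+1)%:Z) by apply/negP => /imin; lia.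
  by lia.
have e0 := low i0 (leqnn _); have st := hstep i0.
split=> [|j jm]; first by lia.
have -> : (i0 + j = (i0 + j - m) + m)%N by lia.
have := low (i0 + j - m)%N; rewrite !hper; lia.
Qed.

End Walk.

Lemma sum_orbit (T : finType) (f : T -> T) z (F : T -> int) : injective f ->
  (forall x, fconnect f z x) ->
  (\sum_(l < fingraph.order f z) F (iter l f z) = \sum_x F x)%R.
Proof.
move=> fI cyc; rewrite -(big_mkord xpredT (fun l => F (iter l f z))).
transitivity (\sum_(x <- fingraph.orbit f z) F x)%R.
  rewrite (big_nth z) size_orbit !big_nat; apply: eq_bigr => i /andP[_ lt].
  by rewrite /fingraph.orbit nth_traject.
rewrite big_uniq ?orbit_uniq //; apply: eq_bigl => x.
by rewrite -fconnect_orbit cyc.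
Qed.

Section Rotation.
Variable c : core.
Local Notation N := (cN c).
Local Notation hd := (@ch c).
Local Notation chi := (@core_chi c).
Hypotheses (cwf : core_wf c) (ctree : core_tree c).
Let chiI : injective chi := @core_chi_inj c.
Let cyc := core_chi_cycle ctree.

Section Start.
Variable z : N.
Local Notation m := (fingraph.order chi z).
Let e (x : N) : int := if hd x then 1%R else (-1)%R.
Let h i : int := (\sum_(l < i) e (iter l chi z))%R.

Let hS i : h i.+1 = (h i + e (iter i chi z))%R. Proof. exact: big_ord_recr. Qed.
Let h0 : h 0 = 0%R. Proof. exact: big_ord0. Qed.
Let hstep i : h i.+1 = (h i + 1)%R \/ h i.+1 = (h i - 1)%R.
Proof. by rewrite hS /e; case: ifP; [left|right]. Qed.

Let htot : h m = (#|hd|%:Z - #|predC hd|%:Z)%R.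
Proof.
rewrite /h sum_orbit // (bigID hd) /=; congr (_ + _)%R.
  rewrite (eq_bigr (fun => 1%R)) => [|x]; last by rewrite /e => ->.
  by rewrite sumr_const; lia.
rewrite (eq_bigr (fun => (-1)%R)) => [|x]; last by rewrite /e => /negPf ->.
by rewrite sumr_const (eq_card (B := predC hd)) //; lia.
Qed.

Let hper i : h (i + m) = (h i + (#|hd|%:Z - #|predC hd|%:Z))%R.
Proof.
rewrite -htot; elim: i => [|i IHi]; first by rewrite h0 add0r.
by rewrite addSn !hS IHi iterD iter_order //; lia.
Qed.

(** The contour starts at the last passage; [absz] loses nothing, as heights relative to it are
    never negative. *)
Lemma positive_height : #|predC hd| < #|hd| -> exists (x0 : N) S, [/\ S 0 = 0,
  forall i, hd (iter i chi x0) -> S i.+1 = (S i).+1,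
  forall i, ~~ hd (iter i chi x0) -> S i = (S i.+1).+1 &
  forall i, 0 < i -> 0 < S i].
Proof.
move=> lt; have [|i0 Hi] := @walk_last_passage h m _ (fingraph.order_gt0 _ _) h0 hstep hper.
  by lia.
have Hi' i : (h i0 <= h (i0 + i))%R by case: i => [|i]; rewrite ?addn0 //; have := Hi i.+1 isT; lia.
exists (iter i0 chi z), (fun j => absz (h (i0 + j) - h i0)); split.
- by rewrite addn0 subrr.
- move=> i; rewrite -iterD addnC => hi; have := Hi' i; have := Hi' i.+1.
  by rewrite addnS hS /e hi; lia.
- move=> i; rewrite -iterD addnC => /negPf hi; have := Hi' i; have := Hi' i.+1.
  by rewrite addnS hS /e hi; lia.
- by move=> i /Hi; lia.
Qed.

(** A turn that starts with a first passage to a new minimum ends at its own minimum, so no opening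
    is pending at its end. *)
Lemma negative_start : #|hd| < #|predC hd| -> exists (x0 : N) (g : nat -> int), [/\ ~~ hd x0,
  g 0 = 0%R, forall i, g i.+1 = (g i + e (iter i chi x0))%R &
  forall i, i <= fingraph.order chi x0 -> (g (fingraph.order chi x0) <= g i)%R].
Proof.
move=> lt; have [|i0 [Hd Hi]] := @walk_first_passage h m _ (fingraph.order_gt0 _ _) h0 hstep hper.
  by lia.
have om : fingraph.order chi (iter i0 chi z) = m.
  apply: eq_card => x; rewrite !inE; apply: esym.
  exact: (same_connect (fconnect_sym chiI) (fconnect_iter _ i0 z) x).
exists (iter i0 chi z), (fun j => h (i0 + j) - h i0)%R; rewrite om; split.
- by move: Hd; rewrite hS /e; case: ifP => // _; lia.
- by rewrite addn0 subrr.
- by move=> i; rewrite addnS hS -iterD addnC; lia.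
- by move=> i /Hi; lia.
Qed.
End Start.

Section Stack.
Variable x0 : N.
Local Notation m := (fingraph.order chi x0).
Local Notation xs i := (iter i chi x0).

(* [stack j] is the number of unmatched non-buds before time [j], [record j]
   the number of buds met while the stack was empty. *)
Fixpoint stack j := if j is i.+1 then if hd (xs i) then (stack i).+1 else (stack i).-1 else 0.
Fixpoint record j := if j is i.+1 then record i + (~~ hd (xs i) && (stack i == 0)) else 0.

(** A bud met with an empty stack has nothing to close; it is reread as an opening, and each such
    opening raises the base level of [flip_height] for good. *)
Definition flip (x : N) := hd x || (stack (findex chi x0 x) == 0).
Definition flip_height j := stack j + record j.

Hypotheses (hx0 : ~~ hd x0) (stack_m : stack m = 0).

Lemma flip_xs i : i < m -> flip (xs i) = hd (xs i) || (stack i == 0).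
Proof. by move=> lt; rewrite /flip findex_iter. Qed.

Lemma flip_up i : i < m -> flip (xs i) -> flip_height i.+1 = (flip_height i).+1.
Proof.
move=> lt; rewrite flip_xs // /flip_height /=; case: (hd _) => /= [_|/eqP ->]; first by rewrite addn0.
by rewrite addn1.
Qed.

Lemma flip_down i : i < m -> ~~ flip (xs i) -> flip_height i = (flip_height i.+1).+1.
Proof.
move=> lt; rewrite flip_xs // negb_or /flip_height /= => /andP[/negPf -> /negPf s0] /=.
by rewrite s0 addn0; move: s0; case: (stack i) => //.
Qed.

Lemma record_mono i j : i <= j -> record i <= record j.
Proof.
move=> le; rewrite -(subnK le); elim: (j - i) => //= n IHn.
by rewrite (leq_trans IHn) // leq_addr.
Qed.

Lemma flip_pos i : 0 < i <= m -> 0 < flip_height i.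
Proof.
move=> /andP[i0 _]; rewrite /flip_height addn_gt0; apply/orP; right.
by apply: (leq_trans _ (record_mono i0)); rewrite /= hx0.
Qed.

Local Notation matched := (matched chi flip x0 flip_height).
Local Notation unmatched := (unmatched chi flip x0 flip_height).

Let S0 : flip_height 0 = 0. Proof. by []. Qed.
Let cyc0 x : fconnect chi x0 x. Proof. exact: cyc. Qed.

(** The stack ends empty, so it falls back below each non-bud while [record] stands still, which
    closes it. A reread bud has raised [record], and the height never returns to its level. *)
Lemma flip_matched x : flip x && matched x = hd x.
Proof.
have lt : findex chi x0 x < m by apply: findex_max.
have xE : xs (findex chi x0 x) = x by apply: iter_findex.
have [hx|hx] := boolP (hd x); last first.
  apply/negbTE/negP => /andP[fx /existsP[t /andP[ht /eqP qE]]].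
  have [] := opener_tl_height cyc0 S0 flip_up flip_down flip_pos ht.
  rewrite qE => E ltx; have s0 : stack (findex chi x0 x) = 0.
    by apply/eqP; move: fx; rewrite /flip (negPf hx).
  have := record_mono (i := (findex chi x0 x).+1) (j := (findex chi x0 t).+1).
  have rE : record (findex chi x0 x).+1 = (record (findex chi x0 x)).+1.
    by rewrite /= xE hx s0 addn1.
  by rewrite ltnS (ltnW ltx) rE => /(_ isT); move: E; rewrite /flip_height s0; lia.
rewrite /flip hx; apply: contraT => nm.
have ux : unmatched x by rewrite /unmatched /flip hx.
set j := findex chi x0 x in lt xE.
have ex : exists r, [&& j < r, r <= m & stack r <= stack j].
  by exists m; rewrite lt leqnn stack_m.
case: (ex_minnP ex) => r /and3P[jr rm le] rmin.
have above k : j < k < r -> stack j < stack k.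
  move=> /andP[jk kr]; rewrite ltnNge; apply/negP => le'.
  by have := rmin k; rewrite jk le' (leq_trans (ltnW kr) rm) => /(_ isT); rewrite leqNgt kr.
have rec k : j < k -> k <= r -> record k = record j.
  elim: k => // k IHk; rewrite ltnS leq_eqVlt => /orP[/eqP <-|jk] kr.
    by rewrite /= xE hx addn0.
  rewrite /= IHk ?(ltnW kr) //; have := above k; rewrite jk kr => /(_ isT).
  by case: (stack k) => // n _; rewrite andbF addn0.
have := unmatched_height cyc0 S0 flip_up flip_down flip_pos (u := x) (r := r) ux.
by rewrite -/j jr rm => /(_ isT); rewrite /flip_height rec //; lia.
Qed.

End Stack.

Lemma core_iso_wf c1 c2 : core_iso c1 c2 -> core_wf c1 -> core_wf c2.
Proof.
case=> g [[g' gK g'K] _ gw gc] wf x; rewrite -[x]g'K gc => /wf E.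
by rewrite -gw E.
Qed.

Lemma core_surjP : #|predC hd| < #|hd| ->
  exists2 O, in_O O & mob_iso (PhiP O) (mob_core c).
Proof.
move=> lt; have /card_gt0P[z _] : 0 < #|hd| by apply: leq_trans lt.
have [x0 [S [S0 Su Sd Sp]]] := positive_height z lt.
have Su' i (_ : i < fingraph.order chi x0) := Su i.
have Sd' i (_ : i < fingraph.order chi x0) := Sd i.
have Sp' i : 0 < i <= fingraph.order chi x0 -> 0 < S i by case/andP=> /Sp.
exists (map_of_core ctree S0 Su' Sd' Sp'); first exact: map_of_core_in_O.
have hh := @map_of_core_has_head _ _ _ cwf ctree S0 Su' Sd' Sp'.
have ro := @map_of_core_root_out _ _ _ ctree S0 Su' Sd' Sp'.
have iso : core_iso (Core (cb c) (cw c) hd) (core_of ro hh (fun d => ~~ oout d)).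
  by apply: map_of_core_core => // x; rewrite /= negbK.
have wf1 : core_wf (Core (cb c) (cw c) hd) by [].
apply: mob_iso_trans (mob_iso_sym (PhiP_core ro hh)) _.
apply: (@mob_iso_trans _ (mob_core (Core (cb c) (cw c) hd))).
  by apply/mob_core_iso; [exact: core_iso_wf iso _|exact: wf1|exact: core_iso_sym].
by apply/mob_core_iso => //; exists id; split=> //; exists id.
Qed.

Lemma core_surjM : #|hd| < #|predC hd| ->
  exists2 O, in_Ot O & mob_iso (PhiM O) (mob_core c).
Proof.
move=> lt; have /card_gt0P[z _] : 0 < #|predC hd| by apply: leq_trans lt.
have [x0 [g [hx0 g0 gS gm]]] := negative_start z lt.
(* [record] grows only while the stack is empty, where it is the opposite of [g]; the final minimum
   of [g] thus bounds it and forces the stack to end empty. *)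
have gE i : g i = ((stack x0 i)%:Z - (record x0 i)%:Z)%R /\
    (i <= fingraph.order chi x0 -> ((record x0 i)%:Z <= - g (fingraph.order chi x0))%R).
  elim: i => [|i [IH1 IH2]]; first by split=> [|_]; rewrite ?g0 //=; have := gm 0 isT; rewrite g0; lia.
  have gi := gS i; move: gi; rewrite IH1 /=; case: (hd _) => /= gi.
    by split; [lia|move=> /ltnW/IH2; rewrite addn0].
  case s0: (stack x0 i) gi => [|n] gi /=; last first.
    by split; [lia|move=> /ltnW/IH2; rewrite addn0].
  by split; [lia|move=> /gm; lia].
have stack_m : stack x0 (fingraph.order chi x0) = 0.
  by have [E /(_ (leqnn _))] := gE (fingraph.order chi x0); lia.
pose c' := Core (cb c) (cw c) (flip x0).
have cwf' : core_wf c' by move=> x /=; rewrite negb_or => /andP[/cwf].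
have S0 : flip_height x0 0 = 0 by [].
have Su := @flip_up x0; have Sd := @flip_down x0; have Sp := flip_pos hx0.
have ctree' : core_tree c' := ctree.
pose O := @map_of_core c' x0 (flip_height x0) ctree' S0 Su Sd Sp.
have inO : in_O O by apply: map_of_core_in_O.
have pl := @map_of_core_plane c' x0 (flip_height x0) cwf' ctree' S0 Su Sd Sp.
have or := @map_of_core_or c' x0 (flip_height x0) ctree' S0 Su Sd Sp.
have hh := @map_of_core_has_head c' x0 (flip_height x0) cwf' ctree' S0 Su Sd Sp.
have ro := @map_of_core_root_out c' x0 (flip_height x0) ctree' S0 Su Sd Sp.
(* The unmatched openings are the reread buds, which [cw] fixes. *)
have adm : admissible O.
  apply: map_of_core_admissible => // u /andP[fu nm]; apply: cwf; apply: contra nm => hu.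
  by move: (flip_matched hx0 stack_m u); rewrite hu => /andP[].
exists O => //.
have iso : core_iso (Core (cb c) (cw c) hd) (core_of ro hh (@mopen O)).
  apply: (@map_of_core_core c' x0 (flip_height x0) cwf' ctree' S0 Su Sd Sp) => x.
  by rewrite map_of_core_mopen; exact: flip_matched.
have wf1 : core_wf (Core (cb c) (cw c) hd) by [].
apply: mob_iso_trans (mob_iso_sym (PhiM_core pl or ro hh adm)) _.
apply: (@mob_iso_trans _ (mob_core (Core (cb c) (cw c) hd))).
  by apply/mob_core_iso; [exact: core_iso_wf iso _|exact: wf1|exact: core_iso_sym].
by apply/mob_core_iso => //; exists id; split=> //; exists id.
Qed.

End Rotation.

(** * The two bijections *)

Section Final.
Variable O : fro.
Hypothesis inO : in_O O.

Lemma in_O_facts : [/\ is_plane_map O, is_orientation O,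
  forall x : oD O, inroot x -> oout x,
  forall x : oD O, exists2 h, samev x h & ~~ oout h &
  exists2 o : oD O -> oD O, is_owner o & drains o].
Proof.
have [pl or cw acc] := inO.
have ro := cw_root_out pl or cw; have hh := cw_has_head pl or cw acc.
split=> //; have [o oP] := owner_exists hh; exists o => //.
exact: (in_O_drains pl or cw acc oP).
Qed.

Lemma outdeg_gt0 : 0 < outdeg O.
Proof. by apply/card_gt0P; exists (oroot O); rewrite inE inroot_root. Qed.

Lemma PhiP_mobile : is_pbmobile (PhiP O) /\ excess (PhiP O) = (outdeg O)%:Z%R.
Proof.
have [pl or ro hh [o oP dr]] := in_O_facts; have iso := PhiP_core ro hh.
have wf := @core_of_wfP _ ro hh; split.
  apply: (mob_iso_pbmobile iso); apply/(mob_core_pbmobile wf).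
  exact: (core_of_tree pl or ro hh oP dr).
by rewrite -(mob_iso_excess iso) excess_mob_core core_of_excess.
Qed.

Lemma PhiM_mobile : admissible O ->
  is_pbmobile (PhiM O) /\ excess (PhiM O) = (- (outdeg O)%:Z)%R.
Proof.
move=> adm; have [pl or ro hh [o oP dr]] := in_O_facts.
have iso := PhiM_core pl or ro hh adm.
have wf := @core_of_wfM _ pl or ro hh adm; split.
  apply: (mob_iso_pbmobile iso); apply/(mob_core_pbmobile wf).
  exact: (core_of_tree pl or ro hh oP dr).
by rewrite -(mob_iso_excess iso) excess_mob_core core_of_excessM.
Qed.

End Final.

Lemma PhiP_iso (O1 O2 : fro) : in_O O1 -> in_O O2 ->
  (fro_iso O1 O2 <-> mob_iso (PhiP O1) (PhiP O2)).
Proof.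
move=> /in_O_facts[pl1 or1 ro1 hh1 [o1 oP1 dr1]] /in_O_facts[pl2 or2 ro2 hh2 [o2 oP2 dr2]].
have i1 := PhiP_core ro1 hh1; have i2 := PhiP_core ro2 hh2.
have w1 := @core_of_wfP _ ro1 hh1; have w2 := @core_of_wfP _ ro2 hh2.
split=> [iso|iso].
  apply: mob_iso_trans (mob_iso_sym i1) _; apply: mob_iso_trans i2.
  apply/(mob_core_iso w1 w2); apply: fro_iso_core iso => f _ _ fo _ x.
  by rewrite fo.
apply: (@core_iso_froP _ _ _ _ _ _ _ _ ro2 hh2 o1 o2) => //.
apply/(mob_core_iso w1 w2).
by apply: mob_iso_trans i1 _; apply: mob_iso_trans iso (mob_iso_sym i2).
Qed.

Lemma PhiM_iso (O1 O2 : fro) : in_Ot O1 -> in_Ot O2 ->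
  (fro_iso O1 O2 <-> mob_iso (PhiM O1) (PhiM O2)).
Proof.
case=> /in_O_facts[pl1 or1 ro1 hh1 [o1 oP1 dr1]] ad1.
case=> /in_O_facts[pl2 or2 ro2 hh2 [o2 oP2 dr2]] ad2.
have i1 := PhiM_core pl1 or1 ro1 hh1 ad1; have i2 := PhiM_core pl2 or2 ro2 hh2 ad2.
have w1 := @core_of_wfM _ pl1 or1 ro1 hh1 ad1; have w2 := @core_of_wfM _ pl2 or2 ro2 hh2 ad2.
split=> [iso|iso].
  apply: mob_iso_trans (mob_iso_sym i1) _; apply: mob_iso_trans i2.
  apply/(mob_core_iso w1 w2); apply: fro_iso_core iso => f _ fa fo fr x.
  by rewrite /mopen fo -fa fr.
apply: (@core_iso_froM _ _ _ _ _ _ _ _ ro2 hh2 o1 o2) => //.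
apply/(mob_core_iso w1 w2).
by apply: mob_iso_trans i1 _; apply: mob_iso_trans iso (mob_iso_sym i2).
Qed.

Lemma mobile_core_tree (M : mobile) : is_pbmobile M -> exists c,
  [/\ core_wf c, core_tree c, mob_iso (mob_core c) M &
      excess M = (#|@ch c|%:Z - #|predC (@ch c)|%:Z)%R].
Proof.
move=> pM; have [c wf iso] := mobile_core pM; exists c; split=> //.
  by apply/(mob_core_pbmobile wf); apply: mob_iso_pbmobile pM; apply: mob_iso_sym.
by rewrite -(mob_iso_excess iso) excess_mob_core.
Qed.

Local Open Scope ring_scope.

Theorem theorem8 :
  (* (1) Phi_+ : O -> mobiles of positive excess *)
  ((forall O : fro, in_O O ->
      [/\ is_pbmobile (PhiP O), 0 < excess (PhiP O)
        & excess (PhiP O) = (outdeg O)%:Z]) /\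
   (forall O1 O2 : fro, in_O O1 -> in_O O2 ->
      (fro_iso O1 O2 <-> mob_iso (PhiP O1) (PhiP O2))) /\
   (forall M : mobile, is_pbmobile M -> 0 < excess M ->
      exists2 O : fro, in_O O & mob_iso (PhiP O) M)) /\
  (* (2) Phi_- : admissible O -> mobiles of negative excess *)
  ((forall O : fro, in_Ot O ->
      [/\ is_pbmobile (PhiM O), excess (PhiM O) < 0
        & excess (PhiM O) = - (outdeg O)%:Z]) /\
   (forall O1 O2 : fro, in_Ot O1 -> in_Ot O2 ->
      (fro_iso O1 O2 <-> mob_iso (PhiM O1) (PhiM O2))) /\
   (forall M : mobile, is_pbmobile M -> excess M < 0 ->
      exists2 O : fro, in_Ot O & mob_iso (PhiM O) M)).
Proof.
split; split.
- move=> O inO; have [pM eM] := PhiP_mobile inO; split=> //.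
  by rewrite eM; have := outdeg_gt0 O; lia.
- split=> [|M pM]; first exact: PhiP_iso.
  have [c [wf tr iso ->]] := mobile_core_tree pM => pos.
  have [|O inO iO] := core_surjP wf tr; first by lia.
  by exists O => //; apply: mob_iso_trans iO iso.
- move=> O [inO adm]; have [pM eM] := PhiM_mobile inO adm; split=> //.
  by rewrite eM; have := outdeg_gt0 O; lia.
- split=> [|M pM]; first exact: PhiM_iso.
  have [c [wf tr iso ->]] := mobile_core_tree pM => neg.
  have [|O inO iO] := core_surjM wf tr; first by lia.
  by exists O => //; apply: mob_iso_trans iO iso.
Qed.
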